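(* For every function $f\in L^1(\mathbb{T})$ we have $$\frac{1}{2\pi}\left|\left\{\xi\in\mathbb{T} : \mathcal{H}^{\mathbb{T}}f(\xi)\geq 1\right\}\right| \leq \frac4\pi\arctan\left(\exp\left(\frac\pi2\|f\|_1\right)\right)-1.$$ Moreover, for every $m\in[0,1)$ there exists a function $f\in L^1(\mathbb{T})$ for which both sides of this inequality are equal to $m$.
   Context: $\mathbb{T}$ is the unit circle in $\mathbb{C}$, $|A|$ denotes the arc-length measure of $A\subset\mathbb{T}$ (so $|\mathbb{T}|=2\pi$). Functions are real-valued, and $\|f\|_p$ is the $L^p$-norm with respect to the normalized Haar measure on $\mathbb{T}$, i.e. $\|f\|_p^p=\frac1{2\pi}\int_{-\pi}^{\pi}|f(e^{is})|^p\,ds$. The Hilbert transform on the circle is the singular integral (defined for almost every $t$) $$\mathcal{H}^{\mathbb{T}}f(e^{it})=\frac1{2\pi}\,\mathrm{p.v.}\int_{-\pi}^{\pi}f(e^{is})\cot\frac{t-s}{2}\,ds,\qquad f\in L^1(\mathbb{T}).$$ *)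

(* Defs.v *)
From HB Require Import structures.
From mathcomp Require Import all_boot all_order all_algebra.
From mathcomp Require Import complex ring.
From mathcomp Require Import all_classical all_reals all_analysis.

Set Implicit Arguments.
Unset Strict Implicit.
Unset Printing Implicit Defensive.

Import Order.TTheory GRing.Theory Num.Theory.
Import numFieldNormedType.Exports.

Local Open Scope classical_set_scope.
Local Open Scope ring_scope.

(* A function on the unit circle is used through its pullback by expi,
   s |-> e^(is), integrated over [-pi, pi] for Lebesgue measure. *)
Definition circle (R : realType) := {z : R[i] | `|z| == 1}.

Lemma norm_cos_sin (R : realType) (t : R) :
  `|Complex (cos t) (sin t)| == 1 :> R[i].
Proof. by rewrite normc_def /= cos2Dsin2 sqrtr1. Qed.

Definition expi (R : realType) (t : R) : circle R :=
  exist _ (Complex (cos t) (sin t)) (norm_cos_sin t).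

(* The argument in ]-pi, pi]. *)
Definition carg (R : realType) (xi : circle R) : R :=
  let: Complex x y := val xi in if 0 <= y then acos x else - acos x.

Lemma cargK (R : realType) : cancel (@carg R) (@expi R).
Proof.
move=> [[x y] xy1]; apply/val_inj; rewrite /carg /=.
have xy : x ^+ 2 + y ^+ 2 = 1.
  move: xy1 => /eqP; rewrite normc_def /= => -[] xy1.
  rewrite -[LHS]sqr_sqrtr ?addr_ge0 ?sqr_ge0// xy1 expr1n //.
have x1 : -1 <= x <= 1.
  by rewrite -ler_norml -(@expr_le1 _ 2)// real_normK ?num_real// -xy lerDl sqr_ge0.
have y2 : 1 - x ^+ 2 = y ^+ 2 by rewrite -xy addrC addKr.
case: ifPn => [y0|]; last rewrite -ltNge => y0.
- by rewrite acosK ?in_itv// sin_acos// y2 sqrtr_sqr ger0_norm.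
- by rewrite cosN sinN acosK ?in_itv// sin_acos// y2 sqrtr_sqr ltr0_norm// opprK.
Qed.

Definition cot (R : realType) (x : R) : R := cos x / sin x.

Definition arclength (R : realType) (A : set (circle R)) : \bar R :=
  @lebesgue_measure R [set t : R | - pi < t <= pi /\ A (expi t)].

Definition L1_circle (R : realType) (f : circle R -> R) : Prop :=
  (@lebesgue_measure R).-integrable `[- pi, pi]%classic
    (EFin \o (f \o @expi R)).

Definition L1norm_circle (R : realType) (f : circle R -> R) : R :=
  (2 * pi)^-1 *
  \int[@lebesgue_measure R]_(s in `[- pi, pi]%classic) `|f (expi s)|.

(* [-pi, pi] without the points s such that e^(is) is eps-close to e^(it). Using
   the distance in C rather than |t - s| also removes the points near t +/- 2 pi,
   at which the cotangent kernel is singular when t is close to +/- pi. *)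
Definition truncated_period (R : realType) (t eps : R) : set R :=
  [set s | - pi <= s <= pi /\
    (real_complex R eps < `|val (expi s) - val (expi t)| :> R[i])].

Definition truncated_hilbert (R : realType) (f : circle R -> R) (t eps : R) : R :=
  (2 * pi)^-1 * \int[@lebesgue_measure R]_(s in truncated_period t eps)
     (f (expi s) * cot ((t - s) / 2)).

(* Principal value; at the points where the limit does not exist, lim is 0.
   See hilbertE for an arbitrary argument t of xi. *)
Definition hilbert (R : realType) (f : circle R -> R) (xi : circle R) : R :=
  lim (truncated_hilbert f (carg xi) eps @[eps --> 0^'+]).

Lemma cot_half (R : realType) (x : R) : cot (x / 2) = sin x / (1 - cos x).
Proof.
have xE : x = (x / 2) *+ 2 by rewrite -mulr_natr mulfVK.
rewrite {2 3}xE /cot sin_mulr2n cos_mulr2n.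
set c := cos _; set s := sin _.
have cs : c ^+ 2 = 1 - s ^+ 2 by rewrite /c /s cos2sin2.
have -> : 1 - (c ^+ 2 *+ 2 - 1) = s * s *+ 2.
  by rewrite cs; ring.
have [->|s0] := eqVneq s 0; first by rewrite !(mulr0, mul0r, mul0rn, invr0).
by field.
Qed.

Lemma hilbertE (R : realType) (f : circle R -> R) (t : R) :
  hilbert f (expi t) = lim (truncated_hilbert f t eps @[eps --> 0^'+]).
Proof.
have := cargK (expi t); rewrite /hilbert; set u := carg _ => ut.
suff -> : truncated_hilbert f u = truncated_hilbert f t by [].
apply/funext => eps; rewrite /truncated_hilbert /truncated_period ut.
congr (_ * Rintegral _ _ _); apply/funext => s.
have [cE sE] : cos u = cos t /\ sin u = sin t by case: ut.
by rewrite !cot_half !cosB !sinB cE sE.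
Qed.

(* Main.v *)
(** Upper bound. Let [v] be the conjugate Poisson integral of [f] on a circle of radius [r < 1]
and [E = {v >= k}]. The map [strip_re + i strip_im] sends the strip [|Re| < 1] conformally onto
the strip [|Im| < 1]. Composed with the Poisson extension of (almost) the indicator of [E], it
gives a boundary function [a + i b] with [|b| <= 1], with [a >= 0] concentrated on [E], and, by
the mean value property, with mean [strip_re (|E| / (2 pi)) 0]. Since conjugation is
antisymmetric, [2 pi ||f||_1] bounds the integral of [v a], hence [k] times that of [a]:
[|E| / (2 pi) <= extremal_rate (||f||_1 / k)]. Finally [v_r t] is an Abel average of the
truncated singular integrals at [t], so, for [k < 1], every point of [{Hf >= 1}] lies in
[{v_r >= k}] for [r] close to [1].

Equality. Take [f (x + i y) = sgn y * sqrt ((1 + x) / (cos al - x))] on the arc [x < cos al] and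
[0] elsewhere. Both [||f||_1] and the truncated singular integrals have elementary
antiderivatives, and [Hf = 1] on the arc. *)

Require Import Defs.
From mathcomp Require Import all_boot all_order all_algebra.
From mathcomp Require Import complex ring lra.
From mathcomp Require Import all_classical all_reals all_analysis measurable_realfun.
Import Order.TTheory GRing.Theory Num.Theory.
Import numFieldNormedType.Exports.
Local Open Scope classical_set_scope.
Local Open Scope ring_scope.

Set Implicit Arguments.
Unset Strict Implicit.
Unset Printing Implicit Defensive.

(** * Analytic functions on a half-plane *)

(** Why the strip: its map sends the imaginary axis to itself and the line [Re = 1] to the lines
    [|Im| = 1]. Ideally the Poisson extension has real part 0 off [E] and 1 on [E], so [a] vanishes
    off [E], while [b] stays in the unit ball dual to the L^1 norm of [f]. On the real axis the map
    is [c |-> (2 / pi) ln (tan (pi (1 + c) / 4))], and the right-hand side of the theorem is its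
    inverse.

    Boundary values are avoided: all functions live at radii below 1, and finite sums of Poisson
    kernels replace the indicator. The total mass loses a factor [1 - e], which keeps the values off
    the line [Re = 1], where the map is singular.

    Origin of the extremal function: let [G] be analytic in the disc with boundary values
    [f + i Hf]. If [Hf = 1] on the arc and [f = 0] off it, then [G - i] is real on the arc and
    imaginary off it, so [(G - i)^2] is real on the circle, changing sign at the ends of the arc.
    This holds for [G = i - i (1 + z) / sqrt (1 - 2 z cos al + z^2)], where [G(0) = 0] and
    [(G - i)^2 = (1 + x) / (cos al - x)] on the circle. *)

Section holomorphic.
Context {R : realType}.
Implicit Types (A B C D : R * R -> R).

(* [A + i B] is analytic on [x < x0], with derivative [C + i D]. Analytic functions on a disc are
   used through [x + i y |-> exp (x + i y)], so that [left_end] is the centre of the disc. *)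
Definition holo (x0 : R) A B := exists C D : R * R -> R, forall z, z.1 < x0 ->
  [/\ A @ z --> A z, B @ z --> B z, C @ z --> C z & D @ z --> D z] /\
  [/\ is_derive z.1 1 (fun x => A (x, z.2)) (C z),
      is_derive z.1 1 (fun x => B (x, z.2)) (D z),
      is_derive z.2 1 (fun y => A (z.1, y)) (- D z) &
      is_derive z.2 1 (fun y => B (z.1, y)) (C z)].

(** Convergence is uniform in the imaginary part, as a limit at the centre of a disc is uniform in
    the angle; this lets it pass under the integral in [holo_circle_mean]. *)
Definition left_end : set_system (R * R) :=
  filter_prod (-oo : set_system R) (globally [set: R]).

Lemma left_end_filter : ProperFilter left_end.
Proof.
have ? : ProperFilter (globally [set: R]) by apply: (@globally_properfilter _ _ 0).
exact: filter_prod_proper.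
Qed.

Lemma is_derive_sqrD (f g : R -> R) (x df dg : R) :
  is_derive x 1 f df -> is_derive x 1 g dg ->
  is_derive x 1 (fun t => f t ^+ 2 + g t ^+ 2) (f x * df *+ 2 + g x * dg *+ 2).
Proof.
move=> fx gx; under eq_fun do rewrite !expr2.
apply: (is_derive_eq (is_deriveD (is_deriveM fx fx) (is_deriveM gx gx))).
by rewrite /= /GRing.scale /=; ring.
Qed.

Lemma holo_cst x0 a b : holo x0 (cst a) (cst b).
Proof.
exists (cst 0), (cst 0) => z _; split; split; try exact: cvg_cst.
all: rewrite /= ?oppr0; exact: is_derive_cst.
Qed.

Lemma holoD x0 A B A' B' : holo x0 A B -> holo x0 A' B' ->
  holo x0 (fun z => A z + A' z) (fun z => B z + B' z).
Proof.
move=> [C [D h]] [C' [D' h']].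
exists (fun z => C z + C' z), (fun z => D z + D' z) => z zx.
have [[cA cB cC cD] [Ax Bx Ay By]] := h _ zx.
have [[cA' cB' cC' cD'] [Ax' Bx' Ay' By']] := h' _ zx.
split; split; try exact: cvgD.
- exact: is_deriveD.
- exact: is_deriveD.
- by rewrite opprD; exact: is_deriveD.
- exact: is_deriveD.
Qed.

Lemma holoM x0 A B A' B' : holo x0 A B -> holo x0 A' B' ->
  holo x0 (fun z => A z * A' z - B z * B' z) (fun z => A z * B' z + B z * A' z).
Proof.
move=> [C [D h]] [C' [D' h']].
exists (fun z => (C z * A' z - D z * B' z) + (A z * C' z - B z * D' z)),
  (fun z => (C z * B' z + D z * A' z) + (A z * D' z + B z * C' z)) => z zx.
have [[cA cB cC cD] [Ax Bx Ay By]] := h _ zx.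
have [[cA' cB' cC' cD'] [Ax' Bx' Ay' By']] := h' _ zx.
case: z zx => x y /= zx in cA cB cC cD Ax Bx Ay By cA' cB' cC' cD' Ax' Bx' Ay' By' *.
split; split.
- by apply: cvgB; exact: cvgM.
- by apply: cvgD; exact: cvgM.
- by apply: cvgD; apply: cvgB; exact: cvgM.
- by apply: cvgD; apply: cvgD; exact: cvgM.
- apply: (is_derive_eq (is_deriveB (is_deriveM Ax Ax') (is_deriveM Bx Bx'))).
  by rewrite /= /GRing.scale /=; ring.
- apply: (is_derive_eq (is_deriveD (is_deriveM Ax Bx') (is_deriveM Bx Ax'))).
  by rewrite /= /GRing.scale /=; ring.
- apply: (is_derive_eq (is_deriveB (is_deriveM Ay Ay') (is_deriveM By By'))).
  by rewrite /= /GRing.scale /=; ring.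
- apply: (is_derive_eq (is_deriveD (is_deriveM Ay By') (is_deriveM By Ay'))).
  by rewrite /= /GRing.scale /=; ring.
Qed.

Lemma holoV x0 A B : holo x0 A B ->
  (forall z, z.1 < x0 -> A z ^+ 2 + B z ^+ 2 != 0) ->
  holo x0 (fun z => A z / (A z ^+ 2 + B z ^+ 2))
          (fun z => - B z / (A z ^+ 2 + B z ^+ 2)).
Proof.
move=> [C [D h]] N0.
pose N z := A z ^+ 2 + B z ^+ 2.
(* The parts of [- (C + i D) / (A + i B) ^+ 2], after multiplying above and below by the squared
   conjugate [(A - i B) ^+ 2]. *)
exists (fun z => - (C z * (A z ^+ 2 - B z ^+ 2) + D z * (A z * B z *+ 2)) / N z ^+ 2),
  (fun z => (C z * (A z * B z *+ 2) - D z * (A z ^+ 2 - B z ^+ 2)) / N z ^+ 2) => z zx.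
have [[cA cB cC cD] [Ax Bx Ay By]] := h _ zx.
have Nz := N0 _ zx.
case: z zx Nz => x y /= zx Nz in cA cB cC cD Ax Bx Ay By *.
have cA2 : A z ^+ 2 @[z --> (x, y)] --> A (x, y) ^+ 2.
  by rewrite expr2; under eq_fun do rewrite expr2; exact: cvgM.
have cB2 : B z ^+ 2 @[z --> (x, y)] --> B (x, y) ^+ 2.
  by rewrite expr2; under eq_fun do rewrite expr2; exact: cvgM.
have cN : N @ (x, y) --> N (x, y) by exact: cvgD.
have cN2 : (N z ^+ 2)^-1 @[z --> (x, y)] --> (N (x, y) ^+ 2)^-1.
  apply: cvgV; first by rewrite expf_neq0.
  by rewrite expr2; under eq_fun do rewrite expr2; exact: cvgM.
have cNV : (N z)^-1 @[z --> (x, y)] --> (N (x, y))^-1 by exact: cvgV.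
have cAB : (A z * B z *+ 2) @[z --> (x, y)] --> (A (x, y) * B (x, y) *+ 2).
  by rewrite mulr2n; under eq_fun do rewrite mulr2n; apply: cvgD; exact: cvgM.
have Nx : is_derive x 1 (fun t => A (t, y) ^+ 2 + B (t, y) ^+ 2)
    (A (x, y) * C (x, y) *+ 2 + B (x, y) * D (x, y) *+ 2).
  exact: is_derive_sqrD.
have Ny : is_derive y 1 (fun t => A (x, t) ^+ 2 + B (x, t) ^+ 2)
    (- (A (x, y) * D (x, y) *+ 2) + B (x, y) * C (x, y) *+ 2).
  by apply: (is_derive_eq (is_derive_sqrD Ay By)); rewrite mulrN mulNrn.
have NxV := @is_deriveV R (fun t => A (t, y) ^+ 2 + B (t, y) ^+ 2) _ _ _ Nz Nx.
have NyV := @is_deriveV R (fun t => A (x, t) ^+ 2 + B (x, t) ^+ 2) _ _ _ Nz Ny.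
have Bx' : is_derive x 1 (fun t => - B (t, y)) (- D (x, y)) by exact: is_deriveN.
have By' : is_derive y 1 (fun t => - B (x, t)) (- C (x, y)) by exact: is_deriveN.
split; split.
- exact: cvgM.
- by apply: cvgM => //; exact: cvgN.
- apply: cvgM => //; apply: cvgN; apply: cvgD; apply: cvgM => //.
  by apply: cvgB.
- by apply: cvgM => //; apply: cvgB; apply: cvgM => //; apply: cvgB.
- apply: (is_derive_eq (is_deriveM Ax NxV)).
  by rewrite /= /GRing.scale /= /N; field.
- apply: (is_derive_eq (is_deriveM Bx' NxV)).
  by rewrite /= /GRing.scale /= /N; field.
- apply: (is_derive_eq (is_deriveM Ay NyV)).
  by rewrite /= /GRing.scale /= /N; field.
- apply: (is_derive_eq (is_deriveM By' NyV)).
  by rewrite /= /GRing.scale /= /N; field.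
Qed.

Lemma holo_exp x0 A B : holo x0 A B ->
  holo x0 (fun z => expR (A z) * cos (B z)) (fun z => expR (A z) * sin (B z)).
Proof.
move=> [C [D h]].
exists (fun z => expR (A z) * (C z * cos (B z) - D z * sin (B z))),
  (fun z => expR (A z) * (C z * sin (B z) + D z * cos (B z))) => z zx.
have [[cA cB cC cD] [Ax Bx Ay By]] := h _ zx.
case: z zx => x y /= zx in cA cB cC cD Ax Bx Ay By *.
have cE : expR (A z) @[z --> (x, y)] --> expR (A (x, y)).
  by apply: continuous_cvg => //; exact: continuous_expR.
have cc : cos (B z) @[z --> (x, y)] --> cos (B (x, y)).
  by apply: continuous_cvg => //; exact: continuous_cos.
have cs : sin (B z) @[z --> (x, y)] --> sin (B (x, y)).
  by apply: continuous_cvg => //; exact: continuous_sin.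
have EAx := is_derive1_comp (is_derive_expR _) Ax.
have EAy := is_derive1_comp (is_derive_expR _) Ay.
have cBx := is_derive1_comp (is_derive_cos _) Bx.
have cBy := is_derive1_comp (is_derive_cos _) By.
have sBx := is_derive1_comp (is_derive_sin _) Bx.
have sBy := is_derive1_comp (is_derive_sin _) By.
split; split.
- exact: cvgM.
- exact: cvgM.
- by apply: cvgM => //; apply: cvgB; exact: cvgM.
- by apply: cvgM => //; apply: cvgD; exact: cvgM.
- apply: (is_derive_eq (is_deriveM EAx cBx)).
  by rewrite /= /GRing.scale /=; ring.
- apply: (is_derive_eq (is_deriveM EAx sBx)).
  by rewrite /= /GRing.scale /=; ring.
- apply: (is_derive_eq (is_deriveM EAy cBy)).
  by rewrite /= /GRing.scale /=; ring.
- apply: (is_derive_eq (is_deriveM EAy sBy)).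
  by rewrite /= /GRing.scale /=; ring.
Qed.

(** On the right half-plane the principal argument is [atan (B / A)], so no branch has to be chosen.
    The strip map is written so that only such values reach the logarithm. *)
Lemma holo_ln x0 A B : holo x0 A B -> (forall z, z.1 < x0 -> 0 < A z) ->
  holo x0 (fun z => ln (A z ^+ 2 + B z ^+ 2) / 2) (fun z => atan (B z / A z)).
Proof.
move=> [C [D h]] A0.
pose N z := A z ^+ 2 + B z ^+ 2.
exists (fun z => (C z * A z + D z * B z) / N z),
  (fun z => (D z * A z - C z * B z) / N z) => z zx.
have [[cA cB cC cD] [Ax Bx Ay By]] := h _ zx.
have Az := A0 _ zx.
have Nz : 0 < N z by rewrite /N ltr_wpDr ?sqr_ge0 ?exprn_gt0.
case: z zx Az Nz => x y /= zx Az Nz in cA cB cC cD Ax Bx Ay By *.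
have cN : N @ (x, y) --> N (x, y).
  rewrite /N !expr2; under eq_fun do rewrite !expr2.
  by apply: cvgD; exact: cvgM.
have cNV : (N z)^-1 @[z --> (x, y)] --> (N (x, y))^-1.
  by apply: cvgV => //; exact: lt0r_neq0.
have Nx : is_derive x 1 (fun t => A (t, y) ^+ 2 + B (t, y) ^+ 2)
    (A (x, y) * C (x, y) *+ 2 + B (x, y) * D (x, y) *+ 2).
  exact: is_derive_sqrD.
have Ny : is_derive y 1 (fun t => A (x, t) ^+ 2 + B (x, t) ^+ 2)
    (- (A (x, y) * D (x, y) *+ 2) + B (x, y) * C (x, y) *+ 2).
  by apply: (is_derive_eq (is_derive_sqrD Ay By)); rewrite mulrN mulNrn.
have Lx : is_derive x 1 (fun t => ln (A (t, y) ^+ 2 + B (t, y) ^+ 2))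
    ((N (x, y))^-1 * (A (x, y) * C (x, y) *+ 2 + B (x, y) * D (x, y) *+ 2)).
  exact: (@is_derive1_comp R (@ln R) (fun t => A (t, y) ^+ 2 + B (t, y) ^+ 2) _ _ _ (is_derive1_ln Nz) Nx).
have Ly : is_derive y 1 (fun t => ln (A (x, t) ^+ 2 + B (x, t) ^+ 2))
    ((N (x, y))^-1 * (- (A (x, y) * D (x, y) *+ 2) + B (x, y) * C (x, y) *+ 2)).
  exact: (@is_derive1_comp R (@ln R) (fun t => A (x, t) ^+ 2 + B (x, t) ^+ 2) _ _ _ (is_derive1_ln Nz) Ny).
have Az0 := lt0r_neq0 Az.
have Nz0 : A (x, y) ^+ 2 + B (x, y) ^+ 2 != 0 by exact: lt0r_neq0.
have Tx := is_derive1_comp (is_derive1_atan _) (is_deriveM Bx (@is_deriveV R (fun t => A (t, y)) _ _ _ Az0 Ax)).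
have Ty := is_derive1_comp (is_derive1_atan _) (is_deriveM By (@is_deriveV R (fun t => A (x, t)) _ _ _ Az0 Ay)).
have Nz1 : 1 + (B (x, y) / A (x, y)) ^+ 2 != 0.
  by apply: lt0r_neq0; rewrite ltr_pwDl ?sqr_ge0.
split; split.
- apply: cvgM; last exact: cvg_cst.
  by apply: (continuous_cvg _ _ cN); exact: continuous_ln.
- apply: (@continuous_cvg _ _ _ _ _ (fun z => B z / A z) atan); first exact: continuous_atan.
  by apply: cvgM => //; exact: cvgV.
- by apply: cvgM => //; apply: cvgD; apply: cvgM.
- by apply: cvgM => //; apply: cvgB; apply: cvgM.
- apply: (is_derive_eq (is_deriveM Lx (is_derive_cst (2^-1 : R) _ _))).
  by rewrite /= /GRing.scale /= /N; field.
- apply: (is_derive_eq Tx).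
  rewrite [X in 1 + X ^+ 2](_ : _ = B (x, y) / A (x, y))//.
  by rewrite /GRing.scale /= /N; field; rewrite Az0 Nz0.
- apply: (is_derive_eq (is_deriveM Ly (is_derive_cst (2^-1 : R) _ _))).
  by rewrite /= /GRing.scale /= /N; field.
- apply: (is_derive_eq Ty).
  rewrite [X in 1 + X ^+ 2](_ : _ = B (x, y) / A (x, y))//.
  by rewrite /GRing.scale /= /N; field; rewrite Az0 Nz0.
Qed.

Lemma holo_id x0 : holo x0 fst snd.
Proof.
exists (cst 1), (cst 0) => z _; split; split.
- exact: cvg_fst.
- exact: cvg_snd.
- exact: cvg_cst.
- exact: cvg_cst.
- exact: is_derive_id.
- exact: is_derive_cst.
- by rewrite /= oppr0; exact: is_derive_cst.
- exact: is_derive_id.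
Qed.
Notation mu := (@lebesgue_measure R).

Lemma pi_neg_lt : - pi < pi :> R.
Proof. by have := @pi_gt0 R; lra. Qed.

Lemma continuous_integrable_itv (f : R -> R) (a b : R) : continuous f ->
  mu.-integrable `[a, b] (EFin \o f).
Proof.
move=> cf; apply: continuous_compact_integrable; first exact: segment_compact.
exact: continuous_subspaceT.
Qed.

Lemma continuous_Rintegral_derivative (f g : R -> R) (a b : R) : a < b ->
  (forall x : R, is_derive x 1 f (g x)) -> continuous g ->
  \int[mu]_(x in `[a, b]) g x = f b - f a.
Proof.
move=> ab fg cg; rewrite /Rintegral (@continuous_FTC2 _ g f)//.
- exact: continuous_subspaceT.
- have cf : continuous f.
    by move=> x; apply/differentiable_continuous/derivable1_diffP; have [] := fg x.
  split => [x _||]; first by have [] := fg x.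
  - exact/cvg_at_right_filter/cf.
  - exact/cvg_at_left_filter/cf.
- by move=> x _; rewrite derive1E; apply: derive_val.
Qed.

Lemma Rintegral_itv_cst (a b c : R) : a <= b ->
  \int[mu]_(x in `[a, b]) c = c * (b - a).
Proof.
move=> ab; rewrite Rintegral_cst//; congr (_ * _).
rewrite [X in fine X](_ : _ = mu `[a, b])// lebesgue_measure_itv/= lte_fin.
by case: ltgtP ab => //= ->; rewrite subrr.
Qed.

Lemma continuous_bounded_rectangle (C : R * R -> R) (u v a b : R) :
  (forall z, u <= z.1 <= v -> C @ z --> C z) ->
  exists M : R, forall x y, u <= x <= v -> a <= y <= b -> `|C (x, y)| <= M.
Proof.
move=> cC; pose K := `[u, v]%classic `*` `[a, b]%classic : set (R * R).
have cK : compact K by apply: compact_setX; exact: segment_compact.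
have /compact_bounded[M [_ MP]] : compact (C @` K).
  apply: continuous_compact cK; apply: continuous_in_subspaceT => z.
  rewrite inE => -[/= z1 z2]; apply: cC.
  by move: z1; rewrite in_itv.
exists (M + 1) => x y xuv yab; apply: MP; first by rewrite ltrDl.
by exists (x, y) => //; split; rewrite /= in_itv.
Qed.

(** By Cauchy-Riemann the derivative in [x] of the mean of [A] over a vertical period is the
    integral of the [y]-derivative of [B], which is 0 as [B] agrees at [pi] and [- pi]. The mean is
    thus constant, and equals its limit at [left_end]. *)
Lemma holo_circle_mean (x0 a : R) A B : 0 < x0 -> holo x0 A B ->
  A @ left_end --> a -> (forall x, x < x0 -> B (x, pi) = B (x, - pi)) ->
  \int[mu]_(y in `[- pi, pi]) A (0, y) = 2 * pi * a.
Proof.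
move=> x00 [C [D h]] Aa Bpi.
pose K x := \int[mu]_(y in `[- pi, pi]) A (x, y).
have Ay x : x < x0 -> continuous (fun y => A (x, y)).
  move=> xx0 y; have [_ [_ _ d _]] := h (x, y) xx0.
  by apply/differentiable_continuous/derivable1_diffP; case: d.
have C_y x : x < x0 -> continuous (fun y => C (x, y)).
  move=> xx0 y; have [[_ _ c _] _] := h (x, y) xx0.
  have xy : (x, t) @[t --> y] --> (x, y).
    exact: (cvg_pair (cvg_cst x) cvg_id).
  exact: (cvg_comp _ _ xy c).
have K' x : x < x0 -> is_derive x 1 K 0.
  move=> xx0.
  (* A compact rectangle around [x], still to the left of [x0], bounds [C] and supplies the
     dominating constant for differentiation under the integral. *)
  have /(@continuous_bounded_rectangle _ _ _ (- pi) pi)[M Mb] :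
      forall z, x - 1 <= z.1 <= (x + x0) / 2 -> C @ z --> C z.
    move=> [s t] /= /andP[_ st]; have [|[_ _ c _] _] := h (s, t) => //=.
    by apply: le_lt_trans st _; lra.
  have xI : x \in `]x - 1, ((x + x0) / 2)[ by rewrite in_itv /=; lra.
  have d1 y z : z < x0 -> ((fun x => A (x, y))^`()%classic : R -> R) z = C (z, y).
    by move=> zx; have [_ [d _ _ _]] := h (z, y) zx; rewrite derive1E; apply: derive_val.
  pose G (_ : R) : R := `|M|.
  have Il (z : R) : `]x - 1, ((x + x0) / 2)[%classic z -> z < x0 by rewrite /= in_itv /=; lra.
  have intC : \int[mu]_(y in `[- pi, pi]) (partial1of2 (fun x0 y0 => A (x0, y0)) x y) = 0.
    transitivity (\int[mu]_(y in `[- pi, pi]) C (x, y)).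
      by apply: eq_Rintegral => y _; exact: d1.
    have By (y : R) : is_derive y 1 (fun y => B (x, y)) (C (x, y)).
      by have [_ []] := h (x, y) xx0.
    by rewrite (continuous_Rintegral_derivative pi_neg_lt By (C_y _ xx0)) Bpi// subrr.
  have H : h^-1 *: (K (h + x) - K x) @[h --> 0^'] -->
      \int[mu]_(y in `[- pi, pi]) (partial1of2 (fun x0 y0 => A (x0, y0)) x y).
    apply: (@cvg_differentiation_under_integral R _ _ mu (fun x y => A (x, y))
      `[- pi, pi] _ x (x - 1) ((x + x0) / 2) xI _ _ G) => //.
    - by move=> z /Il zx; apply: continuous_integrable_itv; exact: Ay.
    - by move=> z y /Il zx _; have [_ [[]]] := h (z, y) zx.
    - by move=> y; rewrite /G.
    - by apply: continuous_integrable_itv => y; exact: cvg_cst.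
    - move=> z y zI; rewrite /= in_itv /= => yI.
      rewrite /partial1of2 d1; last exact: Il.
      apply: le_trans (ler_norm M); apply: Mb => //.
      by move: zI; rewrite /= in_itv /=; lra.
  rewrite intC in H.
  apply: DeriveDef.
    apply/cvg_ex; exists 0.
    by under eq_fun do rewrite scaler1.
  apply/cvg_lim => //.
  by under eq_fun do rewrite scaler1.
have K0 x : x < 0 -> K x = K 0.
  move=> x_lt0.
  have [||c _] := @MVT R K (fun=> 0) _ _ x_lt0.
  - by move=> z; rewrite in_itv /= => zI; apply: K'; lra.
  - apply: derivable_within_continuous => z; rewrite in_itv /= => zI.
    by have [] : is_derive z 1 K 0 by apply: K'; lra.
  - by rewrite mul0r => /eqP; rewrite subr_eq0 => /eqP.
apply/eqP; rewrite -subr_eq0 -normr_le0; apply/ler_addgt0Pl => e e0.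
rewrite addr0.
have pi0 := @pi_gt0 R.
have /cvgrPdist_le/(_ (e / (2 * pi))) := Aa.
case; first by rewrite divr_gt0// mulr_gt0.
move=> [P Q] /= [[M [Mr MP]] Q1] PQ.
pose x := Num.min (M - 1) (-1).
have xM : x < M by rewrite /x; case: (lerP (M - 1) (-1)) => /=; lra.
have x_lt0 : x < 0 by rewrite /x; case: (lerP (M - 1) (-1)) => /=; lra.
rewrite -/(K 0) -(K0 _ x_lt0) /K.
have -> : 2 * pi * a = \int[mu]_(y in `[- pi, pi]) a.
  by rewrite Rintegral_itv_cst; [ring|lra].
have ia : mu.-integrable `[- pi, pi] (EFin \o (fun=> a)).
  by apply: continuous_integrable_itv => y; exact: cvg_cst.
have iA : mu.-integrable `[- pi, pi] (EFin \o (fun y => A (x, y))).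
  by apply: continuous_integrable_itv; apply: Ay; lra.
have cAa : continuous (fun y => A (x, y) - a).
  by move=> y; apply: cvgB; [apply: Ay; lra|exact: cvg_cst].
rewrite -RintegralB//; apply: le_trans (le_normr_Rintegral _ _) _ => //.
  exact: continuous_integrable_itv.
have -> : e = \int[mu]_(y in `[- pi, pi]) (e / (2 * pi)).
  by rewrite Rintegral_itv_cst; [field; lra|lra].
apply: le_Rintegral => //.
- by apply: continuous_integrable_itv => y; apply: cvg_norm; exact: cAa.
- by apply: continuous_integrable_itv => y; exact: cvg_cst.
- move=> y _; rewrite distrC; apply: (PQ (x, y)); split => /=; first exact: MP.
  exact: Q1.
Qed.
End holomorphic.

(** * Poisson kernels and the conformal map of the strip *)

Section poisson.
Context {R : realType}.
Implicit Types (A B : R * R -> R) (r s t x y X Y e : R) (L : seq (R * R)).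
Notation mu := (@lebesgue_measure R).

Lemma eq_holo x0 A B A' B' : A =1 A' -> B =1 B' -> holo x0 A B -> holo x0 A' B'.
Proof. by move=> /funext -> /funext ->. Qed.

(** Multiplication by [- i]: it lets [holo_circle_mean], which is about real parts, speak of
    imaginary parts. *)
Lemma holo_mulNi x0 A B : holo x0 A B -> holo x0 B (fun z => - A z).
Proof.
move=> h; have := holoM (holo_cst x0 0 (-1)) h; apply: eq_holo => z /=; ring.
Qed.

Lemma lipschitz_of_derive (f g : R -> R) (M : R) :
  (forall x : R, is_derive x 1 f (g x)) -> (forall x, `|g x| <= M) ->
  forall x y : R, `|f x - f y| <= M * `|x - y|.
Proof.
move=> fg gM x y; wlog xy : x y / y < x.
  move=> h; have [xy|yx|->] := ltgtP x y; [|exact: h|].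
    by rewrite distrC (distrC x); exact: h.
  by rewrite !subrr !normr0 mulr0.
have [|c _ ->] := @MVT R f g y x xy (fun z _ => fg z).
  apply: continuous_subspaceT => z; apply/differentiable_continuous/derivable1_diffP.
  by have [] := fg z.
by rewrite normrM ler_wpM2r.
Qed.

Lemma sin_lipschitz x y : `|sin x - sin y| <= `|x - y|.
Proof.
rewrite -[leRHS]mul1r; apply: lipschitz_of_derive x y => z; exact: cos_max.
Qed.

Lemma cos_lipschitz x y : `|cos x - cos y| <= `|x - y|.
Proof.
rewrite -[leRHS]mul1r; apply: lipschitz_of_derive x y => z.
by rewrite normrN sin_max.
Qed.

Definition poisson r t : R := (1 - r ^+ 2) / (1 - 2 * r * cos t + r ^+ 2).

Definition conj_poisson r t : R := 2 * r * sin t / (1 - 2 * r * cos t + r ^+ 2).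

Lemma poisson_den_ge r t : 0 <= r -> (1 - r) ^+ 2 <= 1 - 2 * r * cos t + r ^+ 2.
Proof. by move=> r0; have := cos_le1 t; nra. Qed.

Lemma poisson_den_gt0 r t : 0 <= r < 1 -> 0 < 1 - 2 * r * cos t + r ^+ 2.
Proof.
move=> /andP[r0 r1]; apply: lt_le_trans (poisson_den_ge t r0).
by rewrite exprn_gt0// subr_gt0.
Qed.

Lemma poisson_ge0 r t : 0 <= r < 1 -> 0 <= poisson r t.
Proof.
move=> r01; rewrite divr_ge0 ?(ltW (poisson_den_gt0 t r01))//.
by move/andP: r01 => [r0 r1]; rewrite subr_ge0 expr_le1// ltW.
Qed.

(** The two kernels are the parts of [(1 + Z) / (1 - Z)] with [Z = r exp (z - i s)]; the condition
    on [x0] gives [|Z| < 1]. *)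
Lemma holo_poisson x0 r s : 0 <= r -> r * expR x0 <= 1 ->
  holo x0 (fun z => poisson (r * expR z.1) (z.2 - s))
          (fun z => conj_poisson (r * expR z.1) (z.2 - s)).
Proof.
move=> r0 rx0.
have lt1 (z : R * R) : z.1 < x0 -> 0 <= r * expR z.1 < 1.
  move=> zx; rewrite mulr_ge0 ?expR_ge0//=.
  have [->|rn0] := eqVneq r 0; first by rewrite mul0r.
  by apply: lt_le_trans rx0; rewrite ltr_pM2l ?ltr_expR// lt0r rn0.
have hZ := holoM (holo_cst x0 (r * cos s) (- r * sin s)) (holo_exp (holo_id x0)).
have h1 := holoD (holo_cst x0 1 0) hZ.
have h2 := holoD (holo_cst x0 1 0) (holoM (holo_cst x0 (-1) 0) hZ).
(* The left side is [|1 - Z|^2] in the very shape that [holoV] produces; it is the common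
   denominator of the two kernels. *)
have NE (z : R * R) : (1 + (-1 * (r * cos s * (expR z.1 * cos z.2) - - r * sin s * (expR z.1 * sin z.2)) -
        0 * (r * cos s * (expR z.1 * sin z.2) + - r * sin s * (expR z.1 * cos z.2)))) ^+ 2 +
   (0 + (-1 * (r * cos s * (expR z.1 * sin z.2) + - r * sin s * (expR z.1 * cos z.2)) +
        0 * (r * cos s * (expR z.1 * cos z.2) - - r * sin s * (expR z.1 * sin z.2)))) ^+ 2 =
   1 - 2 * (r * expR z.1) * cos (z.2 - s) + (r * expR z.1) ^+ 2.
  rewrite cosB; have := cos2Dsin2 s; have := cos2Dsin2 z.2.
  set a := cos s; set b := sin s; set c := cos _; set d := sin _; set e := expR _.
  move=> cd ab.
  transitivity (1 - 2 * (r * e) * (c * a + d * b) + (r * e) ^+ 2 * ((c ^+ 2 + d ^+ 2) * (a ^+ 2 + b ^+ 2))).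
    by ring.
  by rewrite cd ab !mulr1.
refine (eq_holo _ _ (holoM h1 (holoV h2 _))).
- move=> z /=; rewrite NE /poisson !mulrA -mulrBl; congr (_ / _).
  have := cos2Dsin2 s; have := cos2Dsin2 z.2.
  set a := cos s; set b := sin s; set c := cos _; set d := sin _; set e := expR _.
  move=> cd ab.
  transitivity (1 - (r * e) ^+ 2 * ((c ^+ 2 + d ^+ 2) * (a ^+ 2 + b ^+ 2))); first by ring.
  by rewrite cd ab !mulr1.
- move=> z /=; rewrite NE /conj_poisson !mulrA -mulrDl; congr (_ / _).
  by rewrite sinB; ring.
- by move=> z zx /=; rewrite NE; apply: lt0r_neq0; exact/poisson_den_gt0/lt1.
Qed.

Lemma expR_left_end : expR z.1 @[z --> @left_end R] --> (0 : R).
Proof.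
apply: (cvg_comp fst expR).
  exact: cvg_fst.
apply/cvgNy_compNP.
exact: cvgr_expR.
Qed.

Lemma cvg_bounded_mul0 T (F : set_system T) (FF : Filter F) (f g : T -> R) :
  f @ F --> (0 : R) -> (forall u, `|g u| <= 1) -> f x * g x @[x --> F] --> (0 : R).
Proof.
move=> f0 g1; apply/norm_cvg0P.
have nf0 : `|f u| @[u --> F] --> (0 : R) by exact/norm_cvg0P.
apply: (squeeze_cvgr _ (cvg_cst 0) nf0).
apply: nearW => x; rewrite normr_ge0 /= normrM.
by rewrite ler_piMr.
Qed.

Lemma poisson_left_end r s :
  poisson (r * expR z.1) (z.2 - s) @[z --> @left_end R] --> (1 : R) /\
  conj_poisson (r * expR z.1) (z.2 - s) @[z --> @left_end R] --> (0 : R).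
Proof.
have lef := @left_end_filter R.
have r0 : r * expR z.1 @[z --> @left_end R] --> (0 : R).
  by rewrite -[X in _ --> X](mulr0 r); apply: cvgM; [exact: cvg_cst|exact: expR_left_end].
have r2 : (r * expR z.1) ^+ 2 @[z --> @left_end R] --> (0 : R).
  rewrite -[X in _ --> X](mulr0 0); under eq_fun do rewrite expr2.
  exact: cvgM.
have d1 : 1 - 2 * (r * expR z.1) * cos (z.2 - s) + (r * expR z.1) ^+ 2
    @[z --> @left_end R] --> (1 : R).
  rewrite -[X in _ --> X]addr0 -[X in _ --> X + _]subr0 -[X in _ --> _ - X + _](mulr0 2).
  apply: cvgD => //; apply: cvgB; first exact: cvg_cst.
  under eq_fun do rewrite -mulrA.
  apply: cvgM; first exact: cvg_cst.
  by apply: cvg_bounded_mul0 => // z; exact: cos_max.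
have d1V : (1 - 2 * (r * expR z.1) * cos (z.2 - s) + (r * expR z.1) ^+ 2)^-1
    @[z --> @left_end R] --> (1 : R).
  by rewrite -[X in _ --> X]invr1; apply: cvgV.
split.
- suff : poisson (r * expR z.1) (z.2 - s) @[z --> @left_end R] --> ((1 - 0) * 1 : R).
    by rewrite subr0 mulr1.
  by apply: cvgM => //; apply: cvgB => //; exact: cvg_cst.
- suff : conj_poisson (r * expR z.1) (z.2 - s) @[z --> @left_end R] --> (2 * 0 * 1 : R).
    by rewrite mulr0 mul0r.
  apply: cvgM => //; under eq_fun do rewrite -mulrA.
  apply: cvgM; first exact: cvg_cst.
  by apply: cvg_bounded_mul0 => // z; exact: sin_max.
Qed.

Lemma holo_sum x0 (I : Type) (l : seq I) (A B : I -> R * R -> R) :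
  (forall i, holo x0 (A i) (B i)) ->
  holo x0 (fun z => \sum_(i <- l) A i z) (fun z => \sum_(i <- l) B i z).
Proof.
move=> h; elim: l => [|i l ih].
  by apply: (eq_holo _ _ (holo_cst x0 0 0)) => z; rewrite big_nil.
by apply: (eq_holo _ _ (holoD (h i) ih)) => z; rewrite big_cons.
Qed.

(** Poisson extension of the measure with mass [p.1] at the angle [p.2]. With finitely many masses,
    analyticity follows from that of each term. *)
Definition poisson_sum L r t : R := \sum_(p <- L) p.1 * poisson r (t - p.2).

Definition conj_poisson_sum L r t : R :=
  \sum_(p <- L) p.1 * conj_poisson r (t - p.2).

Lemma holo_poisson_sum x0 L r : 0 <= r -> r * expR x0 <= 1 ->
  holo x0 (fun z => poisson_sum L (r * expR z.1) z.2)
          (fun z => conj_poisson_sum L (r * expR z.1) z.2).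
Proof.
move=> r0 rx0; apply: holo_sum => p.
apply: (eq_holo _ _ (holoM (holo_cst x0 p.1 0) (holo_poisson p.2 r0 rx0))) => z /=; ring.
Qed.

Lemma poisson_sum_left_end L r :
  poisson_sum L (r * expR z.1) z.2 @[z --> @left_end R] --> \sum_(p <- L) p.1 /\
  conj_poisson_sum L (r * expR z.1) z.2 @[z --> @left_end R] --> (0 : R).
Proof.
have lef := @left_end_filter R.
elim: L => [|p L [ih1 ih2]].
  rewrite big_nil; split.
    by under eq_fun do rewrite /poisson_sum big_nil; exact: cvg_cst.
  by under eq_fun do rewrite /conj_poisson_sum big_nil; exact: cvg_cst.
have [h1 h2] := poisson_left_end r p.2.
rewrite big_cons; split.
- under eq_fun do rewrite /poisson_sum big_cons.
  by apply: cvgD ih1; rewrite -[X in _ --> X]mulr1; apply: cvgM => //; exact: cvg_cst.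
- under eq_fun do rewrite /conj_poisson_sum big_cons.
  suff : p.1 * conj_poisson (r * expR z.1) (z.2 - p.2) +
      conj_poisson_sum L (r * expR z.1) z.2 @[z --> @left_end R] --> (0 + 0 : R).
    by rewrite addr0.
  by apply: cvgD ih2; rewrite -[X in _ --> X](mulr0 p.1); apply: cvgM => //; exact: cvg_cst.
Qed.

Lemma poisson_sum_ge0 L r t : 0 <= r < 1 -> (forall p, p \in L -> 0 <= p.1) ->
  0 <= poisson_sum L r t.
Proof.
move=> r01 L0; rewrite /poisson_sum big_seq; apply: sumr_ge0 => p /L0 p0.
by rewrite mulr_ge0// poisson_ge0.
Qed.

(* [Ep + i Eq = W := exp (i pi (X + i Y) / 2)] lies in the right half-plane when [|X| < 1], and
   [strip_re + i strip_im = (2 / pi) log ((W + i) / (W - i)) - i]. *)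
Let Ep (X Y : R) : R := expR (- (pi / 2 * Y)) * cos (pi / 2 * X).
Let Eq (X Y : R) : R := expR (- (pi / 2 * Y)) * sin (pi / 2 * X).

Definition strip_re X Y : R := 2 / pi *
  (ln (Ep X Y ^+ 2 + (Eq X Y + 1) ^+ 2) / 2 -
   ln (Ep X Y ^+ 2 + (Eq X Y - 1) ^+ 2) / 2).

Definition strip_im X Y : R := 2 / pi *
  (atan ((Eq X Y + 1) / Ep X Y) - atan ((Eq X Y - 1) / Ep X Y)) - 1.

Let Ep_gt0 X Y : -1 < X < 1 -> 0 < Ep X Y.
Proof.
move=> X1; rewrite mulr_gt0 ?expR_gt0// cos_gt0_pihalf//.
have := @pi_gt0 R; nra.
Qed.

Lemma holo_strip x0 A B : holo x0 A B -> (forall z, z.1 < x0 -> -1 < A z < 1) ->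
  holo x0 (fun z => strip_re (A z) (B z)) (fun z => strip_im (A z) (B z)).
Proof.
move=> h A1; have he := holo_exp (holoM (holo_cst x0 0 (pi / 2)) h).
have {}he : holo x0 (fun z => Ep (A z) (B z)) (fun z => Eq (A z) (B z)).
  apply: (eq_holo _ _ he) => z /=; rewrite /Ep /Eq !mul0r !add0r ?sub0r.
  - by [].
  - by [].
have hp := holo_ln (holoD he (holo_cst x0 0 1)).
have hm := holo_ln (holoD he (holo_cst x0 0 (-1))).
have E0 z : z.1 < x0 -> 0 < Ep (A z) (B z) + cst 0 z by move=> /A1; rewrite addr0; exact: Ep_gt0.
have hd := holoD (hp E0) (holoM (holo_cst x0 (-1) 0) (hm E0)).
have {}hd := holoD (holoM (holo_cst x0 (2 / pi) 0) hd) (holo_cst x0 0 (-1)).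
by apply: (eq_holo _ _ hd) => z /=; rewrite /strip_re /strip_im ?addr0; ring.
Qed.

Lemma cvg_strip T (F : set_system T) (FF : Filter F) (f g : T -> R) (a b : R) :
  -1 < a < 1 -> f @ F --> a -> g @ F --> b ->
  strip_re (f u) (g u) @[u --> F] --> strip_re a b /\
  strip_im (f u) (g u) @[u --> F] --> strip_im a b.
Proof.
move=> a1 fa gb; have Ep0 := Ep_gt0 b a1.
have cE : expR (- (pi / 2 * g u)) @[u --> F] --> expR (- (pi / 2 * b)).
  apply: (@continuous_cvg _ _ _ _ _ (fun u => - (pi / 2 * g u)) expR); first exact: continuous_expR.
  by apply: cvgN; apply: cvgM => //; exact: cvg_cst.
have cX : pi / 2 * f u @[u --> F] --> pi / 2 * a.
  by apply: cvgM => //; exact: cvg_cst.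
have cp : Ep (f u) (g u) @[u --> F] --> Ep a b.
  apply: cvgM => //.
  by apply: (@continuous_cvg _ _ _ _ _ (fun u => pi / 2 * f u) cos) => //; exact: continuous_cos.
have cq : Eq (f u) (g u) @[u --> F] --> Eq a b.
  apply: cvgM => //.
  by apply: (@continuous_cvg _ _ _ _ _ (fun u => pi / 2 * f u) sin) => //; exact: continuous_sin.
have cq1 : Eq (f u) (g u) + 1 @[u --> F] --> Eq a b + 1.
  by apply: cvgD => //; exact: cvg_cst.
have cq2 : Eq (f u) (g u) - 1 @[u --> F] --> Eq a b - 1.
  by apply: cvgB => //; exact: cvg_cst.
have cln (h : T -> R) (c : R) : h @ F --> c ->
    ln (Ep (f u) (g u) ^+ 2 + h u ^+ 2) / 2 @[u --> F] --> ln (Ep a b ^+ 2 + c ^+ 2) / 2.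
  move=> hc; apply: cvgM; last exact: cvg_cst.
  apply: (@continuous_cvg _ _ _ _ _ (fun u => Ep (f u) (g u) ^+ 2 + h u ^+ 2) (@ln R)).
    by apply: continuous_ln; rewrite ltr_wpDr ?sqr_ge0// exprn_gt0.
  rewrite !expr2; under eq_fun do rewrite !expr2.
  by apply: cvgD; apply: cvgM.
have cat (h : T -> R) (c : R) : h @ F --> c ->
    atan (h u / Ep (f u) (g u)) @[u --> F] --> atan (c / Ep a b).
  move=> hc.
  apply: (@continuous_cvg _ _ _ _ _ (fun u => h u / Ep (f u) (g u)) atan).
    exact: continuous_atan.
  by apply: cvgM => //; apply: cvgV => //; exact: lt0r_neq0.
split.
- apply: cvgM; first exact: cvg_cst.
  by apply: cvgB; exact: cln.
- apply: cvgB; last exact: cvg_cst.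
  apply: cvgM; first exact: cvg_cst.
  by apply: cvgB; exact: cat.
Qed.

(** The two arctangents are the arguments of [W + i] and [W - i]. As [W] is in the right half-plane
    their difference lies in []0, pi[], which the factor [2 / pi] and the shift by 1 carry to []-1,
    1[]. *)
Lemma strip_im_norm_le1 X Y : -1 < X < 1 -> `|strip_im X Y| <= 1.
Proof.
move=> /(Ep_gt0 Y) p0; rewrite /strip_im; set p := Ep _ _ in p0 *; set q := Eq _ _.
have lt : (q - 1) / p < (q + 1) / p by rewrite ltr_pM2r ?invr_gt0//; lra.
have := lt_atan lt; have := atan_gtNpi2 ((q - 1) / p); have := atan_ltpi2 ((q + 1) / p).
set u := atan _; set v := atan _ => u1 v1 vu.
have pi0 := @pi_gt0 R.
rewrite ler_norml; apply/andP; split.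
- rewrite lerBrDl subrr mulr_ge0 ?divr_ge0 ?subr_ge0//; lra.
- rewrite lerBlDr [leRHS](_ : _ = 2 / pi * pi).
    by rewrite ler_pM2l ?divr_gt0//; lra.
  by field; lra.
Qed.

Let Epq X Y : Ep X Y ^+ 2 + Eq X Y ^+ 2 = expR (- (pi / 2 * Y)) ^+ 2.
Proof.
by rewrite /Ep /Eq !exprMn -mulrDr cos2Dsin2 mulr1.
Qed.

Let den_gt0 X Y d : -1 < X < 1 -> 0 < Ep X Y ^+ 2 + d ^+ 2.
Proof. by move=> X1; rewrite ltr_wpDr ?sqr_ge0// exprn_gt0// Ep_gt0. Qed.

(** For [X >= 0] the imaginary part of [W] is nonnegative, so [W] is at least as far from [- i] as
    from [i]. *)
Lemma strip_re_ge0 X Y : 0 <= X < 1 -> 0 <= strip_re X Y.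
Proof.
move=> X1; have pi0 := @pi_gt0 R.
have q0 : 0 <= Eq X Y by rewrite mulr_ge0 ?expR_ge0// sin_ge0_pi//; nra.
have X1' : -1 < X < 1 by lra.
rewrite /strip_re mulr_ge0 ?divr_ge0//; first lra.
rewrite subr_ge0 ler_pM2r ?invr_gt0// ler_ln ?posrE ?den_gt0//.
nra.
Qed.

(** Linear in [X] and uniform in [Y]: this transfers the concentration of a Poisson sum on [E] to
    [a]. With [r = |W|] and [s = sin (pi X / 2)], the squared ratio of [|W + i|] to [|W - i|] is
    [1 + 4 r s / (r ^+ 2 + 1 - 2 r s)], and [ln (1 + x) <= x]. The bound [X <= 1 - e] keeps [W] away
    from the pole [i]. *)
Lemma strip_re_le X Y e : 0 < e <= 1 -> 0 <= X <= 1 - e ->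
  strip_re X Y <= X / (1 - sin (pi / 2 * (1 - e))).
Proof.
move=> e01 X01; have pi0 := @pi_gt0 R.
have X1' : -1 < X < 1 by lra.
have s_mono : sin (pi / 2 * X) <= sin (pi / 2 * (1 - e)).
  have : X <= 1 - e by lra.
  rewrite le_eqVlt => /predU1P[->//|Xe]; apply/ltW.
  by rewrite ltr_sin ?in_itv /=; nra.
have s_lt1 : sin (pi / 2 * (1 - e)) < 1.
  rewrite -[ltRHS](@sin_pihalf R) ltr_sin ?in_itv /=; nra.
have s_ge0 : 0 <= sin (pi / 2 * X) by apply: sin_ge0_pi; nra.
set S := sin (pi / 2 * (1 - e)) in s_mono s_lt1 *.
set s := sin (pi / 2 * X) in s_mono s_ge0.
set r := expR (- (pi / 2 * Y)); have r0 : 0 < r by exact: expR_gt0.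
have qE : Eq X Y = r * s by [].
have pq := Epq X Y; rewrite -/r qE in pq.
have Np := den_gt0 Y (Eq X Y + 1) X1'; have Nm := den_gt0 Y (Eq X Y - 1) X1'.
have NmE : Ep X Y ^+ 2 + (Eq X Y - 1) ^+ 2 = r ^+ 2 + 1 - 2 * r * s.
  by rewrite -pq qE; ring.
have NpE : Ep X Y ^+ 2 + (Eq X Y + 1) ^+ 2 = r ^+ 2 + 1 + 2 * r * s.
  by rewrite -pq qE; ring.
have s_le : s <= pi / 2 * X.
  by have := sin_lipschitz (pi / 2 * X) 0; rewrite sin0 !subr0 !ger0_norm//; nra.
have lnle : ln (Ep X Y ^+ 2 + (Eq X Y + 1) ^+ 2) - ln (Ep X Y ^+ 2 + (Eq X Y - 1) ^+ 2)
   <= 2 * s / (1 - S).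
  rewrite -ln_div ?posrE// NmE NpE; rewrite NmE in Nm; rewrite NpE in Np.
  have -> : (r ^+ 2 + 1 + 2 * r * s) / (r ^+ 2 + 1 - 2 * r * s) =
     1 + 4 * r * s / (r ^+ 2 + 1 - 2 * r * s) by field; lra.
  apply: le_trans (le_ln1Dx _) _.
    apply: lt_le_trans (_ : 0 <= _); first lra.
    by rewrite divr_ge0 ?(ltW Nm)//; nra.
  rewrite ler_pdivrMr// [leRHS]mulrAC ler_pdivlMr; last by lra.
  (* The difference of the two sides is twice the quantity of [h1] plus four times that of [h2]. *)
  have h1 : 0 <= s * (r - 1) ^+ 2 by rewrite mulr_ge0// sqr_ge0.
  have h2 : 0 <= s * r * (S - s) by rewrite !mulr_ge0 ?(ltW r0)//; lra.
  nra.
rewrite /strip_re -mulrBl.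
apply: (@le_trans _ _ (2 / pi * ((2 * s / (1 - S)) / 2))).
  by rewrite ler_pM2l ?divr_gt0// ler_pM2r ?invr_gt0.
rewrite [leLHS](_ : _ = (2 / pi * s) / (1 - S)); last by field; lra.
rewrite ler_pM2r ?invr_gt0; last by lra.
by rewrite mulrC mulrA ler_pdivrMr// ; lra.
Qed.

End poisson.

(** * Mean values of the strip map composed with a Poisson sum *)

Section strip_means.
Context {R : realType}.
Implicit Types (r s t x y X Y e c : R) (L : seq (R * R)).
Notation mu := (@lebesgue_measure R).

(** With [t = 2 u - pi / 2] the quotient is [tan u]. This is the source of the arctangent in the
    final bound. *)
Lemma atan_1Dsin_cos t : - (pi / 2) < t < pi / 2 ->
  atan ((1 + sin t) / cos t) = pi / 4 + t / 2.
Proof.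
move=> t2; have pi0 := @pi_gt0 R.
pose u := pi / 4 + t / 2.
have tE : t = u *+ 2 - pi / 2 by rewrite /u; field.
have u2 : 0 < u < pi / 2 by rewrite /u; lra.
have cu : cos u != 0 by apply: lt0r_neq0; apply: cos_gt0_pihalf; lra.
have su : sin u != 0 by apply: lt0r_neq0; apply: sin_gt0_pi; lra.
rewrite -/u -[RHS]tanK; last by rewrite in_itv /=; lra.
congr atan; rewrite {1 2}tE sinBpihalf cosBpihalf sin_mulr2n cos_mulr2n /tan.
rewrite cos2sin2.
by field; rewrite cu su.
Qed.

(** On the real axis [|W| = 1], so [W + i] and [W - i] are orthogonal and their arguments differ by
    [pi / 2]. *)
Lemma strip_im0 c : -1 < c < 1 -> strip_im c 0 = 0 :> R.
Proof.
move=> c1; have pi0 := @pi_gt0 R.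
have h1 : - (pi / 2) < pi / 2 * c < pi / 2 by apply/andP; split; nra.
have h2 : - (pi / 2) < - (pi / 2 * c) < pi / 2 by lra.
rewrite /strip_im mulr0 oppr0 expR0 !mul1r [_ + 1]addrC atan_1Dsin_cos//.
have -> : (sin (pi / 2 * c) - 1) / cos (pi / 2 * c) =
  - ((1 + sin (- (pi / 2 * c))) / cos (- (pi / 2 * c))).
  by rewrite sinN cosN; ring.
by rewrite atanN atan_1Dsin_cos//; field; lra.
Qed.

Lemma poisson0 t : poisson 0 t = 1 :> R.
Proof. by rewrite /poisson expr0n /= mulr0 mul0r !subr0 addr0 divr1. Qed.

Lemma poisson_sum_period L r : poisson_sum L r pi = poisson_sum L r (- pi) :> R.
Proof.
apply: eq_bigr => p _; congr (_ * _).
by rewrite /poisson !cosB cosN sinN !sinpi oppr0.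
Qed.

Lemma conj_poisson_period r s : conj_poisson r (pi - s) = conj_poisson r (- pi - s) :> R.
Proof. by rewrite /conj_poisson !cosB !sinB !cosN !sinN !sinpi oppr0. Qed.

Lemma poisson_period r s : poisson r (pi - s) = poisson r (- pi - s) :> R.
Proof. by rewrite /poisson !cosB !cosN !sinN !sinpi oppr0. Qed.

Lemma conj_poisson_sum_period L r :
  conj_poisson_sum L r pi = conj_poisson_sum L r (- pi) :> R.
Proof. by apply: eq_bigr => p _; rewrite conj_poisson_period. Qed.

Lemma poisson_mean r s : 0 <= r < 1 ->
  \int[mu]_(t in `[- pi, pi]) poisson r (t - s) = 2 * pi.
Proof.
move=> r01; have [->|r0] := eqVneq r 0.
  under eq_Rintegral do rewrite poisson0.
  by rewrite Rintegral_itv_cst; have := @pi_gt0 R; lra.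
have {}r01 : 0 < r < 1 by rewrite lt0r r0.
have x0 : 0 < - ln r by rewrite oppr_gt0 ln_lt0.
have h : holo (- ln r) (fun z => poisson (r * expR z.1) (z.2 - s))
          (fun z => conj_poisson (r * expR z.1) (z.2 - s)).
  apply: holo_poisson; first by lra.
  by rewrite expRN lnK ?posrE; [rewrite divff//|lra].
have [l1 _] := poisson_left_end r s.
have := holo_circle_mean x0 h l1; rewrite /= expR0 mulr1 mulr1; apply=> x _.
exact: conj_poisson_period.
Qed.

Section strip_of_poisson_sum.
Variables (L : seq (R * R)) (r0 r1 : R).
(** The room between [r0] and [r1] makes the composed function analytic across the circle of radius
    [r0], which is the [0 < x0] of [holo_circle_mean]. *)
Hypothesis r01 : 0 < r0 < r1.
Hypothesis r1le1 : r1 <= 1.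
Hypothesis L0 : forall p, p \in L -> 0 <= p.1.
Hypothesis L1 : forall r t, 0 <= r < r1 -> poisson_sum L r t < 1.

Let M := \sum_(p <- L) p.1.

(** [M] is the value of the Poisson sum at the centre. *)
Let M01 : -1 < M < 1.
Proof.
have h01 := r01; have h1 := r1le1.
have -> : M = poisson_sum L 0 0.
  by apply: eq_bigr => p _; rewrite poisson0 mulr1.
rewrite L1 ?andbT; last by lra.
by apply: lt_le_trans (poisson_sum_ge0 _ _ L0) => //; lra.
Qed.

Let holo_re_im x0 : r0 * expR x0 <= r1 ->
  holo x0
   (fun z => strip_re (poisson_sum L (r0 * expR z.1) z.2) (conj_poisson_sum L (r0 * expR z.1) z.2))
   (fun z => strip_im (poisson_sum L (r0 * expR z.1) z.2) (conj_poisson_sum L (r0 * expR z.1) z.2)).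
Proof.
have h01 := r01; have h1 := r1le1.
move=> x01; apply: holo_strip.
  by apply: holo_poisson_sum; lra.
move=> z zx; have lt1 : 0 <= r0 * expR z.1 < r1.
  rewrite mulr_ge0 ?expR_ge0//=; last by lra.
  by apply: lt_le_trans x01; rewrite ltr_pM2l ?ltr_expR//; lra.
rewrite L1// andbT.
by apply: lt_le_trans (poisson_sum_ge0 _ _ L0) => //; lra.
Qed.

Let cvg_re_im :
  strip_re (poisson_sum L (r0 * expR z.1) z.2) (conj_poisson_sum L (r0 * expR z.1) z.2)
    @[z --> @left_end R] --> strip_re M 0 /\
  strip_im (poisson_sum L (r0 * expR z.1) z.2) (conj_poisson_sum L (r0 * expR z.1) z.2)
    @[z --> @left_end R] --> (0 : R).
Proof.
have h01 := r01; have h1 := r1le1.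
have lef := @left_end_filter R.
have [l1 l2] := poisson_sum_left_end L r0.
by have := cvg_strip _ M01 l1 l2; rewrite (strip_im0 M01); exact.
Qed.

Lemma strip_re_mean :
  \int[mu]_(t in `[- pi, pi]) strip_re (poisson_sum L r0 t) (conj_poisson_sum L r0 t)
  = 2 * pi * strip_re M 0.
Proof.
have h01 := r01; have h1 := r1le1.
have x0 : 0 < ln (r1 / r0) by rewrite ln_gt0// ltr_pdivlMr; lra.
have h : r0 * expR (ln (r1 / r0)) <= r1.
  rewrite lnK ?posrE; last by rewrite divr_gt0//; lra.
  by rewrite mulrC divfK//; apply: lt0r_neq0; lra.
have := holo_circle_mean x0 (holo_re_im h) cvg_re_im.1.
rewrite /= expR0 mulr1; apply=> x _.
by rewrite poisson_sum_period conj_poisson_sum_period.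
Qed.

(** The integrand is the imaginary part of the product of [a + i b] with the analytic function whose
    real part is the Poisson kernel. At the centre both factors are real, with values [strip_re M 0]
    and 1. *)
Lemma strip_poisson_mean r s : 0 < r < 1 ->
  \int[mu]_(t in `[- pi, pi])
     (strip_re (poisson_sum L r0 t) (conj_poisson_sum L r0 t) * conj_poisson r (t - s) +
      strip_im (poisson_sum L r0 t) (conj_poisson_sum L r0 t) * poisson r (t - s)) = 0.
Proof.
have h01 := r01; have h1 := r1le1.
have lef := @left_end_filter R.
move=> r_01; pose x0 := Num.min (ln (r1 / r0)) (- ln r).
have x0_gt0 : 0 < x0.
  by rewrite lt_min ln_gt0 ?ltr_pdivlMr ?oppr_gt0 ?ln_lt0//; lra.
have e1 : r0 * expR x0 <= r1.
  apply: (@le_trans _ _ (r0 * expR (ln (r1 / r0)))).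
    by rewrite ler_pM2l ?ler_expR ?ge_min ?lexx//; lra.
  rewrite lnK ?posrE; last by rewrite divr_gt0//; lra.
  by rewrite mulrC divfK//; apply: lt0r_neq0; lra.
have e2 : r * expR x0 <= 1.
  apply: (@le_trans _ _ (r * expR (- ln r))).
    by rewrite ler_pM2l ?ler_expR ?ge_min ?lexx ?orbT//; lra.
  by rewrite expRN lnK ?posrE; [rewrite divff//; lra|lra].
have h3 := holo_mulNi (holoM (holo_re_im e1) (@holo_poisson _ x0 r s _ e2)).
have [c1 c2] := cvg_re_im; have [c3 c4] := poisson_left_end r s.
rewrite -[RHS](mulr0 (2 * pi)) -[X in _ = _ * X](addr0 0).
rewrite -[X in _ = _ * (X + _)](mulr0 (strip_re M 0)) -[X in _ = _ * (_ + X)](mul0r 1).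
have := holo_circle_mean x0_gt0 (h3 _).
move=> /(_ _ _ (cvgD (cvgM c1 c4) (cvgM c2 c3))).
rewrite /= expR0 !mulr1; apply; first by lra.
move=> x _.
by rewrite poisson_sum_period conj_poisson_sum_period poisson_period conj_poisson_period.
Qed.

End strip_of_poisson_sum.
End strip_means.

(** * The weak-type bound for conjugate Poisson integrals *)

Section conjugate_integral.
Context {R : realType}.
Implicit Types (r s t e : R) (L : seq (R * R)).
Notation mu := (@lebesgue_measure R).

Lemma measurable_inv : measurable_fun [set: R] (@GRing.inv R).
Proof.
rewrite -(setvU [set (0 : R)]); apply/measurable_funU => //.
  by apply: measurableC; exact: measurable_set1.
split; last exact: measurable_fun_set1.
apply: open_continuous_measurable_fun; first exact/closed_openC/closed_eq.
by move=> x; rewrite inE /= => /eqP x0; exact: inv_continuous.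
Qed.

(** Extending the integrand by 0 off the product of [A] and [B] reduces this to Fubini on the whole
    space, with [|g| * |C|] on that product as dominating function. The integrability of both inner
    integrals is part of the result because the callers rescale and compare them. *)
Lemma Fubini_bounded d1 d2 (T1 : measurableType d1) (T2 : measurableType d2)
    (m1 : {sigma_finite_measure set T1 -> \bar R})
    (m2 : {sigma_finite_measure set T2 -> \bar R})
    (A : set T1) (B : set T2) (g : T1 -> R) (K : T1 * T2 -> R) (C : R) :
  measurable A -> measurable B -> (m2 B < +oo)%E ->
  m1.-integrable A (EFin \o g) -> measurable_fun [set: T1 * T2] K ->
  (forall x y, A x -> B y -> `|K (x, y)| <= C) ->
  [/\ m1.-integrable A (EFin \o (fun x => g x * \int[m2]_(y in B) K (x, y))),
     m2.-integrable B (EFin \o (fun y => \int[m1]_(x in A) (g x * K (x, y)))) &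
     \int[m1]_(x in A) (g x * \int[m2]_(y in B) K (x, y)) =
     \int[m2]_(y in B) \int[m1]_(x in A) (g x * K (x, y))].
Proof.
move=> mA mB Bfin ig mK KC.
pose h (z : T1 * T2) : R := (g \_ A) z.1 * (K z * \1_B z.2).
have mg : measurable_fun [set: T1] (g \_ A).
  by apply/(measurable_restrictT _ mA)/measurable_EFinP; exact: measurable_int ig.
have mh : measurable_fun [set: T1 * T2] h.
  apply: measurable_funM; first exact: (measurableT_comp mg).
  by apply: measurable_funM => //; apply: measurableT_comp; [exact: measurable_indic|exact: measurable_snd].
have hA x y : ~ A x -> h (x, y) = 0.
  by move=> Ax; rewrite /h patchE memNset// mul0r.
have hB x y : ~ B y -> h (x, y) = 0.
  by move=> By; rewrite /h indicE memNset// !mulr0.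
have hE x y : A x -> B y -> h (x, y) = g x * K (x, y).
  by move=> Ax By; rewrite /h patchE indicE !mem_set// mulr1.
have gA x : A x -> (g \_ A) x = g x by move=> Ax; rewrite patchE mem_set.
have hle x y : `|h (x, y)| <= `|(g \_ A) x| * (`|C| * \1_B y).
  have [Ax|nAx] := pselect (A x); last first.
    by rewrite hA// normr0 !mulr_ge0.
  have [By|nBy] := pselect (B y); last first.
    by rewrite hB// normr0 !mulr_ge0.
  rewrite hE// gA// indicE mem_set// mulr1 normrM ler_wpM2l//.
  by apply: le_trans (KC _ _ Ax By) _; exact: ler_norm.
have iA : m1.-integrable [set: T1] (EFin \o (g \_ A)).
  by rewrite -restrict_EFin; exact: (integrable_mkcond _ mA).1 ig.
have ih : (m1 \x m2)%E.-integrable [set: T1 * T2] (EFin \o h).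
  apply/integrable12ltyP; first exact/measurable_EFinP.
  apply: (@le_lt_trans _ _ (\int[m1]_x (`|(g \_ A) x|%:E * (`|C|%:E * m2 B)))%E).
    apply: ge0_le_integral => //.
    - by move=> x _; apply: integral_ge0.
    - have mah : measurable_fun [set: T1 * T2] (fun z => `|(h z)%:E|)%E.
        by apply: measurableT_comp => //; exact/measurable_EFinP.
      by apply: (@measurable_fun_fubini_tonelli_F _ _ _ _ R m2 (fun z => `|(h z)%:E|)%E mah).
    - apply: emeasurable_funM; last exact: measurable_cst.
      by apply/measurable_EFinP; apply: measurableT_comp.
    - move=> x _; rewrite -[X in (_ <= _ * (_ * m2 X))%E]setIT -integral_indic//.
      rewrite muleA -EFinM -ge0_integralZl//; last first.
        by apply/measurable_EFinP; exact: measurable_indic.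
      apply: ge0_le_integral => //.
      + apply: measurableT_comp => //; apply/measurable_EFinP.
        exact: (measurableT_comp mh).
      + apply: emeasurable_funM; first exact: measurable_cst.
        by apply/measurable_EFinP; exact: measurable_indic.
      + by move=> y _; rewrite -EFinM lee_fin -mulrA hle.
  rewrite ge0_integralZr//; last 2 first.
  - by apply/measurable_EFinP; apply: measurableT_comp.
  - by rewrite mule_ge0.
  apply: lte_mul_pinfty; first exact: integral_ge0.
    by apply: integrable_fin_num => //; exact: integrable_norm iA.
  by rewrite lte_mul_pinfty.
have KB x : A x -> m2.-integrable B (EFin \o (fun y => K (x, y))).
  move=> Ax; apply: measurable_bounded_integrable => //.
    by apply: measurable_funTS; exact: measurable_fun_pair2.
  exists C; split => [|M CM y By]; first exact: num_real.
  by apply: le_trans (KC _ _ Ax By) _; exact: ltW.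
have gK y : B y -> m1.-integrable A (EFin \o (fun x => g x * K (x, y))).
  move=> By; apply: (integrableMl mA ig (h := fun x => K (x, y))).
    by apply: measurable_funTS; exact: measurable_fun_pair1.
  exists C; split => [|M CM x Ax]; first exact: num_real.
  by apply: le_trans (KC _ _ Ax By) _; exact: ltW.
pose F x := g x * \int[m2]_(y in B) K (x, y).
pose G y := \int[m1]_(x in A) (g x * K (x, y)).
have FE x : (\int[m2]_y (h (x, y))%:E)%E = ((F \_ A) x)%:E.
  rewrite patchE; case: ifPn => [/set_mem Ax|/negP nAx].
    rewrite EFinM fineK; last exact: integrable_fin_num (KB _ Ax).
    rewrite -integralZl//; last exact: KB.
    rewrite [RHS]integral_mkcond; apply: eq_integral => y _.
    rewrite patchE; case: ifPn => [/set_mem By|/negP nBy]; first by rewrite hE.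
    by rewrite hB//; apply: contra_not nBy => /mem_set.
  rewrite (_ : (fun y => _) = cst 0%E) ?integral0//.
  by apply/funext => y; rewrite hA//; apply: contra_not nAx => /mem_set.
have GE y : (\int[m1]_x (h (x, y))%:E)%E = ((G \_ B) y)%:E.
  rewrite patchE; case: ifPn => [/set_mem By|/negP nBy].
    rewrite fineK; last exact: integrable_fin_num (gK _ By).
    rewrite [RHS]integral_mkcond; apply: eq_integral => x _.
    rewrite patchE; case: ifPn => [/set_mem Ax|/negP nAx]; first by rewrite hE.
    by rewrite hA//; apply: contra_not nAx => /mem_set.
  rewrite (_ : (fun x => _) = cst 0%E) ?integral0//.
  by apply/funext => x; rewrite hB//; apply: contra_not nBy => /mem_set.
split.
- apply/(integrable_mkcond _ mA); rewrite restrict_EFin.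
  have := integrable_fubini_F ih; congr (integrable _ _ _).
  by apply/funext => x; exact: FE.
- apply: measurable_bounded_integrable => //.
    apply/(measurable_restrictT _ mB)/measurable_EFinP.
    rewrite (_ : EFin \o _ = (fun y => \int[m1]_x (h (x, y))%:E)%E).
      exact: measurable_fubini_G ih.
    by apply/funext => y; rewrite GE.
  exists (\int[m1]_(x in A) `|g x| * `|C|); split => [|M CM y By]; first exact: num_real.
  apply: le_trans (ltW CM); rewrite -RintegralZr//; last exact: integrable_norm.
  apply: le_trans (le_normr_Rintegral _ _) _ => //; first exact: gK.
  apply: le_Rintegral => //.
  + by apply: integrable_norm; exact: gK.
  + apply: (integrableMl mA (integrable_norm ig) (h := fun=> `|C|)) => //.
    exact: bounded_cst.
  + move=> x Ax; rewrite normrM ler_wpM2l//.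
    by apply: le_trans (KC _ _ Ax By) (ler_norm _).
- rewrite Rintegral_mkcond [RHS]Rintegral_mkcond; congr fine.
  transitivity (\int[m1]_x \int[m2]_y (h (x, y))%:E)%E.
    by apply: eq_integral => x _; rewrite FE.
  transitivity (\int[m2]_y \int[m1]_x (h (x, y))%:E)%E; first exact: (Fubini ih).
  by apply: eq_integral => y _; rewrite GE.
Qed.

Definition conj_poisson_integral (g : R -> R) r t : R :=
  (2 * pi)^-1 * \int[mu]_(s in `[- pi, pi]) (g s * conj_poisson r (t - s)).

(** The half-angle sine is a distance on the circle, for which points near [pi] and [- pi] are
    close, and its mean under the Poisson kernel is small ([poisson_sin_mean]). It factors out of
    both [sin x - sin y] and [sin (x - y)]. *)
Lemma conj_poisson_lipschitz r (x y : R) : 0 <= r < 1 ->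
  `|conj_poisson r x - conj_poisson r y| <=
  16 / (1 - r) ^+ 4 * `|sin ((x - y) / 2)|.
Proof.
move=> r01; have Dx := poisson_den_gt0 x r01; have Dy := poisson_den_gt0 y r01.
have r0 : 0 <= r by lra.
have Dx' := poisson_den_ge x r0; have Dy' := poisson_den_ge y r0.
rewrite /conj_poisson; set X := 1 - _ + _ in Dx Dx' *; set Y := 1 - _ + _ in Dy Dy' *.
set d := (x - y) / 2; set m := (x + y) / 2.
have xE : x = m + d by rewrite /m /d; field.
have yE : y = m - d by rewrite /m /d; field.
have sxy : sin x - sin y = 2 * cos m * sin d.
  by rewrite xE yE sinD sinB; ring.
have sxy2 : sin (x - y) = 2 * cos d * sin d.
  rewrite (_ : x - y = d *+ 2); last by rewrite /d; field.
  by rewrite sin_mulr2n; ring.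
have -> : 2 * r * sin x / X - 2 * r * sin y / Y =
    (4 * r * ((1 + r ^+ 2) * cos m - 2 * r * cos d)) / (X * Y) * sin d.
  transitivity (2 * r * ((1 + r ^+ 2) * (sin x - sin y) - 2 * r * sin (x - y)) / (X * Y)).
    have X0 := lt0r_neq0 Dx; have Y0 := lt0r_neq0 Dy.
    by rewrite sinB; move: X0 Y0; rewrite /X /Y => X0 Y0; field; rewrite X0 Y0.
  by rewrite sxy sxy2; field; rewrite !lt0r_neq0.
rewrite normrM ler_wpM2r// normrM normfV.
have XY : (1 - r) ^+ 4 <= X * Y.
  rewrite (_ : _ ^+ 4 = (1 - r) ^+ 2 * (1 - r) ^+ 2); last by ring.
  by rewrite ler_pM// ?sqr_ge0.
have r4 : 0 < (1 - r) ^+ 4 by rewrite exprn_gt0//; lra.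
rewrite (ger0_norm (mulr_ge0 (ltW Dx) (ltW Dy))).
rewrite ler_pM//.
  by rewrite invr_ge0 mulr_ge0// ltW.
  have := cos_max m; have := cos_max d; rewrite !ler_norml => /andP[? ?] /andP[? ?].
  apply/andP; split; nra.
by rewrite lef_pV2 ?posrE// mulr_gt0.
Qed.

End conjugate_integral.

(** * Approximation of the uniform measure on a set by point masses *)

Section discretization.
Context {R : realType}.
Implicit Types (r s t e : R) (L : seq (R * R)).
Notation mu := (@lebesgue_measure R).

Lemma continuous_poisson r : 0 <= r < 1 -> continuous (poisson r).
Proof.
move=> r01 t; apply: cvgM; first exact: cvg_cst.
apply: cvgV; first exact/lt0r_neq0/poisson_den_gt0.
apply: cvgD; last exact: cvg_cst.
apply: cvgB; first exact: cvg_cst.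
by apply: cvgM; [exact: cvg_cst|exact: continuous_cos].
Qed.

Lemma continuous_conj_poisson r : 0 <= r < 1 -> continuous (conj_poisson r).
Proof.
move=> r01 t; apply: cvgM.
  by apply: cvgM; [exact: cvg_cst|exact: continuous_sin].
apply: cvgV; first exact/lt0r_neq0/poisson_den_gt0.
apply: cvgD; last exact: cvg_cst.
apply: cvgB; first exact: cvg_cst.
by apply: cvgM; [exact: cvg_cst|exact: continuous_cos].
Qed.

Lemma continuous_subr (f : R -> R) s : continuous f -> continuous (fun t => f (t - s)).
Proof.
move=> cf t; apply: (@continuous_comp _ _ _ (fun t => t - s) f); last exact: cf.
by apply: cvgB; [exact: cvg_id|exact: cvg_cst].
Qed.

Lemma integrableM_bounded d (T : measurableType d) (m : {measure set T -> \bar R})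
    (A : set T) (g h : T -> R) (C : R) : measurable A ->
  m.-integrable A (EFin \o g) -> measurable_fun A h ->
  (forall x, A x -> `|h x| <= C) -> m.-integrable A (EFin \o (fun x => g x * h x)).
Proof.
move=> mA ig mh hC; apply: (integrableMl mA ig mh).
exists C; split => [|M CM x Ax]; first exact: num_real.
by apply: le_trans (hC _ Ax) _; exact: ltW.
Qed.

Lemma sin_half_sqr t : cos t = 1 - 2 * sin (t / 2) ^+ 2.
Proof.
rewrite {1}(_ : t = (t / 2) *+ 2); last by field.
by rewrite cos_mulr2n cos2sin2; ring.
Qed.

(** Write [a] for the sine and [P] for the kernel. The denominator of [P] is at least [4 r a ^+ 2]
    and [1 - r ^+ 2 = k ^+ 2 * (1 + r)], so [a ^+ 2 * P <= k ^+ 2]; then [2 a k <= a ^+ 2 + k ^+ 2]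
    gives [a * P <= (k / 2) * P + k / 2], of mean [k]. *)
Lemma poisson_sin_mean k s : 0 < k <= 1 / 2 ->
  \int[mu]_(t in `[- pi, pi]) (`|sin ((t - s) / 2)| * poisson (1 - k ^+ 2) (t - s))
  <= 2 * pi * k.
Proof.
move=> k01; have pi0 := @pi_gt0 R.
set r := 1 - k ^+ 2; have r01 : 3 / 4 <= r < 1 by rewrite /r; nra.
have r01' : 0 <= r < 1 by lra.
have cP := continuous_poisson r01'.
have le1 t : `|sin (t / 2)| * poisson r t <= k / 2 * poisson r t + k / 2.
  have D0 := poisson_den_gt0 t r01'.
  have P0 := poisson_ge0 t r01'.
  set a := `|sin (t / 2)|; have a2 : sin (t / 2) ^+ 2 = a ^+ 2 by rewrite real_normK ?num_real.
  have aP : a ^+ 2 * poisson r t <= k ^+ 2.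
    rewrite /poisson mulrA ler_pdivrMr// sin_half_sqr a2.
    have : 0 <= a ^+ 2 by exact: sqr_ge0.
    rewrite {1}/r; have -> : 1 - (1 - k ^+ 2) ^+ 2 = k ^+ 2 * (1 + r) by rewrite /r; ring.
    move=> a0; rewrite mulrCA ler_pM2l ?exprn_gt0//; last by lra.
    have : 0 <= (1 - r) ^+ 2 by exact: sqr_ge0.
    nra.
  have : 0 <= (a - k) ^+ 2 * poisson r t by rewrite mulr_ge0// sqr_ge0.
  have k0 : 0 < k by lra.
  move=> h; rewrite -(ler_pM2l (_ : 0 < 2 * k)); last by lra.
  nra.
have cl : continuous (fun t => `|sin ((t - s) / 2)| * poisson r (t - s)).
  move=> t; apply: cvgM; last exact: continuous_subr.
  apply: cvg_norm; apply: (@continuous_comp _ _ _ (fun t => (t - s) / 2) sin); last exact: continuous_sin.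
  apply: cvgM; last exact: cvg_cst.
  by apply: cvgB; [exact: cvg_id|exact: cvg_cst].
have cr1 : continuous (fun t => k / 2 * poisson r (t - s)).
  by move=> t; apply: cvgM; [exact: cvg_cst|exact: continuous_subr].
apply: (@le_trans _ _ (\int[mu]_(t in `[- pi, pi]) (k / 2 * poisson r (t - s) + k / 2))).
  apply: le_Rintegral => //; try exact: continuous_integrable_itv.
  by apply: continuous_integrable_itv => t; apply: cvgD; [exact: cr1|exact: cvg_cst].
rewrite RintegralD//; last 2 first.
- exact: continuous_integrable_itv.
- by apply: continuous_integrable_itv => t; exact: cvg_cst.
rewrite RintegralZl//; last first.
  by apply: continuous_integrable_itv; exact: continuous_subr.
rewrite poisson_mean// Rintegral_itv_cst; last by lra.
lra.
Qed.

Lemma poisson_lipschitz r (x y : R) : 0 <= r < 1 ->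
  `|poisson r x - poisson r y| <= 2 / (1 - r) ^+ 4 * `|x - y|.
Proof.
move=> r01; have Dx := poisson_den_gt0 x r01; have Dy := poisson_den_gt0 y r01.
have r0 : 0 <= r by lra.
have Dx' := poisson_den_ge x r0; have Dy' := poisson_den_ge y r0.
have c := cos_lipschitz x y.
rewrite /poisson; set X := 1 - _ + _ in Dx Dx' *; set Y := 1 - _ + _ in Dy Dy' *.
have -> : (1 - r ^+ 2) / X - (1 - r ^+ 2) / Y =
    (2 * r * (1 - r ^+ 2) * (cos x - cos y)) / (X * Y).
  have X0 := lt0r_neq0 Dx; have Y0 := lt0r_neq0 Dy.
  by move: X0 Y0; rewrite /X /Y => X0 Y0; field; rewrite X0 Y0.
have XY : (1 - r) ^+ 4 <= X * Y.
  rewrite (_ : _ ^+ 4 = (1 - r) ^+ 2 * (1 - r) ^+ 2); last by ring.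
  by rewrite ler_pM// ?sqr_ge0.
have r4 : 0 < (1 - r) ^+ 4 by rewrite exprn_gt0//; lra.
rewrite normrM normfV (ger0_norm (mulr_ge0 (ltW Dx) (ltW Dy))) [leRHS]mulrAC ler_pM//.
- by rewrite invr_ge0 mulr_ge0// ltW.
- by rewrite normrM ler_pM// ger0_norm; nra.
- by rewrite lef_pV2 ?posrE// mulr_gt0.
Qed.

Lemma Rintegral_partition (E : set R) (F : R -> R) (a h : R) (n : nat) : 0 <= h ->
  measurable E -> mu.-integrable E (EFin \o F) ->
  \int[mu]_(x in E `&` `]a, a + h * n%:R]) F x =
  \sum_(j < n) \int[mu]_(x in E `&` `]a + h * j%:R, a + h * j.+1%:R]) F x.
Proof.
move=> h0 mE iF; elim: n => [|n ih].
  rewrite big_ord0 mulr0 addr0 set_itv_ge ?bnd_simp ?lexx//.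
  by rewrite setI0 Rintegral_set0.
rewrite big_ord_recr /= -ih -Rintegral_setU//.
- congr Rintegral; rewrite -setIUr; congr (_ `&` _).
  apply/seteqP; split => x /=; rewrite !in_itv /=.
  + by case: (leP x (a + h * n%:R)) => [h1 /andP[-> _]|h1 /andP[_ ->]]; [left|right].
  + have : h * n%:R <= h * n.+1%:R by rewrite ler_wpM2l// ler_nat.
    have : 0 <= h * n%:R by rewrite mulr_ge0.
    by move=> h1 h2 [/andP[-> h3]|/andP[h3 ->]] /=; lra.
- exact: measurableI.
- exact: measurableI.
- apply: integrableS iF => //; last by move=> x [[]|[]].
  by apply: measurableU; exact: measurableI.
- apply/disj_setPS => x /= [[_ +] [_ +]]; rewrite !in_itv /=.
  by move=> /andP[_ h1] /andP[h2 _]; have := lt_le_trans h2 h1; rewrite ltxx.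
Qed.

(* The finite measure with mass [p.1] at [p.2] stands for [1 - e] times the uniform measure on [E];
   the last bound keeps its Poisson extension inside the strip. *)
Lemma discretize_indicator (E : set R) e r1 : measurable E ->
    E `<=` `]- pi, pi] -> 0 < e < 1 -> 0 <= r1 < 1 ->
  exists L, [/\ forall p, p \in L -> 0 <= p.1,
    forall p, p \in L -> 0 < p.1 -> E p.2,
    \sum_(p <- L) p.1 = (1 - e) * (fine (mu E) / (2 * pi)) &
    forall r t, 0 <= r < r1 -> poisson_sum L r t <= 1 - e / 2].
Proof.
move=> mE Epi e01 r101; have pi0 := @pi_gt0 R.
pose Lam := 2 / (1 - r1) ^+ 4.
have Lam0 : 0 <= Lam by rewrite divr_ge0// exprn_ge0//; lra.
(* [Lam] is a Lipschitz constant of the Poisson kernel for all radii below [r1]; the mesh is so fine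
   that the kernel varies by at most [e / 2] on a cell. *)
have [n0 n0P] : exists n : nat, 2 * pi * Lam / (e / 2) < n%:R.
  by exists (Num.truncn (2 * pi * Lam / (e / 2))).+1; exact: truncnS_gt.
pose n := n0.+1; pose h := 2 * pi / n%:R : R.
have n_gt0 : 0 < n%:R :> R by rewrite ltr0n.
have h0 : 0 < h by rewrite divr_gt0//; lra.
have hn : - pi + h * n%:R = pi by rewrite /h; field; rewrite lt0r_neq0.
have hLam : h * Lam <= e / 2.
  rewrite /h mulrAC ler_pdivrMr//.
  move: n0P; rewrite ltr_pdivrMr; last by lra.
  have : n0%:R <= n%:R :> R by rewrite ler_nat.
  by move=> h1 h2; apply: le_trans (ltW h2) _; rewrite mulrC ler_pM2l//; lra.
pose I (j : nat) := E `&` `]- pi + h * j%:R, - pi + h * j.+1%:R].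
have mI j : measurable (I j) by exact: measurableI.
pose c j : R := (1 - e) * (fine (mu (I j)) / (2 * pi)).
(* [xget] samples a point of the cell. On an empty cell it returns the default 0, but the mass is
   then 0; hence membership in [E] is claimed for positive masses only. *)
pose L := [seq (c (nat_of_ord j), xget 0 (I j)) | j <- enum 'I_n].
have Efin : (mu E < +oo)%E.
  apply: (@le_lt_trans _ _ (mu `]- pi, pi]%classic)).
    by apply: le_measure => //; rewrite inE.
  by rewrite lebesgue_measure_itv /=; case: ifP => _; rewrite ltry.
have Ifin j : (mu (I j) < +oo)%E.
  by apply: le_lt_trans Efin; apply: (@le_measure _ _ _ mu _ _ (mem_set (mI j)) (mem_set mE)); exact: subIsetl.
have c0 j : 0 <= c j by rewrite !mulr_ge0 ?fine_ge0 ?invr_ge0 ?subr_ge0//; lra.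
have EI : E `&` `]- pi, - pi + h * n%:R] = E.
  by rewrite hn; apply/setIidPl.
have icst (A : set R) (k : R) : measurable A -> (mu A < +oo)%E ->
    mu.-integrable A (EFin \o (fun=> k)).
  move=> mA Afin; apply: measurable_bounded_integrable => //.
  exists `|k|; split => [|M kM x Ax]; first exact: num_real.
  exact: ltW.
have part F : mu.-integrable E (EFin \o F) ->
    \int[mu]_(x in E) F x = \sum_(j < n) \int[mu]_(x in I j) F x.
  by move=> iF; rewrite -Rintegral_partition// ?EI// ltW.
have cI j : c j = (1 - e) / (2 * pi) * \int[mu]_(x in I j) 1.
  rewrite Rintegral_cst; last exact: mI.
  by rewrite mul1r /c; field; lra.
exists L; split.
- by move=> p /mapP[j _ ->]; exact: c0.
- move=> p /mapP[j _ ->] /= cj.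
  suff : (I j) (xget 0 (I j)) by case.
  have [[x Ix]|nIx] := pselect (exists x, I j x); first exact: (xgetI 0 Ix).
  move: cj; rewrite /c (_ : I j = set0) ?measure0 ?mul0r ?mulr0 ?ltxx//.
  by rewrite -subset0 => x Ix; apply: nIx; exists x.
- rewrite big_map big_enum /=.
  under eq_bigr do rewrite cI.
  rewrite -mulr_sumr -part; last exact: icst.
  rewrite Rintegral_cst; last exact: mE.
  by rewrite mul1r; field; lra.
- move=> r t rr1; rewrite /poisson_sum big_map big_enum /=.
  have r01 : 0 <= r < 1 by lra.
  have cP : continuous (fun s => poisson r (t - s)).
    have -> : (fun s => poisson r (t - s)) = (fun s => poisson r (s - t)).
      by apply/funext => s; rewrite -opprB /poisson cosN.
    by apply: continuous_subr; exact: continuous_poisson.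
  pose F s : R := poisson r (t - s) + e / 2.
  have cF : continuous F by move=> s; apply: cvgD; [exact: cP|exact: cvg_cst].
  have iFpi : mu.-integrable `[- pi, pi] (EFin \o F) by exact: continuous_integrable_itv.
  have Epi' : E `<=` `[- pi, pi].
    by move=> x /Epi /=; rewrite !in_itv /= => /andP[/ltW -> ->].
  have iF : mu.-integrable E (EFin \o F) by apply: integrableS iFpi.
  have iFI j : mu.-integrable (I j) (EFin \o F).
    by apply: integrableS iF; [exact: mE|exact: mI|exact: subIsetl].
  have le_j (j : 'I_n) : c j * poisson r (t - xget 0 (I j)) <=
      (1 - e) / (2 * pi) * \int[mu]_(s in I j) F s.
    have -> : c j * poisson r (t - xget 0 (I j)) =
        (1 - e) / (2 * pi) * (\int[mu]_(x in I j) 1 * poisson r (t - xget 0 (I j))).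
      by rewrite cI; exact: (esym (mulrA _ _ _)).
    apply: ler_wpM2l; first by rewrite divr_ge0//; lra.
    rewrite -RintegralZr; [|exact: mI|exact: icst].
    apply: le_Rintegral; [exact: mI|exact: icst|exact: iFI|].
    move=> s Is; rewrite mul1r /F -lerBlDl.
    apply: le_trans (ler_norm _) _; apply: le_trans (poisson_lipschitz _ _ r01) _.
    apply: le_trans hLam; rewrite mulrC; apply: ler_pM => //.
    + by rewrite divr_ge0// exprn_ge0//; lra.
    + have Ix : (I j) (xget 0 (I j)) by exact: (xgetI 0 Is).
      move: Is Ix => [_ /=]; rewrite in_itv /= => /andP[s1 s2] [_ /=].
      rewrite in_itv /= => /andP[x1 x2].
      rewrite ler_norml; move: s2 x2; rewrite -natr1 mulrDr mulr1; lra.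
    + rewrite ler_pM2l// lef_pV2 ?posrE ?exprn_gt0//; [|lra|lra].
      by rewrite lerXn2r ?nnegrE//; lra.
  apply: le_trans (ler_sum _ (fun j _ => le_j j)) _.
  rewrite -mulr_sumr -part//.
  have : \int[mu]_(s in E) F s <= \int[mu]_(s in `[- pi, pi]) F s.
    rewrite -(setIidr Epi') Rintegral_mkcondr; apply: le_Rintegral => //.
    - by rewrite -restrict_EFin; apply/integrable_restrict => //; rewrite setIidr.
    - move=> s _; rewrite patchE; case: ifP => // _.
      by rewrite addr_ge0 ?poisson_ge0//; lra.
  have -> : \int[mu]_(s in `[- pi, pi]) F s = 2 * pi * (1 + e / 2).
    rewrite RintegralD//; last 2 first.
    - exact: continuous_integrable_itv.
    - by apply: continuous_integrable_itv => s; exact: cvg_cst.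
    rewrite Rintegral_itv_cst; last by lra.
    under eq_Rintegral do rewrite -opprB /poisson cosN.
    rewrite -/(poisson r _) [X in X + _](@poisson_mean _ r t)//; lra.
  move=> h1; apply: le_trans (ler_wpM2l _ h1) _; first by rewrite divr_ge0//; lra.
  (* The factor [1 - e] on the mass pays for the discretization error: this product is
     [1 - e / 2 - e ^+ 2 / 2]. *)
  rewrite [leLHS](_ : _ = (1 - e) * (1 + e / 2)); [nra|by field; lra].
Qed.

End discretization.

(** * Duality and the distributional bound at a fixed radius *)

Section weak_type_smooth.
Context {R : realType}.
Implicit Types (r s t e : R) (L : seq (R * R)).
Notation mu := (@lebesgue_measure R).

Definition extremal_rate (x : R) : R := 4 / pi * atan (expR (pi / 2 * x)) - 1.

(** With [th = pi c / 2], [strip_re c 0] is [2 / pi] times the logarithm of [(1 + sin th) / cos th =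
    tan (pi / 4 + th / 2)], which the exponential and the arctangent undo. *)
Lemma extremal_rate_strip_re (c : R) : -1 < c < 1 -> extremal_rate (strip_re c 0) = c.
Proof.
move=> c1; have pi0 := @pi_gt0 R; pose th := pi / 2 * c.
have th1 : - (pi / 2) < th < pi / 2 by rewrite /th; apply/andP; split; nra.
have cth : 0 < cos th by exact: cos_gt0_pihalf.
have sth : -1 < sin th < 1.
  have := cos2Dsin2 th; nra.
have -> : strip_re c 0 = 2 / pi * ln ((1 + sin th) / cos th).
  rewrite /strip_re !mulr0 oppr0 expR0 !mul1r -/th.
  have -> : cos th ^+ 2 + (sin th + 1) ^+ 2 = 2 * (1 + sin th).
    by have := cos2Dsin2 th; nra.
  have -> : cos th ^+ 2 + (sin th - 1) ^+ 2 = 2 * (1 - sin th).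
    by have := cos2Dsin2 th; nra.
  congr (_ * _); rewrite -mulrBl -ln_div ?posrE; [|nra|nra].
  have -> : 2 * (1 + sin th) / (2 * (1 - sin th)) = ((1 + sin th) / cos th) ^+ 2.
    have c2 : cos th ^+ 2 = (1 - sin th) * (1 + sin th).
      by have := cos2Dsin2 th; lra.
    by rewrite exprMn exprVn c2; field; lra.
  by rewrite lnXn ?divr_gt0//; [rewrite -mulr_natr; field|lra].
rewrite /extremal_rate mulrA [X in expR (X * _)](_ : _ = 1); last by field; lra.
rewrite mul1r lnK ?posrE ?divr_gt0//; last by lra.
by rewrite atan_1Dsin_cos// /th; field; lra.
Qed.

Lemma le_extremal_rate (x y : R) : x <= y -> extremal_rate x <= extremal_rate y.
Proof.
move=> xy; have pi0 := @pi_gt0 R.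
rewrite lerB// ler_pM2l ?divr_gt0// le_atan// ler_expR ler_pM2l//; lra.
Qed.

Lemma continuous_Rintegral_sum (I : Type) (l : seq I) (F : I -> R -> R) (a b : R) :
  (forall i, continuous (F i)) ->
  \int[mu]_(t in `[a, b]) (\sum_(i <- l) F i t) = \sum_(i <- l) \int[mu]_(t in `[a, b]) F i t.
Proof.
move=> cF; elim: l => [|i l ih].
  rewrite big_nil; under eq_Rintegral do rewrite big_nil.
  by rewrite Rintegral_cst// mul0r.
rewrite big_cons -ih -RintegralD//; last 2 first.
- exact: continuous_integrable_itv.
- apply: continuous_integrable_itv.
  elim: l {ih} => [|j l ih] t.
    by under eq_fun do rewrite big_nil; exact: cvg_cst.
  by under eq_fun do rewrite big_cons; apply: cvgD; [exact: cF|exact: ih].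
by apply: eq_Rintegral => t _; rewrite big_cons.
Qed.

Lemma continuous_poisson_sum L r : 0 <= r < 1 -> continuous (poisson_sum L r).
Proof.
move=> r01; rewrite /poisson_sum; elim: L => [|p L ih] t.
  by under eq_fun do rewrite big_nil; exact: cvg_cst.
under eq_fun do rewrite big_cons.
apply: cvgD; last exact: ih.
by apply: cvgM; [exact: cvg_cst|apply: continuous_subr; exact: continuous_poisson].
Qed.

Lemma continuous_conj_poisson_sum L r : 0 <= r < 1 -> continuous (conj_poisson_sum L r).
Proof.
move=> r01; rewrite /conj_poisson_sum; elim: L => [|p L ih] t.
  by under eq_fun do rewrite big_nil; exact: cvg_cst.
under eq_fun do rewrite big_cons.
apply: cvgD; last exact: ih.
by apply: cvgM; [exact: cvg_cst|apply: continuous_subr; exact: continuous_conj_poisson].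
Qed.

Section fixed_function.
Variables (g : R -> R) (r : R).
Hypothesis ig : mu.-integrable `[- pi, pi] (EFin \o g).
Hypothesis r01 : 0 < r < 1.

Let v := conj_poisson_integral g r.
Let N := (2 * pi)^-1 * \int[mu]_(s in `[- pi, pi]) `|g s|.

Let r01' : 0 <= r < 1.
Proof. by have h := r01; lra. Qed.

Let measurable_kernel t : measurable_fun setT (fun s => conj_poisson r (t - s)).
Proof.
apply: continuous_measurable_fun => s.
apply: (@continuous_comp _ _ _ (fun s => t - s) (conj_poisson r)).
  by apply: cvgB; [exact: cvg_cst|exact: cvg_id].
exact: (continuous_conj_poisson r01').
Qed.

Lemma conj_poisson_bound t : `|conj_poisson r t| <= 16 / (1 - r) ^+ 4.
Proof.
have := conj_poisson_lipschitz t 0 r01'.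
rewrite {2}/conj_poisson sin0 mulr0 mul0r !subr0 => /le_trans; apply.
rewrite ler_piMr ?sin_max// divr_ge0// exprn_ge0//.
by have h := r01; lra.
Qed.

Let integrable_kernel t :
  mu.-integrable `[- pi, pi] (EFin \o (fun s => g s * conj_poisson r (t - s))).
Proof.
apply: (integrableM_bounded _ ig) => //; last by move=> s _; exact: conj_poisson_bound.
by apply: measurable_funTS; exact: measurable_kernel.
Qed.

Lemma conj_poisson_integral_lipschitz (x y : R) :
  `|v x - v y| <= 16 / (1 - r) ^+ 4 * N * `|sin ((x - y) / 2)|.
Proof.
have h := r01; have pi0 := @pi_gt0 R.
rewrite /v /conj_poisson_integral -mulrBr normrM ger0_norm; last first.
  by rewrite invr_ge0; lra.
rewrite -RintegralB; [|by []|exact: integrable_kernel|exact: integrable_kernel].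
rewrite [leRHS](_ : _ = (2 * pi)^-1 * (\int[mu]_(s in `[- pi, pi]) `|g s| *
   (16 / (1 - r) ^+ 4 * `|sin ((x - y) / 2)|))); last by rewrite /N; ring.
apply: ler_wpM2l; first by rewrite invr_ge0; lra.
have mk : measurable_fun `[- pi, pi] (fun s => conj_poisson r (x - s) - conj_poisson r (y - s)).
  by apply: measurable_funTS; apply: measurable_funB; exact: measurable_kernel.
have le1 s : `|conj_poisson r (x - s) - conj_poisson r (y - s)| <=
    16 / (1 - r) ^+ 4 * `|sin ((x - y) / 2)|.
  have := conj_poisson_lipschitz (x - s) (y - s) r01'.
  by rewrite (_ : x - s - (y - s) = x - y); [|ring].
have ik : mu.-integrable `[- pi, pi]
    (EFin \o (fun s => g s * (conj_poisson r (x - s) - conj_poisson r (y - s)))).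
  by apply: (integrableM_bounded _ ig mk) => // s _; exact: le1.
rewrite -RintegralZr//; last exact: integrable_norm.
rewrite (_ : \int[mu]_(s in _) _ = \int[mu]_(s in `[- pi, pi])
   (g s * (conj_poisson r (x - s) - conj_poisson r (y - s)))); last first.
  by apply: eq_Rintegral => s _; rewrite mulrBr.
apply: le_trans (le_normr_Rintegral _ _) _ => //.
apply: le_Rintegral => //.
- exact: integrable_norm.
- apply: (integrableM_bounded (C := 16 / (1 - r) ^+ 4 * `|sin ((x - y) / 2)|)) => //.
    exact: integrable_norm.
  by move=> s _; rewrite ger0_norm// mulr_ge0// divr_ge0// exprn_ge0//; lra.
- by move=> s _; rewrite normrM ler_wpM2l.
Qed.

Lemma continuous_conj_poisson_integral : continuous v.
Proof.
move=> x; apply/cvgrPdist_le => e e0.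
pose M := `|16 / (1 - r) ^+ 4 * N| + 1.
have M0 : 0 < M by rewrite ltr_pwDr.
near=> y.
apply: le_trans (conj_poisson_integral_lipschitz _ _) _.
apply: (@le_trans _ _ (M * `|x - y|)).
  apply: ler_pM => //.
  - rewrite mulr_ge0//; first by rewrite divr_ge0// exprn_ge0//; have h := r01; lra.
    by rewrite mulr_ge0 ?invr_ge0 ?mulr_ge0 ?pi_ge0//; exact: Rintegral_ge0.
  - by rewrite /M; have := ler_norm (16 / (1 - r) ^+ 4 * N); lra.
  - have := sin_lipschitz ((x - y) / 2) 0; rewrite sin0 !subr0 => /le_trans; apply.
    by rewrite normrM [`|2^-1|]ger0_norm//; have := normr_ge0 (x - y); lra.
rewrite -ler_pdivlMl//; near: y.
have : 0 < M^-1 * e by rewrite mulr_gt0// invr_gt0.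
by move=> d0; exists (M^-1 * e) => // z /= /ltW.
Unshelve. all: end_near. Qed.

(** After exchanging the integrals, the inner integral of [a] against the conjugate kernel is minus
    that of [b] against the Poisson kernel, hence at most [2 * pi] in absolute value since
    [|b| <= 1]. *)
Lemma conj_poisson_duality (a b : R -> R) : continuous a -> continuous b ->
  (forall t, `|b t| <= 1) ->
  (forall s, \int[mu]_(t in `[- pi, pi])
    (a t * conj_poisson r (t - s) + b t * poisson r (t - s)) = 0) ->
  \int[mu]_(t in `[- pi, pi]) (v t * a t) <= 2 * pi * N.
Proof.
move=> ca cb b1 ab; have pi0 := @pi_gt0 R; have h := r01.
have [Ca CaP] : exists C : R, forall t, - pi <= t <= pi -> `|a t| <= C.
  have [|M MP] := @continuous_bounded_rectangle R (fun z => a z.2) 0 0 (- pi) pi.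
    by move=> z _; apply: (@continuous_comp _ _ _ snd a); [exact: cvg_snd|exact: ca].
  by exists M => t tpi; apply: (MP 0) => //; rewrite lexx.
pose K (z : R * R) := a z.2 * conj_poisson r (z.2 - z.1).
have mK : measurable_fun setT K.
  apply: measurable_funM.
    by apply: measurableT_comp => //; exact: continuous_measurable_fun.
  have mQ : measurable_fun [set: R] (conj_poisson r).
    by apply: continuous_measurable_fun; exact: (continuous_conj_poisson r01').
  by apply: (measurableT_comp mQ); apply: measurable_funB.
have KC (s t : R) : `[- pi, pi]%classic s -> `[- pi, pi]%classic t ->
    `|K (s, t)| <= Ca * (16 / (1 - r) ^+ 4).
  move=> _; rewrite /= in_itv /= => tpi; rewrite normrM ler_pM//; first exact: CaP.
  exact: conj_poisson_bound.
have pifin : (mu `[(- pi)%R, pi]%classic < +oo)%E.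
  by rewrite lebesgue_measure_itv /=; case: ifP => _; rewrite ltry.
have [i1 i2 FE] := @Fubini_bounded R _ _ _ _ mu mu `[- pi, pi] `[- pi, pi] g K _
  (measurable_itv _) (measurable_itv _) pifin ig mK KC.
have -> : \int[mu]_(t in `[- pi, pi]) (v t * a t) =
   (2 * pi)^-1 * \int[mu]_(t in `[- pi, pi]) \int[mu]_(s in `[- pi, pi]) (g s * K (s, t)).
  rewrite -RintegralZl//; apply: eq_Rintegral => t _.
  rewrite /v /conj_poisson_integral -mulrA -RintegralZr//; congr (_ * _).
  by apply: eq_Rintegral => s _; rewrite /K /=; ring.
rewrite -FE.
rewrite [leRHS](_ : _ = (2 * pi)^-1 * (\int[mu]_(s in `[- pi, pi]) `|g s| * (2 * pi))); last first.
  by rewrite /N; ring.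
apply: ler_wpM2l; first by rewrite invr_ge0; lra.
rewrite -RintegralZr//; last exact: integrable_norm.
apply: le_Rintegral => //.
  apply: (integrableM_bounded (C := 2 * pi)) => //; first exact: integrable_norm.
  by move=> s _; rewrite ger0_norm//; lra.
move=> s _; apply: le_trans (ler_norm _) _; rewrite normrM ler_wpM2l//.
have cQ : continuous (fun t => a t * conj_poisson r (t - s)).
  move=> t; apply: cvgM; first exact: ca.
  by apply: continuous_subr; exact: (continuous_conj_poisson r01').
have cP : continuous (fun t => poisson r (t - s)).
  by apply: continuous_subr; exact: (continuous_poisson r01').
have cbP : continuous (fun t => b t * poisson r (t - s)).
  by move=> t; apply: cvgM; [exact: cb|exact: cP].
have := ab s; rewrite RintegralD//; [|exact: continuous_integrable_itv..].
move=> /eqP; rewrite addr_eq0 => /eqP; rewrite /K /= => ->.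
rewrite normrN -(poisson_mean s r01').
apply: le_trans (le_normr_Rintegral _ _) _ => //; first exact: continuous_integrable_itv.
apply: le_Rintegral => //; [|exact: continuous_integrable_itv|].
  by apply: continuous_integrable_itv => t; apply: cvg_norm; exact: cbP.
move=> t _; rewrite normrM (ger0_norm (poisson_ge0 _ r01')).
by rewrite ler_piMl// poisson_ge0.
Qed.

(* At radius [1 - k ^+ 2] the function [a] is not exactly supported on [E]; as [v] is Lipschitz, the
   error is at most the mean of [|sin ((t - s) / 2)|] under the Poisson kernel, which is [<= k]. *)
Lemma conj_poisson_weak_type_aux e kap : 0 < e < 1 -> 0 < kap ->
  let E := [set t | - pi < t <= pi /\ kap <= v t] in
  measurable E ->
  kap * strip_re ((1 - e) * (fine (mu E) / (2 * pi))) 0 <= N.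
Proof.
move=> e01 kap0 E mE; have pi0 := @pi_gt0 R; have h := r01.
have N0 : 0 <= N.
  by rewrite mulr_ge0 ?invr_ge0 ?mulr_ge0 ?pi_ge0//; exact: Rintegral_ge0.
apply/ler_addgt0Pl => d d0.
pose Lv := 16 / (1 - r) ^+ 4 * N.
have Lv0 : 0 <= Lv by rewrite mulr_ge0// divr_ge0// exprn_ge0//; lra.
pose C := (1 - sin (pi / 2 * (1 - e / 2)))^-1.
have C0 : 0 <= C by rewrite invr_ge0 subr_ge0 sin_le1.
(* The total error will be [C * Lv * k], to be at most [d]; [1 / 2] is the range of
   [poisson_sin_mean]. *)
pose k := Num.min (1 / 2) (d / (C * Lv + 1)).
have CLv1 : 0 <= C * Lv := mulr_ge0 C0 Lv0.
have CLv0 : 0 < C * Lv + 1 by rewrite ltr_wpDl.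
have k0 : 0 < k by rewrite lt_min divr_gt0// divr_gt0.
have k12 : k <= 1 / 2 by rewrite ge_min lexx.
have kd : C * Lv * k <= d.
  have : k <= d / (C * Lv + 1) by rewrite ge_min lexx orbT.
  rewrite ler_pdivlMr// mulrC; nra.
(* [r0] is the radius of [poisson_sin_mean], and [r1] leaves room on both sides: above [r0] for
   analyticity, below 1 for the discretization. *)
pose r0 := 1 - k ^+ 2; pose r1 := 1 - k ^+ 2 / 2.
have r0r1 : 0 < r0 < r1 by rewrite /r0 /r1; nra.
have r11 : 0 <= r1 < 1 by rewrite /r1; nra.
have r01s : 0 <= r0 < 1 by lra.
have Epi : E `<=` `]- pi, pi] by move=> t [tpi _]; rewrite /= in_itv.
have [L [L0 LE Lsum L1]] := discretize_indicator mE Epi e01 r11.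
have L1' r' t : 0 <= r' < r1 -> poisson_sum L r' t < 1.
  by move=> /(L1 _ t); lra.
have X0 r' t : 0 <= r' < r1 -> 0 <= poisson_sum L r' t.
  by move=> r'1; apply: poisson_sum_ge0 => //; lra.
have r0r1' : 0 <= r0 < r1 by lra.
have Xm t : -1 < poisson_sum L r0 t < 1.
  by have := X0 _ t r0r1'; have := L1' _ t r0r1'; lra.
pose a t := strip_re (poisson_sum L r0 t) (conj_poisson_sum L r0 t).
pose b t := strip_im (poisson_sum L r0 t) (conj_poisson_sum L r0 t).
have cX := @continuous_poisson_sum L _ r01s.
have cY := @continuous_conj_poisson_sum L _ r01s.
have ca : continuous a by move=> t; have [] := cvg_strip _ (Xm t) (cX t) (cY t).
have cb : continuous b by move=> t; have [] := cvg_strip _ (Xm t) (cX t) (cY t).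
have cv := continuous_conj_poisson_integral.
have r1le : r1 <= 1 by lra.
have dual : \int[mu]_(t in `[- pi, pi]) (v t * a t) <= 2 * pi * N.
  apply: (conj_poisson_duality ca cb) => [t|s].
    exact: strip_im_norm_le1.
  exact: (strip_poisson_mean r0r1 r1le L0 L1').
have mean : \int[mu]_(t in `[- pi, pi]) a t = 2 * pi * strip_re (\sum_(p <- L) p.1) 0.
  exact: (strip_re_mean r0r1 r1le L0 L1').
rewrite -Lsum.
pose S (p : R * R) (t : R) := p.1 * (`|sin ((t - p.2) / 2)| * poisson r0 (t - p.2)) : R.
have cS p : continuous (S p).
  move=> t; apply: cvgM; first exact: cvg_cst.
  apply: cvgM; last by apply: continuous_subr; exact: continuous_poisson.
  apply: cvg_norm; apply: (@continuous_comp _ _ _ (fun t => (t - p.2) / 2) sin); last exact: continuous_sin.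
  apply: cvgM; last exact: cvg_cst.
  by apply: cvgB; [exact: cvg_id|exact: cvg_cst].
pose SL t := \sum_(p <- L) S p t.
have cSL : continuous SL.
  rewrite /SL; elim: (L) => [|p l ih] t.
    by under eq_fun do rewrite big_nil; exact: cvg_cst.
  by under eq_fun do rewrite big_cons; apply: cvgD; [exact: cS|exact: ih].
have a0 t : 0 <= a t.
  by apply: strip_re_ge0; rewrite X0//= L1'.
(* Where [v t < kap], [a t] is at most [C] times the Poisson sum, and every point [p.2] with
   positive mass has [v p.2 >= kap], so that [kap - v t <= v p.2 - v t <= Lv * |sin ((t - p.2) /
   2)|]. *)
have pointwise t : kap * a t <= v t * a t + C * Lv * SL t.
  have [kv|vk] := leP kap (v t).
    have SL0 : 0 <= SL t.
      rewrite /SL big_seq; apply: sumr_ge0 => p pL.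
      exact: (mulr_ge0 (L0 _ pL) (mulr_ge0 (normr_ge0 _) (poisson_ge0 _ r01s))).
    rewrite -[leLHS]addr0; apply: lerD; first exact: ler_wpM2r.
    exact: (mulr_ge0 CLv1 SL0).
  rewrite -lerBlDl -mulrBl.
  have aX : a t <= C * poisson_sum L r0 t.
    rewrite mulrC; apply: strip_re_le; first by lra.
    by rewrite X0//= L1.
  apply: (@le_trans _ _ ((kap - v t) * (C * poisson_sum L r0 t))).
    by rewrite ler_wpM2l// subr_ge0 ltW.
  rewrite mulrCA -mulrA ler_wpM2l// /poisson_sum /SL !mulr_sumr.
  rewrite !big_seq; apply: ler_sum => p pL.
  have P0 := poisson_ge0 (t - p.2) r01s.
  have := L0 _ pL; rewrite le_eqVlt => /predU1P[p0|p0].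
    by rewrite /S -p0 !mul0r !mulr0.
  have [_ kvp] := LE _ pL p0.
  rewrite /S [leLHS]mulrCA [leRHS]mulrCA [X in _ <= _ * X]mulrA.
  apply: (ler_wpM2l (ltW p0)); apply: (ler_wpM2r P0).
  have := conj_poisson_integral_lipschitz t p.2; rewrite -/Lv ler_norml => /andP[lip _].
  apply: le_trans (_ : _ <= v p.2 - v t) _; first by rewrite lerB.
  by rewrite -lerN2 opprB.
have int_le : \int[mu]_(t in `[- pi, pi]) (kap * a t) <=
    \int[mu]_(t in `[- pi, pi]) (v t * a t + C * Lv * SL t).
  apply: le_Rintegral => //.
  - by apply: continuous_integrable_itv => t; apply: cvgM; [exact: cvg_cst|exact: ca].
  - apply: continuous_integrable_itv => t; apply: cvgD.
      by apply: cvgM; [exact: cv|exact: ca].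
    by apply: cvgM; [exact: cvg_cst|exact: cSL].
have ia : mu.-integrable `[- pi, pi] (EFin \o a) by exact: continuous_integrable_itv.
have iS : mu.-integrable `[- pi, pi] (EFin \o SL) by exact: continuous_integrable_itv.
have intS : \int[mu]_(t in `[- pi, pi]) SL t <= 2 * pi * k.
  rewrite continuous_Rintegral_sum//.
  apply: (@le_trans _ _ (\sum_(p <- L) p.1 * (2 * pi * k))).
    rewrite !big_seq; apply: ler_sum => p pL.
    rewrite /S RintegralZl//; last first.
      apply: continuous_integrable_itv => t.
      apply: cvgM; last by apply: continuous_subr; exact: continuous_poisson.
      apply: cvg_norm; apply: (@continuous_comp _ _ _ (fun t => (t - p.2) / 2) sin); last exact: continuous_sin.
      apply: cvgM; last exact: cvg_cst.
      by apply: cvgB; [exact: cvg_id|exact: cvg_cst].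
    apply: ler_wpM2l; first exact: L0.
    by apply: poisson_sin_mean; rewrite k0.
  rewrite -mulr_suml ler_piMl//; first by rewrite mulr_ge0 ?(ltW k0)//; lra.
  have := L1' 0 0; rewrite /poisson_sum.
  under eq_bigr do rewrite poisson0 mulr1.
  by move=> /(_ _)/ltW; apply; lra.
move: int_le; rewrite RintegralZl// RintegralD//; last 2 first.
- by apply: continuous_integrable_itv => t; apply: cvgM; [exact: cv|exact: ca].
- by apply: continuous_integrable_itv => t; apply: cvgM; [exact: cvg_cst|exact: cSL].
have -> : \int[mu]_(x in `[- pi, pi]) (C * Lv * SL x) =
    C * Lv * \int[mu]_(x in `[- pi, pi]) SL x by rewrite RintegralZl.
rewrite mean => int_le.
have : C * Lv * \int[mu]_(t in `[- pi, pi]) SL t <= C * Lv * (2 * pi * k).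
  by rewrite ler_wpM2l.
move=> le2; rewrite -(ler_pM2l (_ : 0 < 2 * pi)); last by lra.
have : 2 * pi * (C * Lv * k) <= 2 * pi * d by rewrite ler_pM2l//; lra.
lra.
Qed.

(** Applying the increasing [extremal_rate] to the auxiliary bound yields
    [(1 - e) * m <= extremal_rate (N / kap)], and [e] is arbitrary. The factor [1 - e] keeps the
    argument of [strip_re] below 1 even when [E] has full measure. *)
Lemma conj_poisson_weak_type kap : 0 < kap ->
  let E := [set t | - pi < t <= pi /\ kap <= v t] in
  measurable E /\ fine (mu E) / (2 * pi) <= extremal_rate (N / kap).
Proof.
move=> kap0 E; have pi0 := @pi_gt0 R.
have mE : measurable E.
  have -> : E = `]- pi, pi] `&` v @^-1` `[kap, +oo[.
    by apply/seteqP; split => t /=; rewrite !in_itv /= andbT.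
  apply: measurableI => //; rewrite -[X in measurable X]setTI.
  apply: continuous_measurable_fun => //; exact: continuous_conj_poisson_integral.
split=> //; set m := fine (mu E) / (2 * pi).
have m01 : 0 <= m <= 1.
  rewrite divr_ge0 ?fine_ge0//=; last by lra.
  rewrite ler_pdivrMr ?mul1r; last by lra.
  have pifin : mu `]- pi, pi]%classic = (2 * pi)%:E.
    rewrite lebesgue_measure_itv /= lte_fin ifT; last by lra.
    by rewrite -EFinB; congr EFin; ring.
  have Ele : (mu E <= (2 * pi)%:E)%E.
    rewrite -pifin; apply: le_measure; rewrite ?inE//.
    by move=> t [tpi _]; rewrite /= in_itv.
  rewrite -lee_fin fineK// ge0_fin_numE//.
  by apply: le_lt_trans Ele _; rewrite ltry.
apply/ler_addgt0Pl => d d0; pose e := Num.min d (1 / 2).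
have e01 : 0 < e < 1.
  by rewrite lt_min d0 /= gt_min; apply/andP; split; [lra|apply/orP; right; lra].
have ed : e <= d by rewrite ge_min lexx.
have := conj_poisson_weak_type_aux e01 kap0 mE; rewrite -/m mulrC -ler_pdivlMr//.
move=> /le_extremal_rate; rewrite extremal_rate_strip_re; first by nra.
by apply/andP; split; nra.
Qed.

End fixed_function.
End weak_type_smooth.

(** * Principal values and Abel means *)

Section abelian.
Context {R : realType}.
Implicit Types (r s t e k : R).
Notation mu := (@lebesgue_measure R).

Lemma integrable_mulrl d (T : measurableType d) (m : {measure set T -> \bar R})
    (A : set T) (h : T -> R) (c : R) : measurable A ->
  m.-integrable A (EFin \o h) -> m.-integrable A (EFin \o (fun x => c * h x)).
Proof.
move=> mA ih; have := integrableZl mA c ih.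
by under eq_fun do rewrite -EFinM.
Qed.

Lemma lt_chord t s e : 0 <= e ->
  (real_complex R e < `|val (expi s) - val (expi t)| :> R[i]) =
  (e < 2 * `|sin ((t - s) / 2)|).
Proof.
move=> e0; rewrite normc_def /= ltcR.
have -> : (cos s - cos t) ^+ 2 + (sin s - sin t) ^+ 2 = (2 * `|sin ((t - s) / 2)|) ^+ 2.
  rewrite exprMn real_normK ?num_real//.
  have := sin_half_sqr (t - s); rewrite cosB => h.
  have : (cos s - cos t) ^+ 2 + (sin s - sin t) ^+ 2 =
    (cos s ^+ 2 + sin s ^+ 2) + (cos t ^+ 2 + sin t ^+ 2) -
    2 * (cos t * cos s + sin t * sin s) by ring.
  by rewrite !cos2Dsin2 h => ->; ring.
by rewrite sqrtr_sqr ger0_norm// mulr_ge0.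
Qed.

Lemma truncated_periodE t e : 0 <= e -> truncated_period t e =
  `[- pi, pi]%classic `&` [set s | e < 2 * `|sin ((t - s) / 2)|].
Proof.
move=> e0; apply/seteqP; split => s /=; rewrite in_itv /= => -[h1].
  by rewrite lt_chord.
by rewrite -lt_chord.
Qed.

Lemma cot_half_le (u : R) : `|cot (u / 2)| * (2 * `|sin (u / 2)|) <= 2.
Proof.
rewrite /cot normrM normfV; have [->|s0] := eqVneq (sin (u / 2)) 0.
  by rewrite normr0 !mulr0.
rewrite (_ : _ / _ * _ = 2 * `|cos (u / 2)|); first by have := cos_max (u / 2); lra.
by field; rewrite normr_eq0.
Qed.

(** The denominator of the kernel is [r * c ^+ 2 + (1 - r) ^+ 2]. At [c = 0] both sides vanish,
    [cot] being 0 there by the convention on division by 0. *)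
Lemma conj_poisson_cot r (u : R) : 0 < r < 1 ->
  let c := 2 * `|sin (u / 2)| in
  conj_poisson r u = cot (u / 2) * (c ^+ 2 / (c ^+ 2 + (1 - r) ^+ 2 / r)).
Proof.
move=> r01 /=; rewrite exprMn real_normK ?num_real// /conj_poisson /cot.
have D0 : 0 < 1 - 2 * r * cos u + r ^+ 2 by apply: poisson_den_gt0; lra.
have sE : sin u = 2 * sin (u / 2) * cos (u / 2).
  by rewrite {1}(_ : u = (u / 2) *+ 2); [rewrite sin_mulr2n; ring|field].
have DE : 2 ^+ 2 * sin (u / 2) ^+ 2 + (1 - r) ^+ 2 / r = (1 - 2 * r * cos u + r ^+ 2) / r.
  by rewrite (sin_half_sqr u); field; lra.
rewrite DE sE; have [->|s0] := eqVneq (sin (u / 2)) 0.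
  by rewrite !(mulr0, mul0r, expr0n).
by field; rewrite s0 lt0r_neq0//=; lra.
Qed.

Let continuous_half t : continuous (fun s => (t - s) / 2).
Proof.
move=> s; apply: cvgM; last exact: cvg_cst.
by apply: cvgB; [exact: cvg_cst|exact: cvg_id].
Qed.

Lemma measurable_cot_half t : measurable_fun [set: R] (fun s => cot ((t - s) / 2)).
Proof.
apply: measurable_funM.
  apply: continuous_measurable_fun => s.
  apply: (@continuous_comp _ _ _ (fun s => (t - s) / 2) cos); last exact: continuous_cos.
  exact: continuous_half.
apply: (measurableT_comp measurable_inv).
apply: continuous_measurable_fun => s.
apply: (@continuous_comp _ _ _ (fun s => (t - s) / 2) sin); last exact: continuous_sin.
exact: continuous_half.
Qed.

Lemma measurable_chord t : measurable_fun [set: R] (fun s => 2 * `|sin ((t - s) / 2)|).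
Proof.
apply: continuous_measurable_fun => s; apply: cvgM; first exact: cvg_cst.
apply: cvg_norm; apply: (@continuous_comp _ _ _ (fun s => (t - s) / 2) sin); last exact: continuous_sin.
exact: continuous_half.
Qed.

(** The truncation is moved from the domain to the integrand, so that all integrals run over
    [[- pi, pi]] and can be exchanged with an integral in [e]. *)
Definition truncated_kernel t e s : R :=
  if e < 2 * `|sin ((t - s) / 2)| then cot ((t - s) / 2) else 0.

Lemma truncated_kernel_le t e s : 0 < e -> `|truncated_kernel t e s| <= 2 / e.
Proof.
move=> e0; rewrite /truncated_kernel.
case: ifPn => [ech|_]; last by rewrite normr0 divr_ge0// ltW.
rewrite ler_pdivlMr//; apply: le_trans (cot_half_le (t - s)).
by apply: ler_wpM2l => //; exact: ltW.
Qed.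

Lemma measurable_truncated_kernel t e : measurable_fun [set: R] (truncated_kernel t e).
Proof.
apply: measurable_fun_ifT => //; last exact: measurable_cot_half.
by apply: measurable_fun_ltr => //; exact: measurable_chord.
Qed.

Lemma integrable_truncated_kernel (g : R -> R) t e : 0 < e ->
  mu.-integrable `[- pi, pi] (EFin \o g) ->
  mu.-integrable `[- pi, pi] (EFin \o (fun s => g s * truncated_kernel t e s)).
Proof.
move=> e0 ig; apply: (integrableM_bounded _ ig) => //.
  by apply: measurable_funTS; exact: measurable_truncated_kernel.
by move=> s _; exact: truncated_kernel_le.
Qed.

Lemma truncated_hilbertE (f : circle R -> R) t e : 0 <= e ->
  truncated_hilbert f t e =
  (2 * pi)^-1 * \int[mu]_(s in `[- pi, pi]) (f (expi s) * truncated_kernel t e s).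
Proof.
move=> e0; rewrite /truncated_hilbert truncated_periodE// Rintegral_mkcondr.
congr (_ * _); apply: eq_Rintegral => s _; rewrite patchE /truncated_kernel.
case: (boolP (e < _)) => h; first by rewrite mem_set.
by rewrite memNset ?mulr0//; exact/negP.
Qed.

Lemma truncated_hilbert_le (f : circle R -> R) t e : L1_circle f -> 0 < e ->
  `|truncated_hilbert f t e| <= L1norm_circle f * (2 / e).
Proof.
move=> ig e0; have pi0 := @pi_gt0 R.
rewrite truncated_hilbertE ?(ltW e0)// normrM ger0_norm ?invr_ge0 ?mulr_ge0 ?(ltW pi0)//.
rewrite /L1norm_circle -mulrA; apply: ler_wpM2l; first by rewrite invr_ge0; lra.
apply: le_trans (le_normr_Rintegral _ _) _ => //.
  exact: integrable_truncated_kernel.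
rewrite -RintegralZr//; last exact: integrable_norm.
apply: le_Rintegral => //.
- by apply: integrable_norm; exact: integrable_truncated_kernel.
- apply: (integrableM_bounded (C := 2 / e)) => //; first exact: integrable_norm.
  by move=> s _; rewrite ger0_norm// divr_ge0// ltW.
- by move=> s _; rewrite normrM ler_wpM2l// truncated_kernel_le.
Qed.

(** The derivative in [e] of [e ^+ 2 / (e ^+ 2 + k)]: a density whose mass on [[0, 2]] is
    [4 / (4 + k)] and concentrates at 0 as [k] tends to 0. *)
Definition abel_weight k e : R := 2 * k * e / (e ^+ 2 + k) ^+ 2.

Lemma continuous_abel_weight k : 0 < k -> continuous (abel_weight k).
Proof.
move=> k0 e; apply: cvgM.
  by apply: cvgM; [exact: cvg_cst|exact: cvg_id].
apply: cvgV; first by rewrite expf_neq0// lt0r_neq0// ltr_wpDl// sqr_ge0.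
under eq_fun do rewrite !expr2; rewrite !expr2.
by apply: cvgM; apply: cvgD; try exact: cvg_cst; apply: cvgM; exact: cvg_id.
Qed.

Lemma abel_weight_integral k (c : R) : 0 < k -> 0 <= c ->
  \int[mu]_(e in `[0, c]) abel_weight k e = c ^+ 2 / (c ^+ 2 + k).
Proof.
move=> k0; rewrite le_eqVlt => /predU1P[<-|c0].
  by rewrite set_itv1 Rintegral_set1 expr0n /= mul0r.
have dF (e : R) : is_derive e 1 (fun e => e ^+ 2 / (e ^+ 2 + k)) (abel_weight k e).
  have ek : e ^+ 2 + k != 0 by rewrite lt0r_neq0// ltr_wpDl// sqr_ge0.
  have d2 : is_derive e 1 (fun e => e ^+ 2) (2 * e).
    have := is_derive_sqrD (is_derive_id e 1) (is_derive_cst (0 : R) e 1).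
    under eq_fun do rewrite /= expr0n /= addr0.
    by move=> h; apply: (is_derive_eq h); rewrite /=; ring.
  have d3 : is_derive e 1 (fun e => e ^+ 2 + k) (2 * e).
    by apply: (is_derive_eq (is_deriveD d2 (is_derive_cst k e 1))); rewrite addr0.
  have d4 := @is_deriveV R (fun e => e ^+ 2 + k) _ _ _ ek d3.
  apply: (is_derive_eq (is_deriveM d2 d4)).
  by rewrite /GRing.scale /= /abel_weight; field.
have cw := continuous_abel_weight k0.
by rewrite (continuous_Rintegral_derivative c0 dF cw) expr0n /= mul0r subr0.
Qed.

Lemma abel_weight_ge0 k e : 0 < k -> 0 <= e -> 0 <= abel_weight k e.
Proof.
by move=> k0 e0; rewrite divr_ge0 ?sqr_ge0// !mulr_ge0// ltW.
Qed.

(** Vanishing linearly at 0 compensates the singularity of the cotangent: their product is bounded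
    for [e] below the chord. *)
Lemma abel_weight_le k e : 0 < k -> 0 <= e -> abel_weight k e <= 2 * e / k.
Proof.
move=> k0 e0; rewrite /abel_weight.
rewrite [leRHS](_ : _ = 2 * k * e / k ^+ 2); last by field; lra.
apply: ler_wpM2l; first by rewrite !mulr_ge0// ltW.
by rewrite lef_pV2 ?posrE ?exprn_gt0 ?ltr_wpDl ?sqr_ge0// lerXn2r ?nnegrE ?lerDr ?sqr_ge0// ?addr_ge0 ?sqr_ge0 ?ltW.
Qed.

Lemma abel_weight_le_tail k e d : 0 < k -> 0 < d <= e -> abel_weight k e <= 2 * k / d ^+ 3.
Proof.
move=> k0 /andP[d0 de]; rewrite /abel_weight.
have e0 : 0 < e by lra.
apply: (@le_trans _ _ (2 * k * e / (e ^+ 2) ^+ 2)).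
  apply: ler_wpM2l; first by rewrite !mulr_ge0// ltW.
  by rewrite lef_pV2 ?posrE ?exprn_gt0 ?ltr_wpDl ?sqr_ge0// lerXn2r ?nnegrE ?lerDl ?(ltW k0) ?sqr_ge0// addr_ge0 ?sqr_ge0 ?ltW.
rewrite [leLHS](_ : _ = 2 * k / e ^+ 3); last by field; lra.
apply: ler_wpM2l; first by rewrite mulr_ge0// ltW.
by rewrite lef_pV2 ?posrE ?exprn_gt0// lerXn2r ?nnegrE ?(ltW e0) ?(ltW d0).
Qed.

(* [conj_poisson r u = cot (u / 2) * (c ^+ 2 / (c ^+ 2 + k))] for the chord [c], and the last factor
   is the integral of [abel_weight k] over [[0, c]]: exchange the two integrals. *)
Lemma conj_poisson_integral_truncated (f : circle R -> R) r t :
  L1_circle f -> 0 < r < 1 ->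
  let k := (1 - r) ^+ 2 / r in
  mu.-integrable `[0, 2] (EFin \o (fun e => abel_weight k e * truncated_hilbert f t e)) /\
  conj_poisson_integral (f \o @expi R) r t =
  \int[mu]_(e in `[0, 2]) (abel_weight k e * truncated_hilbert f t e).
Proof.
move=> ig r01 k; have k0 : 0 < k by rewrite /k divr_gt0 ?exprn_gt0//; lra.
have pi0 := @pi_gt0 R.
pose g s := f (expi s).
pose ch s := 2 * `|sin ((t - s) / 2)| : R.
have ch0 s : 0 <= ch s by rewrite mulr_ge0.
pose ct s := cot ((t - s) / 2).
have mct : measurable_fun [set: R] ct by exact: measurable_cot_half.
have mch : measurable_fun [set: R] ch by exact: measurable_chord.
have mw : measurable_fun [set: R] (abel_weight k).
  by apply: continuous_measurable_fun; exact: continuous_abel_weight.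
pose K (z : R * R) : R := if z.2 < ch z.1 then ct z.1 * abel_weight k z.2 else 0.
have mK : measurable_fun [set: R * R] K.
  apply: measurable_fun_ifT; [|apply: measurable_funM|exact: measurable_cst].
  - by apply: measurable_fun_ltr => //; exact: (measurableT_comp mch).
  - exact: (measurableT_comp mct).
  - exact: (measurableT_comp mw).
have KC (s e : R) : `[- pi, pi]%classic s -> `[0, 2]%classic e -> `|K (s, e)| <= 4 / k.
  move=> _; rewrite /= in_itv /= => /andP[e0 e2]; rewrite /K /=.
  case: ifPn => [ech|_]; last by rewrite normr0 divr_ge0// ltW.
  rewrite normrM (ger0_norm (abel_weight_ge0 k0 e0)).
  apply: (@le_trans _ _ (`|ct s| * (2 * ch s / k))).
    apply: ler_wpM2l => //; apply: le_trans (abel_weight_le k0 e0) _.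
    by rewrite ler_pM2r ?invr_gt0//; lra.
  rewrite mulrA ler_pM2r ?invr_gt0//.
  have := cot_half_le (t - s); rewrite -/(ch s) -/(ct s); lra.
have fin02 : (mu `[0%R, 2%R]%classic < +oo)%E.
  by rewrite lebesgue_measure_itv /=; case: ifP => _; rewrite ltry.
have [_ i2 FE] := @Fubini_bounded R _ _ _ _ mu mu `[- pi, pi] `[0, 2] g K _
  (measurable_itv _) (measurable_itv _) fin02 ig mK KC.
have inner e : 0 <= e -> \int[mu]_(s in `[- pi, pi]) (g s * K (s, e)) =
    2 * pi * (abel_weight k e * truncated_hilbert f t e).
  move=> e0; rewrite truncated_hilbertE//.
  rewrite [RHS](_ : _ = abel_weight k e * \int[mu]_(s in `[- pi, pi])
    (g s * truncated_kernel t e s)); last by field; lra.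
  (* At [e = 0] the truncated kernel has no bound, but the weight vanishes. *)
  have [->|en0] := eqVneq e 0.
    rewrite /K /abel_weight /= mulr0 mul0r mul0r.
    rewrite (@eq_Rintegral _ _ _ _ _ (fun=> 0)); first by rewrite Rintegral_cst// mul0r.
    by move=> s _; case: ifP; rewrite ?mulr0.
  rewrite -RintegralZl//; last by apply: integrable_truncated_kernel; rewrite // lt0r en0.
  by apply: eq_Rintegral => s _; rewrite /K /truncated_kernel /ct /=; case: ifP => _; rewrite ?mulr0//; ring.
split.
  have i2' : mu.-integrable `[0, 2] (EFin \o (fun y =>
      (2 * pi)^-1 * \int[mu]_(x in `[- pi, pi]) (g x * K (x, y)))).
    exact: integrable_mulrl.
  apply: eq_integrable i2' => // e; rewrite inE /= in_itv /= => /andP[e0 _].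
  by rewrite inner//; congr EFin; field; lra.
rewrite /conj_poisson_integral.
have -> : \int[mu]_(e in `[0, 2]) (abel_weight k e * truncated_hilbert f t e) =
    (2 * pi)^-1 * \int[mu]_(e in `[0, 2]) \int[mu]_(s in `[- pi, pi]) (g s * K (s, e)).
  rewrite -RintegralZl//; apply: eq_Rintegral => e.
  rewrite inE /= in_itv /= => /andP[e0 _].
  by rewrite inner//; field; lra.
congr (_ * _); rewrite -FE; apply: eq_Rintegral => s _; congr (_ * _).
rewrite (@conj_poisson_cot r (t - s))// -/(ch s) -/k -(abel_weight_integral k0 (ch0 s)).
(* Chords of the unit circle have length at most 2, whence the interval [[0, 2]]. *)
have ch2 : ch s <= 2 by rewrite /ch; have := sin_max ((t - s) / 2); lra.
have iw (c : R) : mu.-integrable `[0, c] (EFin \o abel_weight k).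
  by apply: continuous_integrable_itv; exact: continuous_abel_weight.
rewrite -RintegralZl// -Rintegral_itv_bndo_bndc; last first.
  apply: integrableS (_ : mu.-integrable `[0, ch s] _) => //.
    by apply: subset_itvl; rewrite bnd_simp.
  exact: integrable_mulrl.
have -> : `[0, ch s[%classic = `[0, 2]%classic `&` [set e | e < ch s].
  apply/seteqP; split => e /=; rewrite !in_itv /=; [move=> /andP[-> h]; split => //=; lra|].
  by move=> [/andP[-> _] ->].
rewrite Rintegral_mkcondr; apply: eq_Rintegral => e _.
rewrite patchE /K /=; case: (boolP (e < ch s)) => h; first by rewrite mem_set.
by rewrite memNset//; exact/negP.
Qed.

(** The weight concentrates at 0 as [r] tends to 1. For [e < e1] the truncated integral is at least
    [l - d / 2]; beyond [e1] it is bounded by [N * (2 / e1)], while the weight is at most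
    [2 * k / e1 ^+ 3]. *)
Lemma abelian_lower_bound (f : circle R -> R) t (l d : R) : L1_circle f -> 0 < d ->
  truncated_hilbert f t e @[e --> 0^'+] --> l ->
  exists2 r0, r0 < 1 & forall r, r0 < r < 1 ->
    l - d <= conj_poisson_integral (f \o @expi R) r t.
Proof.
move=> ig d0 /cvgrPdist_le Tl; pose d' := d / 2; have d'0 : 0 < d' by rewrite /d'; lra.
have {Tl} [e1 /= e10 e1P] := Tl _ d'0.
pose N := L1norm_circle f.
have N0 : 0 <= N.
  by rewrite mulr_ge0 ?invr_ge0 ?mulr_ge0 ?pi_ge0//; exact: Rintegral_ge0.
pose C := N * (2 / e1) + `|l|.
have C0 : 0 <= C by rewrite addr_ge0// mulr_ge0// divr_ge0// ltW.
have Te e : 0 < e -> l - d' - (if e < e1 then 0 else C) <= truncated_hilbert f t e.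
  move=> e0; case: ifPn => [ee1|]; last rewrite -leNgt => e1e.
    have := e1P e; rewrite /= sub0r normrN (gtr0_norm e0) => /(_ ee1 e0).
    by rewrite ler_norml; lra.
  have := truncated_hilbert_le t ig e0; rewrite ler_norml -/N => /andP[h _].
  have : N * (2 / e) <= N * (2 / e1).
    by apply: ler_wpM2l => //; rewrite ler_pM2l// lef_pV2 ?posrE.
  have := ler_norm l; rewrite /C; lra.
(* [M] collects the coefficients of [k] in the two losses: [|l| + d'] for the missing mass
   [k / (4 + k)] of the weight, the last term for its tail. The 1 makes [M] positive. *)
pose M := `|l| + d' + 1 + C * 4 / e1 ^+ 3.
have M0 : 0 < M.
  by rewrite ltr_pwDl// ?divr_ge0 ?mulr_ge0 ?exprn_ge0 ?(ltW e10)// ltr_wpDl ?addr_ge0// ltW.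
pose k0 := d' / M; have k00 : 0 < k0 by rewrite divr_gt0.
(* For [r > 1 / 2], [k = (1 - r) ^+ 2 / r] is at most [1 - r], hence at most [k0]. *)
exists (Num.max (1 / 2) (1 - k0 / 2)); first by rewrite gt_max; apply/andP; split; lra.
move=> r; rewrite gt_max => /andP[/andP[r12 rk] r1].
have r01 : 0 < r < 1 by lra.
set k := (1 - r) ^+ 2 / r; have k_gt0 : 0 < k by rewrite /k divr_gt0 ?exprn_gt0//; lra.
have kk0 : k <= k0.
  rewrite /k ler_pdivrMr; last by lra.
  nra.
have kM : k * M <= d' by rewrite -ler_pdivlMr.
have [iwT ->] := conj_poisson_integral_truncated t ig r01.
rewrite -/k in iwT *.
have iw : mu.-integrable `[0, 2] (EFin \o abel_weight k).
  by apply: continuous_integrable_itv; exact: continuous_abel_weight.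
apply: (@le_trans _ _ (\int[mu]_(e in `[0, 2]) (abel_weight k e * (l - d') - C * (2 * k / e1 ^+ 3)))).
  rewrite RintegralB//; last 2 first.
  - apply: continuous_integrable_itv => e; apply: cvgM; last exact: cvg_cst.
    exact: continuous_abel_weight.
  - by apply: continuous_integrable_itv => e; exact: cvg_cst.
  rewrite RintegralZr// abel_weight_integral// Rintegral_itv_cst//.
  have : 2 ^+ 2 / (2 ^+ 2 + k) * (l - d') = (l - d') - (l - d') * (k / (4 + k)).
    by field; lra.
  move=> ->; have le1 : (l - d') * (k / (4 + k)) <= (`|l| + d') * k.
    apply: (@le_trans _ _ ((`|l| + d') * (k / (4 + k)))).
      apply: ler_wpM2r; first by rewrite divr_ge0//; lra.
      by have := ler_norm l; lra.
    apply: ler_wpM2l; first by have := normr_ge0 l; lra.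
    by rewrite ler_pdivrMr//; nra.
  have : C * (2 * k / e1 ^+ 3) * (2 - 0) = k * (C * 4 / e1 ^+ 3).
    by field; rewrite lt0r_neq0.
  move: kM; rewrite /M /d' in le1 *; move=> kM ->; nra.
apply: le_Rintegral => //.
  apply: continuous_integrable_itv => e; apply: cvgB; last exact: cvg_cst.
  apply: cvgM; last exact: cvg_cst.
  exact: continuous_abel_weight.
move=> e; rewrite /= in_itv /= => /andP[e0 e2].
have w0 := abel_weight_ge0 k_gt0 e0.
have Ck : 0 <= C * (2 * k / e1 ^+ 3).
  by rewrite mulr_ge0// divr_ge0 ?exprn_ge0 ?(ltW e10)//; lra.
have [->|en0] := eqVneq e 0.
  by rewrite /abel_weight !(mulr0, mul0r) sub0r oppr_le0.
have {}e0 : 0 < e by rewrite lt0r en0.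
apply: le_trans (ler_wpM2l w0 (Te e e0)).
rewrite [leRHS]mulrBr lerD2l lerN2; case: ifPn => [_|]; first by rewrite mulr0.
rewrite -leNgt => e1e; rewrite mulrC; apply: ler_wpM2l => //.
by apply: abel_weight_le_tail => //; rewrite e10.
Qed.

End abelian.

(** * The weak-type bound for the principal value *)

Section upper_bound.
Context {R : realType}.
Notation mu := (@lebesgue_measure R).

Lemma continuous_extremal_rate : continuous (@extremal_rate R).
Proof.
move=> x; apply: cvgB; last exact: cvg_cst.
apply: cvgM; first exact: cvg_cst.
apply: (@continuous_comp _ _ _ (fun x => expR (pi / 2 * x)) atan); last exact: continuous_atan.
apply: (@continuous_comp _ _ _ (fun x => pi / 2 * x) expR); last exact: continuous_expR.
by apply: cvgM; [exact: cvg_cst|exact: cvg_id].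
Qed.

(** The underlying outer measure is defined and monotone on all sets, so the set where [Hf >= 1] can
    be compared directly with measurable ones. *)
Lemma lebesgue_measure_le (A B : set R) : A `<=` B -> (mu A <= mu B)%E.
Proof.
by move=> AB; rewrite /lebesgue_measure /lebesgue_stieltjes_measure /measure_extension; exact: le_mu_ext.
Qed.

Lemma lebesgue_measure_circle_le (A : set R) : A `<=` `]- pi, pi] ->
  (mu A <= (2 * pi)%:E)%E.
Proof.
move=> Api; have pi0 := @pi_gt0 R; apply: le_trans (lebesgue_measure_le Api) _.
rewrite lebesgue_measure_itv /= lte_fin ifT; last by lra.
by rewrite -EFinB lee_fin; lra.
Qed.

Lemma fin_num_lebesgue_measure_circle (A : set R) : A `<=` `]- pi, pi] ->
  mu A \is a fin_num.
Proof.
move=> /lebesgue_measure_circle_le muA; rewrite ge0_fin_numE.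
  by apply: le_lt_trans muA _; rewrite ltry.
by rewrite -(measure0 mu); apply: lebesgue_measure_le.
Qed.

(** Where the principal value does not exist, [lim] takes the default value 0, which is below 1. *)
Lemma hilbert_ge1_cvg (f : circle R -> R) (t : R) : 1 <= hilbert f (expi t) ->
  truncated_hilbert f t e @[e --> 0^'+] --> hilbert f (expi t).
Proof.
rewrite hilbertE => h; have [//|/dvgP l0] := pselect (cvg (truncated_hilbert f t e @[e --> 0^'+])).
by move: h; rewrite l0 ler10.
Qed.

Theorem hilbert_weak_type (f : circle R -> R) : L1_circle f ->
  (arclength [set xi | 1 <= hilbert f xi]%R <=
    (2 * pi * extremal_rate (L1norm_circle f))%:E)%E.
Proof.
move=> ig; have pi0 := @pi_gt0 R.
pose N := L1norm_circle f.
pose r (n : nat) : R := 1 - n.+2%:R^-1.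
have r01 n : 0 < r n < 1.
  by rewrite /r subr_gt0 invf_lt1// ltr1n /= ltrBlDr ltrDl invr_gt0.
have bound (kap : R) : 0 < kap < 1 ->
    (arclength [set xi | 1 <= hilbert f xi]%R <= (2 * pi * extremal_rate (N / kap))%:E)%E.
  move=> kap01; have kap0 : 0 < kap by lra.
  pose E n := [set t | - pi < t <= pi /\ kap <= conj_poisson_integral (f \o @expi R) (r n) t].
  have wt n := conj_poisson_weak_type ig (r01 n) kap0.
  have mE n : measurable (E n) by have [] := wt n.
  have muE n : (mu (E n) <= (2 * pi * extremal_rate (N / kap))%:E)%E.
    have [_] := wt n; rewrite -/(E n) ler_pdivrMr; last by lra.
    rewrite mulrC -lee_fin fineK// fin_num_lebesgue_measure_circle//.
    by move=> t [tpi _]; rewrite /= in_itv.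
  (* Each point of the target set lies in [E j] from some rank on, but that rank depends on the
     point. The tail intersections increase with [n], inherit the bound on [E n], and continuity
     from below passes it to their union. *)
  pose A n := \bigcap_(j in [set j | (n <= j)%N]) E j.
  have mA n : measurable (A n) by apply: bigcap_measurable => //; exists n => /=.
  have muA n : (mu (A n) <= (2 * pi * extremal_rate (N / kap))%:E)%E.
    apply: le_trans (muE n); apply: lebesgue_measure_le => t; apply => /=.
    exact: leqnn.
  apply: (@le_trans _ _ (mu (\bigcup_n A n))).
    apply: lebesgue_measure_le => t [tpi h1].
    have l1 := hilbert_ge1_cvg h1.
    have kap1 : 0 < 1 - kap by lra.
    have [r0 r01' r0P] := abelian_lower_bound ig kap1 l1.
    have [n nP] : exists n : nat, (1 - r0)^-1 < n%:R.
      by exists (Num.truncn (1 - r0)^-1).+1; exact: truncnS_gt.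
    exists n => // j /= nj; split => //.
    apply: le_trans (r0P (r j) _); first by move: h1; rewrite /=; lra.
    have [_ ->] := andP (r01 j); rewrite andbT /r.
    rewrite ltrBrDl -ltrBrDr -[ltRHS]invrK ltf_pV2 ?posrE// ?invr_gt0 ?subr_gt0//.
    by apply: lt_trans nP _; rewrite ltr_nat ltnS leqW.
  have ndA : nondecreasing_seq A.
    move=> i j ij; apply/subsetPset => t At k /= jk; apply: At => /=.
    exact: leq_trans jk.
  have cA : mu \o A @ \oo --> mu (\bigcup_n A n).
    apply: (@nondecreasing_cvg_mu _ _ R mu A mA _ ndA).
    by apply: (@bigcupT_measurable _ (measurableTypeR R)) => n; exact: mA.
  rewrite -(cvg_lim _ cA)//; apply: lime_le; first exact: cvgP cA.
  exact: nearW.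
have fin : arclength [set xi | 1 <= hilbert f xi] \is a fin_num.
  apply: fin_num_lebesgue_measure_circle => t [tpi _].
  by rewrite /= in_itv.
rewrite -(fineK fin) lee_fin.
(* The level was lowered to [kap] to absorb the loss [1 - kap] allowed in the Abelian bound;
   continuity of the rate brings it back to 1. *)
have cG : 2 * pi * extremal_rate (N / kap) @[kap --> 1^'-] --> 2 * pi * extremal_rate N.
  rewrite -[in X in _ --> X](divr1 N).
  apply: (@cvg_at_left_filter _ _ (fun kap => 2 * pi * extremal_rate (N / kap))).
  apply: cvgM; first exact: cvg_cst.
  apply: (@continuous_cvg _ _ _ _ _ (fun kap => N / kap) (@extremal_rate R)).
    exact: continuous_extremal_rate.
  apply: cvgM; first exact: cvg_cst.
  by apply: cvgV; [exact: oner_neq0|exact: cvg_id].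
rewrite -(cvg_lim _ cG)//; apply: limr_ge; first exact: cvgP cG.
near=> kap; rewrite -lee_fin fineK//; apply: bound.
apply/andP; split; near: kap; [exact: nbhs_left_gt|exact: nbhs_left_lt].
Unshelve. all: end_near. Qed.
End upper_bound.

(** * The extremal function *)

Section improper.
Context {R : realType}.
Implicit Types (f F G : R -> R) (a b c x y s t e d : R).
Notation mu := (@lebesgue_measure R).

Lemma continuous_on_Rintegral_derivative f F a b : a < b ->
  (forall x, a <= x <= b -> is_derive x 1 F (f x) /\ {for x, continuous f}) ->
  (\int[mu]_(x in `[a, b]) (f x)%:E)%E = (F b - F a)%:E.
Proof.
move=> ab dF.
have cF x : a <= x <= b -> {for x, continuous F}.
  by move=> /dF[[h _] _]; apply/differentiable_continuous/derivable1_diffP.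
rewrite (@continuous_FTC2 _ f F)//.
- apply: continuous_in_subspaceT => x /set_mem /=.
  by rewrite in_itv /= => /dF[].
- split => [x||]; rewrite ?in_itv /=.
  + by move=> /andP[xa xb]; have [|[]] := dF x; rewrite ?(ltW xa) ?(ltW xb).
  + by apply/cvg_at_right_filter/cF; rewrite lexx ltW.
  + by apply/cvg_at_left_filter/cF; rewrite lexx ltW.
- move=> x; rewrite in_itv /= => /andP[xa xb].
  by rewrite derive1E; apply: derive_val; have [|] := dF x; rewrite ?(ltW xa) ?(ltW xb).
Qed.

(** The integrand may blow up at the ends. Compact subintervals exhaust the open one, and by
    positivity monotone convergence gives both integrability and value. *)
Lemma ge0_FTC2_oo f F a b : a < b ->
  (forall x, a < x < b -> is_derive x 1 F (f x) /\ {for x, continuous f}) ->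
  (forall x, a < x < b -> 0 <= f x) ->
  F x @[x --> a^'+] --> F a -> F x @[x --> b^'-] --> F b ->
  mu.-integrable `]a, b[ (EFin \o f) /\ \int[mu]_(x in `]a, b[) f x = F b - F a.
Proof.
move=> ab dF f0 Fa Fb.
(* Starting at a third of the length keeps [a + h n < b - h n] from [n = 0] on. *)
pose h n : R := (b - a) / n.+3%:R.
have h0 n : 0 < h n by rewrite divr_gt0 ?subr_gt0// ltr0n.
have hle n m : (n <= m)%N -> h m <= h n.
  move=> nm; rewrite /h ler_pM2l ?subr_gt0// lef_pV2 ?posrE ?ltr0n// ler_nat.
  by rewrite !ltnS.
have h3 n : h n <= (b - a) / 3 by apply: (hle 0%N).
have hcvg : h n @[n --> \oo] --> (0 : R).
  rewrite -(mulr0 (b - a)); apply: cvgM; first exact: cvg_cst.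
  have := @cvg_harmonic R; rewrite -(cvg_shiftn 2).
  by under eq_fun do rewrite addn2.
pose A n := `[a + h n, b - h n]%classic.
have Aoo : \bigcup_n A n = `]a, b[%classic.
  apply/seteqP; split => x /=.
    by move=> [n _]; rewrite /A /= !in_itv /= => /andP[x1 x2]; have := h0 n; lra.
  rewrite in_itv /= => /andP[ax xb].
  have : \forall n \near \oo, h n < Num.min (x - a) (b - x).
    by apply: (cvgr_lt 0 hcvg); rewrite lt_min !subr_gt0 ax xb.
  move=> [n _ /(_ n (leqnn n))] /=; rewrite lt_min => /andP[h1 h2].
  by exists n => //; rewrite /A /= in_itv /=; lra.
have mf : measurable_fun `]a, b[ f.
  apply: open_continuous_measurable_fun; first exact: interval_open.
  by move=> x /set_mem /=; rewrite in_itv /= => /dF[].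
have Ain n x : A n x -> a < x < b.
  by rewrite /A /= in_itv /= => /andP[x1 x2]; have := h0 n; lra.
have lim1 : (\int[mu]_(x in A n) (f x)%:E)%E @[n --> \oo] -->
    (\int[mu]_(x in `]a, b[) (f x)%:E)%E.
  rewrite -Aoo; apply: ge0_nondecreasing_set_cvg_integral => //.
  - move=> n m nm; apply/subsetPset => x; rewrite /A /= !in_itv /=.
    by have := hle _ _ nm; lra.
  - by move=> n; exact: measurable_itv.
  - move=> n; apply: measurableT_comp => //; apply: measurable_funS mf => // x /Ain.
    by rewrite /= in_itv.
  - by move=> n x /Ain /f0; rewrite lee_fin.
have lim2 : (\int[mu]_(x in A n) (f x)%:E)%E @[n --> \oo] --> (F b - F a)%:E.
  have -> : (fun n => (\int[mu]_(x in A n) (f x)%:E)%E) =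
      (fun n => (F (b - h n) - F (a + h n))%:E).
    apply/funext => n; apply: continuous_on_Rintegral_derivative.
      by have := h3 n; have := ab; lra.
    by move=> x xn; apply: dF; have := h0 n; lra.
  apply: cvg_EFin; first exact: nearW.
  apply: cvgB.
  - apply: cvg_comp Fb => P [e /= e0 eP]; near=> n; apply: eP => /=.
      rewrite opprB addrC subrK ger0_norm ?ltW//.
      by near: n; exact: cvgr_lt hcvg _ e0.
    by rewrite ltrBlDr ltrDl.
  - apply: cvg_comp Fa => P [e /= e0 eP]; near=> n; apply: eP => /=.
      rewrite opprD addrA subrr add0r normrN ger0_norm ?ltW//.
      by near: n; exact: cvgr_lt hcvg _ e0.
    by rewrite ltrDl.
have intE : (\int[mu]_(x in `]a, b[) (f x)%:E)%E = (F b - F a)%:E.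
  by apply: cvg_unique lim1 lim2.
split; last by rewrite /Rintegral intE.
apply/integrableP; split; first exact/measurable_EFinP.
under eq_integral.
  move=> x /set_mem /=; rewrite in_itv /= => /f0 fx0.
  rewrite ger0_norm//.
  over.
by rewrite intE ltry.
Unshelve. all: end_near. Qed.

Lemma cvg_Rintegral_shrink (q : R -> R) t r : 0 < r ->
  (forall s, t - r <= s <= t + r -> {for s, continuous q}) ->
  \int[mu]_(s in `]t - d, t + d]) q s @[d --> 0^'+] --> (0 : R).
Proof.
move=> r0 cq; have ct : {for t, continuous q} by apply: cq; lra.
pose C := `|q t| + 1.
have C0 : 0 <= C by rewrite addr_ge0.
have bound : \forall d \near 0^'+, forall s, t - d <= s <= t + d -> `|q s| <= C.
  have : \forall s \near t, `|q s| < C.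
    by apply: (cvgr_lt _ (cvg_norm ct)); rewrite ltrDl.
  move=> [e /= e0 eP]; near=> d => s sd; apply/ltW/eP => /=.
  have de : d < e by near: d; exact: nbhs_right_lt.
  by rewrite ltr_norml; lra.
have lim0 (c : R) : c * (2 * d) @[d --> 0^'+] --> (0 : R).
  rewrite -[X in _ --> X](mulr0 (c * 2)); under eq_fun do rewrite mulrA.
  by apply: cvgM; [exact: cvg_cst|apply: cvg_at_right_filter; exact: cvg_id].
apply: (@squeeze_cvgr _ _ _ _ (fun d => - C * (2 * d)) (fun d => C * (2 * d))).
- near=> d.
  have d0 : 0 < d by near: d; exact: nbhs_right_gt.
  have dr : d < r by near: d; exact: nbhs_right_lt.
  have iq' : mu.-integrable `[t - d, t + d] (EFin \o q).
    apply: continuous_compact_integrable; first exact: segment_compact.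
    apply: continuous_in_subspaceT => s /set_mem /=; rewrite in_itv /= => sd.
    by apply: cq; lra.
  have iq : mu.-integrable `]t - d, t + d] (EFin \o q).
    by apply: integrableS iq' => //; apply: subset_itvr; rewrite bnd_simp.
  have muE : mu `]t - d, t + d]%classic = (2 * d)%:E.
    rewrite lebesgue_measure_itv /= lte_fin ifT; last by lra.
    by rewrite -EFinB; congr EFin; ring.
  rewrite mulNr -ler_norml; apply: le_trans (le_normr_Rintegral _ _) _ => //.
  rewrite [leRHS](_ : _ = \int[mu]_(s in `]t - d, t + d]) C).
    apply: le_Rintegral => //.
    + exact: integrable_norm.
    + apply: measurable_bounded_integrable => //.
        by rewrite /= muE ltry.
      exists C; split => [|K KC x _]; first exact: num_real.
      by rewrite /= ger0_norm// ltW.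
    + move=> s; rewrite /= in_itv /= => /andP[/ltW s1 s2].
      by have : forall s, t - d <= s <= t + d -> `|q s| <= C; [near: d|apply; rewrite s1].
  by rewrite Rintegral_cst//; congr (_ * _); rewrite -[LHS]/(fine (2 * d)%:E) -muE.
- exact: lim0.
- exact: lim0.
Unshelve. all: end_near. Qed.

Lemma is_derive_cvg f x (df : R) : is_derive x 1 f df ->
  (f (x + d) - f x) / d @[d --> 0^'] --> df.
Proof.
move=> [ex <-]; rewrite (_ : (fun d => _) =
    (fun k => k^-1 *: ((f \o shift x) (k *: 1) - f x))); first exact: ex.
by apply/funext => d /=; rewrite /GRing.scale /= mulr1 mulrC (addrC d).
Qed.

Lemma cvg_dnbhs_right (c : R) : c != 0 -> c * d @[d --> (0 : R)^'+] --> (0 : R)^'.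
Proof.
move=> c0 P [e /= e0 eP].
have : \forall d \near 0^'+, P (c * d); last by [].
near=> d; have d0 : 0 < d by near: d; exact: nbhs_right_gt.
apply: eP; last by rewrite mulf_neq0// gt_eqF.
rewrite /= sub0r normrN normrM (gtr0_norm d0) -ltr_pdivlMl ?normr_gt0//.
by near: d; apply: nbhs_right_lt; rewrite mulr_gt0// invr_gt0 normr_gt0.
Unshelve. all: end_near. Qed.

End improper.

(** * Integrals over symmetric intervals and parity *)

Section reflection.
Context {R : realType}.
Implicit Types (h : R -> \bar R) (G : R -> R) (a b c x y s t e d : R).
Notation mu := (@lebesgue_measure R).

Lemma ge0_integral_reflect h a : measurable_fun [set: R] h ->
  (forall x, (0 <= h x)%E) ->
  (\int[mu]_(x in `[(- a)%R, 0%R]) h x = \int[mu]_(x in `[0%R, a]) h (- x)%R)%E.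
Proof.
move=> mh h0; rewrite (_ : `[0%R, a]%classic =
    (-%R : _ -> measurableTypeR R) @^-1` `[(- a)%R, 0%R]); last first.
  by rewrite opp_preimage_itvbndbnd/= oppr0 opprK.
rewrite -ge0_integral_pushforward//=; last exact: measurable_funS mh.
by apply: eq_measure_integral => //= A mA AS; exact/esym/lebesgue_measureN.
Qed.

Lemma integral_reflect h a : measurable_fun [set: R] h ->
  (\int[mu]_(x in `[(- a)%R, 0%R]) h x = \int[mu]_(x in `[0%R, a]) h (- x)%R)%E.
Proof.
move=> mh; rewrite integralE [RHS]integralE; congr (_ - _)%E.
- rewrite (@ge0_integral_reflect h^\+%E a (measurable_funepos mh) (fun x => funepos_ge0 h x)).
  by apply: eq_integral => x _; rewrite !funeposE.
- rewrite (@ge0_integral_reflect h^\-%E a (measurable_funeneg mh) (fun x => funeneg_ge0 h x)).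
  by apply: eq_integral => x _; rewrite !funenegE.
Qed.

Lemma integrable_reflect G a : measurable_fun [set: R] G ->
  mu.-integrable `[- a, 0] (EFin \o G) <->
  mu.-integrable `[0, a] (EFin \o (fun x => G (- x))).
Proof.
move=> mG; have mGN : measurable_fun [set: R] (fun x => G (- x)).
  exact: (measurableT_comp mG).
have intE := @integral_reflect (fun x => `|(G x)%:E|%E) a.
have {}intE := intE ltac:(by apply: measurableT_comp => //; exact: measurableT_comp).
split=> /integrableP[_ iG]; apply/integrableP; split.
- by apply: measurable_funTS; exact: measurableT_comp.
- by rewrite -intE.
- by apply: measurable_funTS; exact: measurableT_comp.
- by move: iG; rewrite -intE.
Qed.

Lemma Rintegral_fold G a : 0 <= a -> measurable_fun [set: R] G ->
  mu.-integrable `[- a, a] (EFin \o G) ->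
  \int[mu]_(x in `[- a, a]) G x = \int[mu]_(x in `[0, a]) (G x + G (- x)).
Proof.
move=> a0 mG iG.
have iN : mu.-integrable `[- a, 0] (EFin \o G).
  by apply: integrableS iG => //; apply: subset_itvl; rewrite bnd_simp.
have iP : mu.-integrable `[0, a] (EFin \o G).
  by apply: integrableS iG => //; apply: subset_itvr; rewrite bnd_simp; lra.
rewrite RintegralD//; last exact/integrable_reflect.
rewrite addrC [X in X + _](_ : _ = \int[mu]_(x in `[- a, 0]) G x); last first.
  by rewrite /Rintegral integral_reflect//; exact: measurableT_comp.
have := @Rintegral_itvB _ G (BLeft (- a)) (BRight a) 0 iG.
rewrite !bnd_simp oppr_le0 => /(_ a0 a0).
rewrite Rintegral_itv_obnd_cbnd; last by apply: integrableS iP => //; apply: subset_itvr; rewrite bnd_simp.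
by move=> <-; rewrite addrC subrK.
Qed.

Lemma Rintegral_vanish (A B : set R) G : B `<=` A ->
  (forall x, A x -> ~ B x -> G x = 0) ->
  \int[mu]_(x in A) G x = \int[mu]_(x in B) G x.
Proof.
move=> BA G0; rewrite -(setIidr BA) Rintegral_mkcondr.
apply: eq_Rintegral => x /set_mem Ax; rewrite patchE.
by case: ifPn => // /negP nB; apply: G0 => // Bx; apply/nB/mem_set.
Qed.

Lemma integrable_vanish (A B : set R) G : measurable A -> measurable B -> B `<=` A ->
  (forall x, A x -> ~ B x -> G x = 0) ->
  mu.-integrable B (EFin \o G) -> mu.-integrable A (EFin \o G).
Proof.
move=> mA mB BA G0 iG.
have iGB : mu.-integrable A (EFin \o (G \_ B)).
  by rewrite -restrict_EFin; apply/integrable_restrict => //; rewrite setIidr.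
apply: eq_integrable iGB => // x /set_mem Ax /=; rewrite patchE.
by case: ifPn => // /negP nB; rewrite G0// => Bx; apply/nB/mem_set.
Qed.

Lemma integrable_unfold G a : 0 <= a -> measurable_fun [set: R] G ->
  (forall x, G (- x) = - G x) -> mu.-integrable `[0, a] (EFin \o G) ->
  mu.-integrable `[- a, a] (EFin \o G).
Proof.
move=> a0 mG GN iG.
have G0 : G 0 = 0 by have := GN 0; rewrite oppr0; lra.
have iN : mu.-integrable `[- a, 0] (EFin \o G).
  apply/integrable_reflect => //; rewrite (_ : EFin \o _ = -%E \o (EFin \o G)).
    exact: integrableN iG.
  by apply/funext => x /=; rewrite GN.
have patched (A : set R) : measurable A -> A `<=` `[- a, a] ->
    mu.-integrable A (EFin \o G) -> mu.-integrable `[- a, a] (EFin \o (G \_ A)).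
  move=> mA Aa iA; rewrite -restrict_EFin; apply/integrable_restrict => //.
  by rewrite setIidr.
have iNa := patched _ (measurable_itv _) _ iN.
have iPa := patched _ (measurable_itv _) _ iG.
have {}iNa : mu.-integrable `[- a, a] (EFin \o (G \_ `[- a, 0])).
  by apply: iNa; apply: subset_itvl; rewrite bnd_simp.
have {}iPa : mu.-integrable `[- a, a] (EFin \o (G \_ `[0, a])).
  by apply: iPa; apply: subset_itvr; rewrite bnd_simp; lra.
have iD := @integrableD _ _ R mu _ (measurable_itv _) _ _ iNa iPa.
apply: eq_integrable iD => //.
move=> x /set_mem /=; rewrite in_itv /= => xa; rewrite -EFinD !patchE.
congr EFin; rewrite !mem_setE !in_itv /=.
have [x0|x0|->] := ltgtP x 0; last by rewrite !ifT ?G0 ?addr0//; lra.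
- by rewrite ifT ?ifF ?addr0//; lra.
- by rewrite ifF ?ifT ?add0r//; lra.
Qed.

End reflection.

(** * An odd function supported on an arc, with transform 1 on that arc *)

Section extremal_function.
Context {R : realType}.
Implicit Types (a b c x y s t e d : R).
Notation mu := (@lebesgue_measure R).

(* It vanishes where [cos al <= x], the square root of a negative number being [0]. *)
Definition extremal_function (al : R) (xi : circle R) : R :=
  let: Complex x y := val xi in
  (if 0 <= y then 1 else -1) * Num.sqrt ((1 + x) / (cos al - x)).

Section fixed_angle.
Variable al : R.
Hypothesis al0 : 0 < al < pi.

(** Half-angle variables: [1 + cos s = 2 * kk s ^+ 2], and [cos al - cos s = 2 * g s ^+ 2] on the
    arc, where [F] is therefore [kk / g] for [s > 0]. *)
Let F s := extremal_function al (expi s).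
Let sg s := sin (s / 2).
Let kk s := cos (s / 2).
Let g s := Num.sqrt (sg s ^+ 2 - sg al ^+ 2).

Let FE s : F s = (if 0 <= sin s then 1 else -1) * Num.sqrt ((1 + cos s) / (cos al - cos s)).
Proof. by []. Qed.

Lemma extremal_function0 s : cos al <= cos s -> F s = 0.
Proof.
move=> h; rewrite FE ler0_sqrtr ?mulr0//.
by rewrite mulr_ge0_le0// ?invr_le0 ?subr_le0.
Qed.

Lemma extremal_functionN s : F (- s) = - F s.
Proof.
have := al0 => al0'; rewrite !FE cosN sinN oppr_ge0.
case: (ltgtP (sin s) 0) => h; first by rewrite mulN1r mul1r opprK.
  by rewrite mul1r mulN1r.
(* The sign convention at [y = 0] does not spoil oddness: the square root is 0 at both points of the
   circle with [y = 0]. *)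
have /eqP := sin0cos1 h; rewrite eqr_norml => /andP[/orP[]/eqP -> _].
  by rewrite ler0_sqrtr ?mulr0 ?oppr0// mulr_ge0_le0// invr_le0 subr_le0.
by rewrite subrr mul0r sqrtr0 !mulr0 oppr0.
Qed.

Lemma measurable_extremal_function : measurable_fun [set: R] F.
Proof.
apply: measurable_funM.
  apply: measurable_fun_ifT => //.
  apply: measurable_fun_ler => //.
  exact: continuous_measurable_fun (@continuous_sin R).
apply: (measurableT_comp (continuous_measurable_fun (@sqrt_continuous R))).
have mc : measurable_fun [set: R] (@cos R).
  exact: continuous_measurable_fun (@continuous_cos R).
apply: measurable_funM; first exact: measurable_funD.
by apply: (measurableT_comp measurable_inv); exact: measurable_funB.
Qed.

Let outer s : al < s < pi -> [/\ 0 < kk s, 0 < sg al, sg al < sg s & 0 < g s].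
Proof.
have := al0 => al0' sal; have pi0 := @pi_gt0 R.
have s0 : 0 < sg al by apply: sin_gt0_pi; lra.
have ss : sg al < sg s by rewrite ltr_sin ?in_itv/=; lra.
split => //; first by apply: cos_gt0_pihalf; lra.
by rewrite sqrtr_gt0; nra.
Qed.

Let gE s : al < s < pi -> g s ^+ 2 = sg s ^+ 2 - sg al ^+ 2.
Proof. by move=> /outer[_ a0 h _]; rewrite sqr_sqrtr//; nra. Qed.

Lemma extremal_function_outer s : al < s < pi -> F s = kk s / g s.
Proof.
move=> sal; have [k0 a0 ls g0] := outer sal.
have := al0 => al0'; have pi0 := @pi_gt0 R.
rewrite FE ifT ?mul1r; last by apply: sin_ge0_pi; lra.
have -> : (1 + cos s) / (cos al - cos s) = (kk s / g s) ^+ 2.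
  rewrite expr_div_n gE// (sin_half_sqr s) (sin_half_sqr al) /kk cos2sin2 -/(sg s) -/(sg al).
  by field; nra.
by rewrite sqrtr_sqr ger0_norm// divr_ge0// ltW.
Qed.

Lemma is_derive_half s : is_derive s 1 (fun s => s / 2) (1 / 2).
Proof.
have h := @is_deriveM R _ id (cst 2^-1) s 1 _ _ (is_derive_id _ _) (is_derive_cst _ _ _).
by apply: (is_derive_eq h); rewrite /GRing.scale /=; lra.
Qed.

Let dsg s : is_derive s 1 sg (kk s / 2).
Proof.
apply: (is_derive_eq (@is_derive1_comp R (@sin R) (fun s => s / 2) _ _ _ (is_derive_sin _) (is_derive_half s))).
by rewrite mul1r.
Qed.

Let dkk s : is_derive s 1 kk (- (sg s / 2)).
Proof.
apply: (is_derive_eq (@is_derive1_comp R (@cos R) (fun s => s / 2) _ _ _ (is_derive_cos _) (is_derive_half s))).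
by rewrite mul1r mulNr.
Qed.

Let dg s : al < s < pi -> is_derive s 1 g (sg s * kk s / (2 * g s)).
Proof.
move=> sal; have [k0 a0 ls g0] := outer sal.
have d1 : is_derive s 1 (fun s => sg s ^+ 2 - sg al ^+ 2) (sg s * kk s).
  under eq_fun do rewrite expr2.
  apply: (is_derive_eq (is_deriveB (is_deriveM (dsg s) (dsg s)) (is_derive_cst _ _ _))).
  by rewrite /GRing.scale /=; field.
apply: (is_derive_eq (@is_derive1_comp R (@Num.sqrt R) _ _ _ _ (is_derive1_sqrt _) d1)).
  by move: g0; rewrite sqrtr_gt0.
by rewrite mulrC.
Qed.

Let csg : continuous sg.
Proof.
move=> s; apply: (@continuous_comp _ _ _ (fun s => s / 2) sin); last exact: continuous_sin.
by apply: cvgM; [exact: cvg_id|exact: cvg_cst].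
Qed.

Let ckk : continuous kk.
Proof.
move=> s; apply: (@continuous_comp _ _ _ (fun s => s / 2) cos); last exact: continuous_cos.
by apply: cvgM; [exact: cvg_id|exact: cvg_cst].
Qed.

Let cg : continuous g.
Proof.
move=> s; apply: (@continuous_comp _ _ _ (fun s => sg s ^+ 2 - sg al ^+ 2) (@Num.sqrt R)).
  2: exact: sqrt_continuous.
apply: cvgB; last exact: cvg_cst.
by rewrite expr2; under eq_fun do rewrite expr2; apply: cvgM; exact: csg.
Qed.

Let cp_al : 0 < sg al /\ 0 < kk al.
Proof.
have := al0 => al0'; have pi0 := @pi_gt0 R.
by split; [apply: sin_gt0_pi; lra|apply: cos_gt0_pihalf; lra].
Qed.

Let g_al : g al = 0.
Proof. by rewrite /g subrr sqrtr0. Qed.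

Let g_pi : g pi = kk al.
Proof.
have [_ k0] := cp_al; rewrite /g /sg sin_pihalf expr1n -cos2sin2 sqrtr_sqr ger0_norm//.
exact: ltW.
Qed.

Let kk_pi : kk pi = 0.
Proof. by rewrite /kk cos_pihalf. Qed.

Let sg_pi : sg pi = 1.
Proof. by rewrite /sg sin_pihalf. Qed.

Let ckg s : al < s < pi -> {for s, continuous (fun s => kk s / g s)}.
Proof.
move=> sal; have [k0 a0 ls g0] := outer sal.
by apply: cvgM; [exact: ckk|apply: cvgV; [rewrite gt_eqF|exact: cg]].
Qed.

Let extremal_function_outside s : 0 <= s <= pi -> ~ (al < s < pi) -> F s = 0.
Proof.
have := al0 => al0' s01 /negP; rewrite negb_and -!leNgt => /orP[sal|spi].
  by apply: extremal_function0; rewrite leNgt ltr_cos ?in_itv/= -?leNgt//; lra.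
by rewrite (_ : s = pi); [rewrite FE cospi subrr mul0r sqrtr0 mulr0|lra].
Qed.

(** With [x = sg s], [F s ds] becomes [2 dx / sqrt (x ^+ 2 - sg al ^+ 2)], an inverse hyperbolic
    cosine, whence the antiderivative [2 * ln (sg s + g s)]. *)
Lemma extremal_function_half :
  mu.-integrable `[0, pi] (EFin \o F) /\
  \int[mu]_(s in `[0, pi]) F s = 2 * ln ((1 + kk al) / sg al).
Proof.
have := al0 => al0'; have [a0 k0] := cp_al.
pose N s := 2 * ln (sg s + g s).
have cN s : 0 < sg s + g s -> N s @[s --> s] --> N s.
  move=> h; apply: cvgM; first exact: cvg_cst.
  apply: (@continuous_comp _ _ _ (fun s => sg s + g s) (@ln R)); last exact: continuous_ln.
  by apply: cvgD; [exact: csg|exact: cg].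
have [] := @ge0_FTC2_oo R (fun s => kk s / g s) N al pi.
- by case/andP: al0'.
- move=> s sal; split; last exact: ckg.
  have [ks0 _ ls g0] := outer sal.
  have sp : 0 < sg s + g s by lra.
  have dl := @is_derive1_comp R (@ln R) (fun s => sg s + g s) _ _ _
    (is_derive1_ln sp) (is_deriveD (dsg s) (dg sal)).
  apply: (is_derive_eq (is_deriveM (is_derive_cst (2 : R) _ _) dl)).
  rewrite /GRing.scale /=; field; lra.
- by move=> s /outer[ks0 _ _ g0]; rewrite divr_ge0// ltW.
- by apply/cvg_at_right_filter/cN; rewrite g_al; lra.
- by apply/cvg_at_left_filter/cN; rewrite g_pi sg_pi; lra.
rewrite /N g_al g_pi sg_pi addr0 => ikg intkg.
have sub : `]al, pi[ `<=` `[0, pi].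
  by move=> x /=; rewrite !in_itv /=; lra.
have van s : s \in `[0, pi] -> s \notin `]al, pi[ -> F s = 0.
  rewrite !in_itv /= => h1 /negP h2; exact: extremal_function_outside.
split.
  apply: (integrable_vanish (measurable_itv _) (measurable_itv _) sub).
    by move=> s h1 /negP; exact: van.
  apply: eq_integrable ikg; first exact: measurable_itv.
  move=> s /set_mem /=; rewrite in_itv /= => sal.
  by rewrite extremal_function_outer.
rewrite (@Rintegral_vanish R _ `]al, pi[)//.
rewrite ln_div ?posrE//; last by lra.
rewrite mulrBr -intkg; apply: eq_Rintegral => s /set_mem /=; rewrite in_itv /= => sal.
by rewrite extremal_function_outer.
Qed.

Lemma L1_extremal_function : L1_circle (extremal_function al).
Proof.
apply: integrable_unfold; first exact: pi_ge0.
- exact: measurable_extremal_function.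
- exact: extremal_functionN.
- by have [] := extremal_function_half.
Qed.

Lemma L1norm_extremal_function :
  L1norm_circle (extremal_function al) = 2 / pi * ln ((1 + kk al) / sg al).
Proof.
have pi0 := @pi_gt0 R; have [iF intF] := extremal_function_half.
have ge0F s : 0 <= s <= pi -> 0 <= F s.
  by move=> spi; rewrite FE sin_ge0_pi// mul1r.
rewrite /L1norm_circle Rintegral_fold; last 3 first.
- exact: ltW.
- by apply: measurableT_comp => //; exact: measurable_extremal_function.
- by apply: integrable_norm => //; exact: L1_extremal_function.
transitivity ((2 * pi)^-1 * \int[mu]_(s in `[0, pi]) (2 * F s)).
  congr (_ * _); apply: eq_Rintegral => s /set_mem /=; rewrite in_itv /= => spi.
  by rewrite -/(F s) -/(F (- s)) extremal_functionN normrN ger0_norm ?ge0F//; lra.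
rewrite RintegralZl// intF.
by field; lra.
Qed.

Section fixed_point.
Variable th : R.
Hypothesis th_al : al < th < pi.

(* In the variable [g / kk], the folded kernel times the extremal function, [h s ds], becomes
   [4 (1 / (1 + x ^+ 2) + 1 / (rho ^+ 2 - x ^+ 2)) dx], whence the antiderivative [N]; the half-angle
   form of the arctangent keeps it regular at [pi], where [kk] vanishes. *)
Let rho := g th / kk th.
Let v s := rho * kk s + g s.
Let w s := rho * kk s - g s.
Let h s := 2 * sg s * kk s ^+ 2 / (g s * (kk s ^+ 2 - kk th ^+ 2)).
Let N s := rho^-1 * (ln (v s ^+ 2) - ln (w s ^+ 2)) + 8 * atan (g s / (kk al + kk s)).

Let rho0 : 0 < rho /\ 0 < kk th.
Proof. by have [k0 _ _ g0] := outer th_al; rewrite divr_gt0. Qed.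

Let closed_outer s : al <= s <= pi -> [/\ 0 <= kk s, 0 <= g s & g s ^+ 2 = kk al ^+ 2 - kk s ^+ 2].
Proof.
have := al0 => al0' sal; have pi0 := @pi_gt0 R; have [a0 _] := cp_al.
have ss : sg al <= sg s by rewrite leNgt ltr_sin ?in_itv/= -?leNgt; lra.
split; [by apply: cos_ge0_pihalf; lra|exact: sqrtr_ge0|].
rewrite sqr_sqrtr; last by nra.
by rewrite /kk !cos2sin2 -/(sg al) -/(sg s); ring.
Qed.

Let kk_lt s t : 0 <= s <= pi -> 0 <= t <= pi -> (kk s < kk t) = (t < s).
Proof.
by move=> s0 t0; have pi0 := @pi_gt0 R; rewrite ltr_cos ?in_itv/=; [|lra|lra]; apply/idP/idP; lra.
Qed.

(** The product is [rho ^+ 2 * kk s ^+ 2 - g s ^+ 2], and [rho] is chosen so that it vanishes at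
    [th]. Since [v] is positive, [th] is the only zero of [w], hence the only singularity of [N]. *)
Let vwE s : al <= s <= pi ->
  v s * w s = kk al ^+ 2 * (kk s ^+ 2 - kk th ^+ 2) / kk th ^+ 2.
Proof.
move=> sal; have [_ _ gs] := closed_outer sal.
have [|_ _ gt] := @closed_outer th; first by have := th_al; lra.
have [r0 k0] := rho0.
rewrite (_ : v s * w s = rho ^+ 2 * kk s ^+ 2 - g s ^+ 2); last by rewrite /v /w; ring.
by rewrite /rho expr_div_n gs gt; field; rewrite gt_eqF.
Qed.

Let v_gt0 s : al <= s <= pi -> 0 < v s.
Proof.
move=> sal; have [k0 g0 gs] := closed_outer sal; have [r0 _] := rho0; have [_ ka0] := cp_al.
rewrite /v; have [kz|kz] := eqVneq (kk s) 0.
  rewrite kz mulr0 add0r lt0r g0 andbT; apply/negP => /eqP gz.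
  by move: gs; rewrite gz kz; nra.
by rewrite ltr_pwDl// mulr_gt0// lt0r kz.
Qed.

Let kk_sqr_gt0 s : al <= s < th -> 0 < kk s ^+ 2 - kk th ^+ 2.
Proof.
have := al0 => al0'; have := th_al => th_al' sal; have [_ kt0] := rho0.
by have : kk th < kk s by [rewrite kk_lt; lra]; nra.
Qed.

Let kk_sqr_lt0 s : th < s <= pi -> kk s ^+ 2 - kk th ^+ 2 < 0.
Proof.
have := al0 => al0'; have := th_al => th_al' sal; have [_ kt0] := rho0.
have [|k0 _ _] := @closed_outer s; first by lra.
by have : kk s < kk th by [rewrite kk_lt; lra]; nra.
Qed.

Let kk_neq s : al <= s <= pi -> s != th -> kk s ^+ 2 - kk th ^+ 2 != 0.
Proof.
move=> /andP[als spi]; case: ltgtP => // sth _.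
- by rewrite gt_eqF// kk_sqr_gt0// als.
- by rewrite lt_eqF// kk_sqr_lt0// sth.
Qed.

Let w_neq0 s : al <= s <= pi -> s != th -> w s != 0.
Proof.
move=> sal sth; suff: v s * w s != 0 by rewrite mulf_eq0 negb_or => /andP[].
have [_ kt0] := rho0; have [_ ka0] := cp_al.
rewrite vwE//; apply: mulf_neq0; last by rewrite invr_eq0 expf_neq0// gt_eqF.
by apply: mulf_neq0; [rewrite expf_neq0// gt_eqF|exact: kk_neq].
Qed.

Let den_gt0 s : al <= s <= pi -> 0 < kk al + kk s.
Proof. by move=> /closed_outer[k0 _ _]; have [_ ka0] := cp_al; lra. Qed.

Let is_derive_ln_sqr (f : R -> R) s df : f s != 0 -> is_derive s 1 f df ->
  is_derive s 1 (fun s => ln (f s ^+ 2)) (2 * df / f s).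
Proof.
move=> f0 dfs.
have d2 : is_derive s 1 (fun s => f s ^+ 2) (2 * f s * df).
  under eq_fun do rewrite expr2.
  by apply: (is_derive_eq (is_deriveM dfs dfs)); rewrite /GRing.scale /=; ring.
have f2 : 0 < f s ^+ 2 by rewrite exprn_even_gt0.
apply: (is_derive_eq (@is_derive1_comp R (@ln R) (fun s => f s ^+ 2) _ _ _ (is_derive1_ln f2) d2)).
by field.
Qed.

Let dN s : al < s < pi -> s != th -> is_derive s 1 N (h s).
Proof.
move=> sal sth; have [k0 a0 ls g0] := outer sal.
have sal' : al <= s <= pi by lra.
have [r0 kt0] := rho0; have [_ ka0] := cp_al.
have dv : is_derive s 1 v (rho * - (sg s / 2) + sg s * kk s / (2 * g s)).
  apply: (is_derive_eq (is_deriveD (is_deriveM (is_derive_cst rho _ _) (dkk s)) (dg sal))).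
  by rewrite /GRing.scale /=; ring.
have dw : is_derive s 1 w (rho * - (sg s / 2) - sg s * kk s / (2 * g s)).
  apply: (is_derive_eq (is_deriveB (is_deriveM (is_derive_cst rho _ _) (dkk s)) (dg sal))).
  by rewrite /GRing.scale /=; ring.
have vn : v s != 0 by rewrite gt_eqF// v_gt0.
have wn := w_neq0 sal' sth.
have pk := den_gt0 sal'.
have dden : is_derive s 1 (fun s => kk al + kk s) (- (sg s / 2)).
  by apply: (is_derive_eq (is_deriveD (is_derive_cst _ _ _) (dkk s))); rewrite add0r.
have dat : is_derive s 1 (fun s => atan (g s / (kk al + kk s))) (sg s / (4 * g s)).
  have dq := is_deriveM (dg sal) (@is_deriveV R (fun s => kk al + kk s) _ _ _ (lt0r_neq0 pk) dden).
  apply: (is_derive_eq (@is_derive1_comp R (@atan R) _ _ _ _ (is_derive1_atan _) dq)).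
  have [_ _ gs] := closed_outer sal'.
  rewrite /GRing.scale /= expr_div_n.
  have -> : 1 + g s ^+ 2 / (kk al + kk s) ^+ 2 = 2 * kk al / (kk al + kk s).
    by rewrite gs; field; lra.
  rewrite invf_div.
  have gkq : g s ^+ 2 + kk s * (kk al + kk s) = kk al * (kk al + kk s) by rewrite gs; ring.
  transitivity (sg s / (4 * kk al) * ((g s ^+ 2 + kk s * (kk al + kk s)) / (g s * (kk al + kk s)))).
    by field; lra.
  by rewrite gkq; field; lra.
apply: (is_derive_eq (is_deriveD (is_deriveM (is_derive_cst rho^-1 _ _)
  (is_deriveB (is_derive_ln_sqr vn dv) (is_derive_ln_sqr wn dw)))
  (is_deriveM (is_derive_cst (8 : R) _ _) dat))).
rewrite /GRing.scale /=.
have [_ _ gs] := closed_outer sal'.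
(* The logarithms give the first term, the arctangent the second. As [g s ^+ 2 + kk s ^+ 2] is the
   constant [kk al ^+ 2], it cancels against [vwE]. *)
transitivity (4 * (g s ^+ 2 + kk s ^+ 2) * sg s / (2 * g s * (v s * w s)) + 2 * sg s / g s).
  move: vn wn; rewrite /v /w => vn wn; field; rewrite vn wn; lra.
have kn := kk_neq sal' sth.
rewrite vwE// gs /h; field; lra.
Qed.

Let continuous_ln_sqr (f : R -> R) s : f s != 0 -> {for s, continuous f} ->
  {for s, continuous (fun s => ln (f s ^+ 2))}.
Proof.
move=> f0 cf; apply: (@continuous_comp _ _ _ (fun s => f s ^+ 2) (@ln R)).
  by apply: (@continuous_comp _ _ _ f (fun y => y ^+ 2)) => //; exact: exprn_continuous.
by apply: continuous_ln; rewrite exprn_even_gt0.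
Qed.

Let cv : continuous v.
Proof.
by move=> s; apply: cvgD; [apply: cvgM; [exact: cvg_cst|exact: ckk]|exact: cg].
Qed.

Let cw : continuous w.
Proof.
by move=> s; apply: cvgB; [apply: cvgM; [exact: cvg_cst|exact: ckk]|exact: cg].
Qed.

Let catan s : al <= s <= pi -> {for s, continuous (fun s => 8 * atan (g s / (kk al + kk s)))}.
Proof.
move=> sal; apply: cvgM; first exact: cvg_cst.
apply: (@continuous_comp _ _ _ (fun s => g s / (kk al + kk s)) (@atan R)).
  2: exact: continuous_atan.
apply: cvgM; first exact: cg.
apply: cvgV; first by rewrite gt_eqF// den_gt0.
by apply: cvgD; [exact: cvg_cst|exact: ckk].
Qed.

Let cN s : al <= s <= pi -> s != th -> {for s, continuous N}.
Proof.
move=> sal sth; apply: cvgD; last exact: catan.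
apply: cvgM; first exact: cvg_cst.
apply: cvgB; first by apply: continuous_ln_sqr; [rewrite gt_eqF// v_gt0|exact: cv].
by apply: continuous_ln_sqr; [exact: w_neq0|exact: cw].
Qed.

Let ch s : al < s < pi -> s != th -> {for s, continuous h}.
Proof.
move=> sal sth; have [k0 _ _ g0] := outer sal.
have ck2 t : kk s ^+ 2 @[s --> t] --> kk t ^+ 2.
  by rewrite expr2; under eq_fun do rewrite expr2; apply: cvgM; exact: ckk.
apply: cvgM.
  by apply: cvgM; last exact: ck2; apply: cvgM; [exact: cvg_cst|exact: csg].
apply: cvgV.
  by apply: mulf_neq0; [rewrite gt_eqF|apply: kk_neq => //; lra].
by apply: cvgM; [exact: cg|apply: cvgB; [exact: ck2|exact: cvg_cst]].
Qed.

Let N_al : N al = 0.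
Proof. by rewrite /N /v /w g_al addr0 subr0 subrr mulr0 mul0r atan0 mulr0 addr0. Qed.

(** The value 1 of the transform originates here: the logarithms cancel at [al] and at [pi], while
    the arctangent rises from 0 to [pi / 4]. *)
Let N_pi : N pi = 2 * pi.
Proof.
have [_ ka0] := cp_al.
rewrite /N /v /w g_pi kk_pi mulr0 add0r sub0r sqrrN subrr mulr0 add0r addr0.
by rewrite divff ?gt_eqF// atan1; field.
Qed.

Let left_integral d : 0 < d < th - al -> \int[mu]_(s in `]al, th - d[) h s = N (th - d).
Proof.
have := al0 => al0'; have := th_al => th_al'; move=> dth.
rewrite -[RHS]subr0 -N_al; apply: (@ge0_FTC2_oo R h N _ _ _ _ _ _ _).2.
- lra.
- move=> s sal; split; [apply: dN|apply: ch]; rewrite ?lt_eqF//; lra.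
- move=> s sal; have [|k0 a0 sa g0] := @outer s; first by lra.
  have kn : 0 < kk s ^+ 2 - kk th ^+ 2 by apply: kk_sqr_gt0; lra.
  by rewrite divr_ge0// ?mulr_ge0 ?(ltW g0) ?(ltW kn) ?sqr_ge0//; lra.
- by apply/cvg_at_right_filter/cN; rewrite ?lt_eqF//; lra.
- by apply/cvg_at_left_filter/cN; rewrite ?lt_eqF//; lra.
Qed.

Let right_integral d : 0 < d < pi - th ->
  \int[mu]_(s in `]th + d, pi[) h s = 2 * pi - N (th + d).
Proof.
have := al0 => al0'; have := th_al => th_al'; move=> dth.
(* Beyond [th] the integrand [h] is negative, so the result for nonnegative functions is applied to
   [- h]. *)
have [] := @ge0_FTC2_oo R (fun s => - h s) (fun s => - N s) (th + d) pi.
- lra.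
- move=> s sal; split.
    by apply: is_deriveN; apply: dN; rewrite ?gt_eqF//; lra.
  by apply: cvgN; apply: ch; rewrite ?gt_eqF//; lra.
- move=> s sal; have [|k0 a0 sa g0] := @outer s; first by lra.
  have kn : kk s ^+ 2 - kk th ^+ 2 < 0 by apply: kk_sqr_lt0; lra.
  rewrite oppr_ge0 /h mulr_ge0_le0 ?invr_le0//.
    by rewrite ?mulr_ge0 ?sqr_ge0//; lra.
  by rewrite mulr_ge0_le0// ltW.
- by apply: cvgN; apply/cvg_at_right_filter/cN; rewrite ?gt_eqF//; lra.
- by apply: cvgN; apply/cvg_at_left_filter/cN; rewrite ?gt_eqF//; lra.
move=> ih; rewrite N_pi => intN.
transitivity (\int[mu]_(s in `]th + d, pi[) (-1 * - h s)).
  by apply: eq_Rintegral => s _; rewrite mulN1r opprK.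
by rewrite RintegralZl// intN; ring.
Qed.

Let w_th : w th = 0.
Proof. by have [_ kt0] := rho0; rewrite /w /rho divfK ?subrr// gt_eqF. Qed.

Let w_beside d : 0 < d -> d < th - al -> d < pi - th -> w (th + d) != 0 /\ w (th - d) != 0.
Proof.
have := al0 => al0'; have := th_al => th_al' d0 d1 d2.
by split; apply: w_neq0; [lra|rewrite gt_eqF//; lra|lra|rewrite lt_eqF//; lra].
Qed.

(* The logarithmic singularities on the two sides of [th] cancel. *)
Let cvg_ln_w : ln (w (th - d) ^+ 2) - ln (w (th + d) ^+ 2) @[d --> 0^'+] --> (0 : R).
Proof.
have := al0 => al0'; have := th_al => th_al'; have [r0 kt0] := rho0.
have [_ a0 ls g0] := outer th_al.
(* The derivative of [w] at [th]. It is nonzero, so [w (th + d)] and [w (th - d)] have the same size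
   to first order. *)
pose W := rho * - (sg th / 2) - sg th * kk th / (2 * g th).
have W0 : W != 0.
  have h1 : 0 < rho * (sg th / 2) by rewrite mulr_gt0// divr_gt0//; lra.
  have h2 : 0 < sg th * kk th / (2 * g th) by rewrite divr_gt0 ?mulr_gt0//; lra.
  by rewrite lt_eqF// /W; lra.
have dw : is_derive th 1 w W.
  apply: (is_derive_eq (is_deriveB (is_deriveM (is_derive_cst rho _ _) (dkk th)) (dg th_al))).
  by rewrite /GRing.scale /= /W; ring.
have cquot (c : R) : c != 0 -> ln ((w (th + c * d) / (c * d)) ^+ 2) @[d --> 0^'+] --> ln (W ^+ 2).
  move=> c0; have := cvg_comp _ _ (cvg_dnbhs_right c0) (is_derive_cvg dw).
  rewrite w_th => lim1.
  have cln : {for W, continuous (fun y : R => ln (y ^+ 2))}.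
    by apply: (@continuous_ln_sqr id) => //; exact: cvg_id.
  have lim2 : w (th + c * d) / (c * d) @[d --> 0^'+] --> W.
    by move: lim1; rewrite /comp /=; under eq_fun do rewrite subr0.
  exact: (cvg_comp _ _ lim2 cln).
have N10 : -1 != 0 :> R by rewrite oppr_eq0 oner_neq0.
have lim1 : ln ((w (th + -1 * d) / (-1 * d)) ^+ 2) - ln ((w (th + 1 * d) / (1 * d)) ^+ 2)
    @[d --> 0^'+] --> (0 : R).
  rewrite -[X in _ --> X](subrr (ln (W ^+ 2))).
  by apply: cvgB; [exact: cquot|exact: cquot (oner_neq0 _)].
apply: (cvg_trans _ lim1).
apply: near_eq_cvg; near=> d.
have d0 : 0 < d by near: d; exact: nbhs_right_gt.
have d1 : d < th - al by near: d; apply: nbhs_right_lt; lra.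
have d2 : d < pi - th by near: d; apply: nbhs_right_lt; lra.
have [wP wN] := w_beside d0 d1 d2.
have sq (y : R) : y != 0 -> y ^+ 2 \is Num.pos by rewrite posrE exprn_even_gt0.
rewrite mulN1r mul1r !expr_div_n sqrrN !ln_div ?sq ?(gt_eqF d0)//.
by ring.
Unshelve. all: end_near. Qed.

Let cvg_N : N (th - d) - N (th + d) @[d --> 0^'+] --> (0 : R).
Proof.
have := al0 => al0'; have := th_al => th_al'.
pose U s := rho^-1 * ln (v s ^+ 2) + 8 * atan (g s / (kk al + kk s)).
have cU : {for th, continuous U}.
  apply: cvgD; last by apply: catan; lra.
  apply: cvgM; first exact: cvg_cst.
  by apply: continuous_ln_sqr; [rewrite gt_eqF// v_gt0//; lra|exact: cv].
have cU' (c : R) : U (th + c * d) @[d --> 0^'+] --> U th.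
  apply: cvg_at_right_filter; apply: (cvg_comp (fun d => th + c * d) U _ cU).
  have lim : th + c * d @[d --> (0 : R)] --> th + c * 0.
    by apply: cvgD; [exact: cvg_cst|apply: cvgM; [exact: cvg_cst|exact: cvg_id]].
  by rewrite mulr0 addr0 in lim.
rewrite (_ : (fun d => _) = (fun d => U (th + -1 * d) - U (th + 1 * d) -
   rho^-1 * (ln (w (th - d) ^+ 2) - ln (w (th + d) ^+ 2)))); last first.
  by apply/funext => d; rewrite mulN1r mul1r /N /U; ring.
rewrite -[X in _ --> X]subr0 -[X in _ --> X - _](subrr (U th)) -[X in _ --> _ - X](mulr0 rho^-1).
apply: cvgB; first by apply: cvgB; exact: cU'.
by apply: cvgM; [exact: cvg_cst|exact: cvg_ln_w].
Qed.

(** What is left of the folded integrand within distance [d] of [th]: only the contribution of the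
    mirror point [- s], which is regular there. *)
Let q s := - (kk s / g s * cot ((th + s) / 2)).

Let sin_gt0 s : 0 < s < pi -> 0 < sin ((th + s) / 2).
Proof. by move=> sp; have := al0; have := th_al => ? ?; apply: sin_gt0_pi; lra. Qed.

Let cvg_middle : \int[mu]_(s in `]th - d, th + d]) q s @[d --> 0^'+] --> (0 : R).
Proof.
have := al0 => al0'; have := th_al => th_al'.
apply: (@cvg_Rintegral_shrink R q th (Num.min (th - al) (pi - th) / 2)).
  by rewrite divr_gt0// lt_min; lra.
have : Num.min (th - al) (pi - th) <= th - al by rewrite ge_min lexx.
have : Num.min (th - al) (pi - th) <= pi - th by rewrite ge_min lexx orbT.
set r := Num.min _ _ => r1 r2 s sr.
have sal : al < s < pi by lra.
apply: cvgN; apply: cvgM; first exact: ckg.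
apply: cvgM.
  apply: (@continuous_comp _ _ _ (fun s => (th + s) / 2) cos); last exact: continuous_cos.
  by apply: cvgM; [apply: cvgD; [exact: cvg_cst|exact: cvg_id]|exact: cvg_cst].
apply: cvgV; first by rewrite gt_eqF// sin_gt0//; lra.
apply: (@continuous_comp _ _ _ (fun s => (th + s) / 2) sin); last exact: continuous_sin.
by apply: cvgM; [apply: cvgD; [exact: cvg_cst|exact: cvg_id]|exact: cvg_cst].
Qed.

Let cotN x : cot (- x) = - cot x.
Proof. by rewrite /cot cosN sinN invrN mulrN. Qed.

Let truncated_kernelN t e s : truncated_kernel (- t) e s = - truncated_kernel t e (- s).
Proof.
rewrite /truncated_kernel (_ : (- t - s) / 2 = - ((t - - s) / 2)); last by field.
by rewrite sinN normrN cotN; case: ifP => // _; rewrite oppr0.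
Qed.

(** Truncation at the chord [2 * sin (d / 2)] is truncation at the angle [d], the half-angle sine
    being increasing on [[0, pi]]. *)
Let sin_half_lt d x : 0 <= d <= pi -> `|x| <= pi ->
  (2 * sin (d / 2) < 2 * `|sin (x / 2)|) = (d < `|x|).
Proof.
move=> d0 xpi; have pi0 := @pi_gt0 R.
have -> : `|sin (x / 2)| = sin (`|x| / 2).
  have [x0|x0] := lerP 0 x; first by rewrite ger0_norm ?sin_ge0_pi//; move: xpi; rewrite ger0_norm//; lra.
  have -> : `|x| / 2 = - (x / 2) by rewrite ltr0_norm//; field.
  rewrite sinN ler0_norm// -oppr_ge0 -sinN; apply: sin_ge0_pi.
  by move: xpi; rewrite ltr0_norm//; lra.
have x0 := normr_ge0 x; rewrite ltr_pM2l// ltr_sin ?in_itv/=; [|lra|lra].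
by rewrite ltr_pM2r.
Qed.

Let kernel_near d s : 0 < d <= pi -> al < s < pi -> truncated_kernel th (2 * sin (d / 2)) s =
  if d < `|th - s| then cot ((th - s) / 2) else 0.
Proof.
have := al0 => al0'; have := th_al => th_al' d0 sal.
by rewrite /truncated_kernel sin_half_lt//; [lra|rewrite ler_norml; lra].
Qed.

(** The mirror point [- s] is never truncated: both ways around the circle, [th + s] and
    [2 * pi - th - s], it is farther than [d] from [th]. *)
Let kernel_far d s : 0 < d < th -> d < pi - th -> al < s < pi ->
  truncated_kernel th (2 * sin (d / 2)) (- s) = cot ((th + s) / 2).
Proof.
have := al0 => al0'; have := th_al => th_al' d0 dpi sal.
rewrite /truncated_kernel opprK ifT//.
have [s1|s1] := lerP (th + s) pi.
  rewrite sin_half_lt; [rewrite gtr0_norm; lra|lra|rewrite ger0_norm; lra].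
have -> : sin ((th + s) / 2) = sin ((2 * pi - th - s) / 2).
  rewrite (_ : (2 * pi - th - s) / 2 = pi - (th + s) / 2); last by field.
  by rewrite sinB sinpi cospi mul0r sub0r mulN1r opprK.
rewrite sin_half_lt; [rewrite gtr0_norm; lra|lra|rewrite ger0_norm; lra].
Qed.

Let P d s := kk s / g s * ((if d < `|th - s| then cot ((th - s) / 2) else 0) - cot ((th + s) / 2)).

Let P_far d s : al < s < pi -> 0 < d < `|th - s| -> P d s = h s.
Proof.
have := al0 => al0'; have := th_al => th_al' sal /andP[d0 ds].
have [k0 _ _ g0] := outer sal.
have sth : s != th by apply: contraTneq ds => ->; rewrite subrr normr0 -leNgt ltW.
have kn : kk s ^+ 2 - kk th ^+ 2 != 0 by apply: kk_neq => //; lra.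
have sE : sin ((th - s) / 2) * sin ((th + s) / 2) = kk s ^+ 2 - kk th ^+ 2.
  rewrite mulrBl mulrDl sinB sinD -/(sg th) -/(sg s) -/(kk th) -/(kk s).
  rewrite (_ : _ * _ = sg th ^+ 2 * kk s ^+ 2 - kk th ^+ 2 * sg s ^+ 2); last by ring.
  by rewrite /sg !sin2cos2 -/(kk th) -/(kk s); ring.
have cE : cos ((th - s) / 2) * sin ((th + s) / 2) - cos ((th + s) / 2) * sin ((th - s) / 2) = 2 * sg s * kk s.
  rewrite [X in X - _]mulrC -sinB (_ : (th + s) / 2 - (th - s) / 2 = (s / 2) *+ 2); last by rewrite mulr2n; field.
  by rewrite sin_mulr2n -/(sg s) -/(kk s); ring.
have := kn; rewrite -sE mulf_eq0 negb_or => /andP[s1 s2].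
rewrite /P ds /cot -mulNr addf_div// sE [X in _ * (X / _)](_ : _ = 2 * sg s * kk s); last by rewrite -cE; ring.
by rewrite /h; field; rewrite kn gt_eqF.
Qed.

Let P_near d s : `|th - s| <= d -> P d s = q s.
Proof. by rewrite /P leNgt => /negbTE ->; rewrite sub0r mulrN. Qed.

Let small d := 0 < d < th - al /\ d < pi - th.

Let integrable_P d : small d -> mu.-integrable `]al, pi[ (EFin \o P d).
Proof.
have := al0 => al0'; have := th_al => th_al' [d1 d2].
have e0 : 0 < 2 * sin (d / 2) by rewrite mulr_gt0//; apply: sin_gt0_pi; lra.
have iT t : mu.-integrable `[- pi, pi] (EFin \o (fun s => F s * truncated_kernel t (2 * sin (d / 2)) s)).
  by apply: integrable_truncated_kernel => //; exact: L1_extremal_function.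
have iD := @integrableD _ _ R mu _ (measurable_itv _) _ _ (iT th) (iT (- th)).
have iD' : mu.-integrable `]al, pi[ (EFin \o (fun s => F s * truncated_kernel th (2 * sin (d / 2)) s +
    F s * truncated_kernel (- th) (2 * sin (d / 2)) s)).
  apply: integrableS iD => // s; rewrite /= !in_itv /=; lra.
apply: eq_integrable iD'; first exact: measurable_itv.
move=> s /set_mem /=; rewrite in_itv /= => sal; congr EFin.
rewrite truncated_kernelN kernel_near ?kernel_far//; [|lra|lra].
by rewrite extremal_function_outer// /P; ring.
Qed.

(** Oddness of [F] folds the integral onto the upper arc. The kernel changes sign when [t] and [s]
    both do, so the result is even in [t] and one computation serves both halves of the arc. *)
Let truncated_hilbert_folded t d : small d -> t = th \/ t = - th ->
  truncated_hilbert (extremal_function al) t (2 * sin (d / 2)) =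
  (2 * pi)^-1 * \int[mu]_(s in `]al, pi[) P d s.
Proof.
have := al0 => al0'; have := th_al => th_al' [d1 d2] tE.
have e0 : 0 < 2 * sin (d / 2) by rewrite mulr_gt0//; apply: sin_gt0_pi; lra.
rewrite truncated_hilbertE ?(ltW e0)//; congr (_ * _).
rewrite Rintegral_fold; last 3 first.
- by lra.
- apply: measurable_funM; first exact: measurable_extremal_function.
  exact: measurable_truncated_kernel.
- by apply: integrable_truncated_kernel => //; exact: L1_extremal_function.
transitivity (\int[mu]_(s in `[0, pi]) (F s * (truncated_kernel th (2 * sin (d / 2)) s -
    truncated_kernel th (2 * sin (d / 2)) (- s)))).
  apply: eq_Rintegral => s _; rewrite -/(F s) -/(F (- s)) extremal_functionN.
  by case: tE => ->; rewrite ?truncated_kernelN ?opprK; ring.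
rewrite (@Rintegral_vanish R _ `]al, pi[).
- apply: eq_Rintegral => s /set_mem /=; rewrite in_itv /= => sal.
  by rewrite kernel_near ?kernel_far ?extremal_function_outer//; lra.
- by move=> s /=; rewrite !in_itv /=; lra.
- by move=> s /=; rewrite !in_itv /= => s1 s2; rewrite extremal_function_outside ?mul0r.
Qed.

Let integral_P d : small d -> \int[mu]_(s in `]al, pi[) P d s =
  2 * pi + (N (th - d) - N (th + d)) + \int[mu]_(s in `]th - d, th + d]) q s.
Proof.
have := al0 => al0'; have := th_al => th_al' dd; have [d1 d2] := dd.
have iP := integrable_P dd.
have iP1 : mu.-integrable `]al, th - d[ (EFin \o P d).
  by apply: integrableS iP => // s; rewrite /= !in_itv /=; lra.
have iP2 : mu.-integrable `]th - d, pi[ (EFin \o P d).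
  by apply: integrableS iP => // s; rewrite /= !in_itv /=; lra.
have := @Rintegral_itvB R (P d) (BRight al) (BLeft pi) (th - d) iP.
rewrite !bnd_simp -Rintegral_itv_bndo_bndc// => /(_ _ _)/(canRL (subrK _)) ->; [|lra|lra].
have := @Rintegral_itvB R (P d) (BRight (th - d)) (BLeft pi) (th + d) iP2.
rewrite !bnd_simp => /(_ _ _)/(canRL (subrK _)) ->; [|lra|lra].
have -> : \int[mu]_(s in `]al, th - d[) P d s = N (th - d).
  rewrite -left_integral//; apply: eq_Rintegral => s /set_mem /=; rewrite in_itv /= => sal.
  by apply: P_far; [lra|rewrite gtr0_norm; lra].
have -> : \int[mu]_(s in `]th + d, pi[) P d s = 2 * pi - N (th + d).
  rewrite -right_integral; last by lra.
  apply: eq_Rintegral => s /set_mem /=; rewrite in_itv /= => sal.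
  by apply: P_far; [lra|rewrite ltr0_norm; lra].
have -> : \int[mu]_(s in `]th - d, th + d]) P d s = \int[mu]_(s in `]th - d, th + d]) q s.
  apply: eq_Rintegral => s /set_mem /=; rewrite in_itv /= => sal.
  by apply: P_near; rewrite ler_norml; lra.
ring.
Qed.

Lemma cvg_truncated_hilbert_extremal t : t = th \/ t = - th ->
  truncated_hilbert (extremal_function al) t e @[e --> 0^'+] --> (1 : R).
Proof.
have := al0 => al0'; have := th_al => th_al' tE; have pi0 := @pi_gt0 R.
pose Q d := (2 * pi)^-1 * (2 * pi + (N (th - d) - N (th + d)) + \int[mu]_(s in `]th - d, th + d]) q s).
have cQ : Q d @[d --> 0^'+] --> (1 : R).
  have -> : 1 = (2 * pi)^-1 * (2 * pi + 0 + 0) :> R by field; lra.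
  apply: cvgM; first exact: cvg_cst.
  apply: cvgD; last exact: cvg_middle.
  by apply: cvgD; [exact: cvg_cst|exact: cvg_N].
(* The angle subtended by a chord of length [e]; it carries limits in [d] to limits in [e]. *)
pose del (e : R) := 2 * asin (e / 2).
have asin0 : asin 0 = 0 :> R by rewrite -[X in asin X]sin0 sinK// in_itv/=; lra.
have cdel : del e @[e --> (0 : R)] --> (0 : R).
  have : del e @[e --> (0 : R)] --> del 0.
    apply: cvgM; first exact: cvg_cst.
    have ca : {for (0 / 2 : R), continuous asin} by apply: continuous_asin; lra.
    apply: (@continuous_comp _ _ _ (fun e : R => e / 2) asin) => //.
    by apply: cvgM; [exact: cvg_id|exact: cvg_cst].
  by rewrite {2}/del mul0r asin0 mulr0.
have del_lt (c : R) : 0 < c -> \forall e \near 0^'+, del e < c.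
  by move=> c0; apply: (cvgr_lt 0 _ _ c0); exact: cvg_at_right_filter.
have del0 (e : R) : 0 < e < 1 -> 0 < del e.
  move=> e01; rewrite mulr_gt0// ltNge; apply/negP => hle.
  have : sin (asin (e / 2)) <= 0.
    have ap : - (pi / 2) <= asin (e / 2) by apply: asin_geNpi2; lra.
    by rewrite -oppr_ge0 -sinN sin_ge0_pi//; lra.
  by rewrite asinK ?in_itv/=; lra.
have cdelr : del e @[e --> 0^'+] --> 0^'+.
  move=> A [r /= r0 rA]; have : \forall e \near 0^'+, A (del e); last by [].
  near=> e; apply: rA => /=; last first.
    by apply: del0; apply/andP; split; near: e; [exact: nbhs_right_gt|exact: nbhs_right_lt].
  near: e; have /cvgrPdist_lt := cvg_at_right_filter cdel; exact.
apply: (cvg_trans _ (cvg_comp _ _ cdelr cQ)).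
apply: near_eq_cvg; near=> e => /=.
have e1 : 0 < e < 1 by apply/andP; split; near: e; [exact: nbhs_right_gt|exact: nbhs_right_lt].
have de : small (del e).
  split; first rewrite del0//=; near: e; apply: del_lt; lra.
rewrite /Q -integral_P// -(truncated_hilbert_folded de tE); congr (truncated_hilbert _ _ _).
by rewrite /del [2 * _ / 2](_ : _ = asin (e / 2)) ?asinK ?in_itv/=; [field|lra|field].
Unshelve. all: end_near. Qed.

End fixed_point.

(** Only this inequality requires computing the transform; the reverse one will be the weak-type
    bound itself. Dropping the ends of the two open arcs costs no length. *)
Lemma arclength_extremal_ge :
  ((2 * (pi - al))%:E <= arclength [set xi | 1 <= hilbert (extremal_function al) xi]%R)%E.
Proof.
have := al0 => al0'.
pose A := `]- pi, - al[%classic : set R; pose B := `]al, pi[%classic : set R.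
have muA : mu A = (pi - al)%:E.
  rewrite lebesgue_measure_itv /= lte_fin ifT; last by lra.
  by rewrite -EFinB; congr EFin; ring.
have muB : mu B = (pi - al)%:E by rewrite lebesgue_measure_itv /= lte_fin ifT//; lra.
have AB0 : A `&` B = set0.
  by apply/seteqP; split => x //; rewrite /A /B /= !in_itv /=; lra.
have -> : (2 * (pi - al))%:E = mu (A `|` B).
  rewrite measureU; [|exact: measurable_itv|exact: measurable_itv|exact: AB0].
  rewrite [X in (X + _)%E]muA [X in (_ + X)%E]muB.
  by rewrite -EFinD; congr EFin; ring.
apply: lebesgue_measure_le => t; rewrite /A /B /= !in_itv /= => tAB.
split; first by case: tAB; lra.
rewrite hilbertE; suff -> : lim (truncated_hilbert (extremal_function al) t e @[e --> 0^'+]) = 1.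
  by [].
apply: cvg_lim => //.
case: tAB => tal.
  by apply: (@cvg_truncated_hilbert_extremal (- t)); [lra|rewrite opprK; right].
by apply: (@cvg_truncated_hilbert_extremal t); [lra|left].
Qed.

End fixed_angle.

Theorem hilbert_weak_type_sharp (m : R) : 0 <= m < 1 ->
  exists f : circle R -> R,
    [/\ L1_circle f,
        (arclength [set xi | 1 <= hilbert f xi]%R = (2 * pi * m)%:E)%E &
        extremal_rate (L1norm_circle f) = m].
Proof.
move=> m01; have pi0 := @pi_gt0 R.
have lo (A : set R) : (0 <= mu A)%E.
  by rewrite -(measure0 mu); exact: lebesgue_measure_le.
(* For [m = 0] the arc would degenerate ([al = pi]); the zero function serves instead. *)
have [m0|m0] := eqVneq m 0.
  have iL : L1_circle (cst 0 : circle R -> R).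
    by apply: (@continuous_integrable_itv R (cst 0)) => s; exact: cvg_cst.
  have L0 : extremal_rate (L1norm_circle (cst 0 : circle R -> R)) = 0.
    rewrite /L1norm_circle (_ : Rintegral _ _ _ = 0) ?mulr0; last first.
      under eq_Rintegral do rewrite /= normr0.
      by rewrite Rintegral_itv_cst ?mul0r//; lra.
    by rewrite /extremal_rate mulr0 expR0 atan1; field; lra.
  exists (cst 0); split => //; last by rewrite m0.
  apply/eqP; rewrite eq_le m0 mulr0 lo andbT.
  by have := hilbert_weak_type iL; rewrite L0 mulr0.
(* [al = pi * (1 - m)] gives the arc its length [2 * (pi - al) = 2 * pi * m]. *)
have al0 : 0 < pi * (1 - m) < pi by apply/andP; split; nra.
have t0 : - (pi / 2) < pi * m / 2 < pi / 2 by apply/andP; split; nra.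
have rate : extremal_rate (L1norm_circle (extremal_function (pi * (1 - m)))) = m.
  rewrite L1norm_extremal_function//.
  have aE : pi * (1 - m) / 2 = pi / 2 - pi * m / 2 by field.
  have -> : cos (pi * (1 - m) / 2) = sin (pi * m / 2).
    by rewrite aE cosB cos_pihalf sin_pihalf mul0r mul1r add0r.
  have -> : sin (pi * (1 - m) / 2) = cos (pi * m / 2).
    by rewrite aE sinB cos_pihalf sin_pihalf mul0r mul1r subr0.
  have c0 : 0 < cos (pi * m / 2) by apply: cos_gt0_pihalf.
  have s0 : 0 <= sin (pi * m / 2) by apply: sin_ge0_pi; apply/andP; split; nra.
  rewrite /extremal_rate mulrA (_ : pi / 2 * (2 / pi) = 1) ?mul1r; last by field; lra.
  rewrite lnK ?posrE ?divr_gt0//; last by lra.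
  by rewrite atan_1Dsin_cos//; field; lra.
have iL := L1_extremal_function al0.
exists (extremal_function (pi * (1 - m))); split => //.
have up := hilbert_weak_type iL; rewrite rate in up.
apply/eqP; rewrite eq_le up.
by apply: le_trans (arclength_extremal_ge al0); rewrite lee_fin; lra.
Qed.

End extremal_function.

Theorem corollary1p2 (R : realType) :
  (forall f : circle R -> R, L1_circle f ->
    ((2 * pi)^-1%:E * arclength [set xi | 1 <= hilbert f xi]%R
     <= (4 / pi * atan (expR (pi / 2 * L1norm_circle f)) - 1)%:E)%E) /\
  (forall m : R, 0 <= m < 1 ->
    exists f : circle R -> R,
      [/\ L1_circle f,
          ((2 * pi)^-1%:E * arclength [set xi | 1 <= hilbert f xi]%R = m%:E)%E &
          4 / pi * atan (expR (pi / 2 * L1norm_circle f)) - 1 = m]).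
Proof.
have pi0 := @pi_gt0 R; split => [f /hilbert_weak_type le|m /hilbert_weak_type_sharp].
  rewrite -(@lee_pmul2l _ (2 * pi)%:E)//; last by rewrite lte_fin; lra.
  by rewrite muleA -!EFinM mulfV ?mul1e//; lra.
move=> [f [iL aE rE]]; exists f; split => //.
by rewrite aE -EFinM; congr EFin; field; lra.
Qed.
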